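(* Let $m\geq 2$ be an integer. Then: (1) There is a monic polynomial $F_m(x)\in\mathbb Z[x]$ of degree $m$ such that, for all $\tau$ in the upper half-plane $\mathbb H$, $$F_m(j(\tau))=\frac{E_4(\tau)E_6(\tau)}{11!}\cdot\Big(m^{11}\,\big(M_\Delta\,|\,T_{-10}(m)\big)(\tau)-\tau(m)\,M_\Delta(\tau)\Big).$$ (2) This polynomial is given by $$F_m(x)=\psi_m(x)+\frac{247944\,\tau(m)}{691}-\frac{65520\,\sigma_{11}(m)}{691}-264\,\sigma_9(m)-264\sum_{l=1}^{m-2}\sigma_9(l)\,\psi_{m-l}(x)-\big(\tau(m)+264\,\sigma_9(m-1)\big)\psi_1(x).$$
   Context: Throughout, $\tau=u+iv\in\mathbb H$ and $q=e^{2\pi i\tau}$; $e(x):=e^{2\pi i x}$. $\sigma_\nu(n)=\sum_{d\mid n}d^\nu$. $E_4(\tau)=1+240\sum_{n\ge1}\sigma_3(n)q^n$ and $E_6(\tau)=1-504\sum_{n\ge1}\sigma_5(n)q^n$ are the usual Eisenstein series, $\Delta(\tau)=\sum_{n\ge1}\tau(n)q^n=(E_4^3-E_6^2)/1728$ is Ramanujan's cusp form (so $\tau(m)$ denotes Ramanujan's tau function, not the variable $\tau$), and $j(\tau)=E_4(\tau)^3/\Delta(\tau)=q^{-1}+744+\cdots$. For $m\ge0$, $\psi_m(x)$ is the unique polynomial such that $\psi_m(j(\tau))=j_m(\tau)$, where $j_0=1$ and for $m\ge1$, $j_m$ is the unique modular function on $\mathrm{SL}_2(\mathbb Z)$, holomorphic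 on $\mathbb H$, with $q$-expansion $q^{-m}+\sum_{n\ge1}c_m(n)q^n$ (e.g. $\psi_1(x)=x-744$). Kloosterman sum: $K(m,n,c)=\sum_{v \bmod c,\ \gcd(v,c)=1} e\big((m\bar v+nv)/c\big)$, where $\bar v$ is the inverse of $v$ mod $c$. $I_{11}$ is the modified Bessel function of the first kind, $B_{12}=-691/2730$ is the 12th Bernoulli number. The mock modular form $M_\Delta$ is the holomorphic function on $\mathbb H$ $$M_\Delta(\tau)=11!\,q^{-1}+\frac{24\cdot 11!}{B_{12}}+\sum_{n\ge1}a_\Delta(n)q^n,\qquad a_\Delta(n)=-2\pi\,\Gamma(12)\,n^{-11/2}\sum_{c=1}^\infty\frac{K(-1,n,c)}{c}\,I_{11}\!\Big(\frac{4\pi\sqrt n}{c}\Big).$$ (It is the holomorphic part of a weight $-10$ harmonic Maass form on $\mathrm{SL}_2(\mathbb Z)$ whose nonholomorphic part is a period integral of $\Delta$.) For a function $f$ on $\mathbb H$, integer weight $k$ and $m\ge1$, the Hecke operator is $$(f\,|\,T_k(m))(\tau)=m^{k-1}\sum_{ad=m,\ a,d>0}\frac{1}{d^k}\sum_{b \bmod d} f\Big(\frac{a\tau+b}{d}\Big).$$ *)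

(* Defs.v *)
From HB Require Import structures.
From mathcomp Require Import all_boot all_order all_algebra.
From mathcomp Require Import complex.
From mathcomp Require Import all_classical all_reals all_analysis.

Set Implicit Arguments.
Unset Strict Implicit.
Unset Printing Implicit Defensive.

Import Order.TTheory GRing.Theory Num.Theory.
Import numFieldNormedType.Exports.

Local Open Scope classical_set_scope.
Local Open Scope ring_scope.
Local Open Scope complex_scope.

(* R[i] carries no topology in the libraries; it receives here the one of the
   normed module R[i]^o, i.e., the topology of the complex modulus. *)
HB.instance Definition _ (R : rcfType) := NormedModule.copy R[i] R[i]^o.

Local Notation "\sum_ ( m <= i '<oo' ) F" :=
  (\big[+%R/0%R]_(m <= i <oo) F%R) : ring_scope.

Definition sigma (nu n : nat) : nat := (\sum_(d <- divisors n) d ^ nu)%N.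

Definition E4_coef (n : nat) : int :=
  if n == 0%N then 1 else 240 * (sigma 3 n)%:Z.

Definition E6_coef (n : nat) : int :=
  if n == 0%N then 1 else - (504 * (sigma 5 n)%:Z).

Definition cauchy_product (u v : nat -> int) (n : nat) : int :=
  \sum_(i < n.+1) u i * v (n - i)%N.

(* Ramanujan's tau: the n-th coefficient of the formal power series
   (E4 ^ 3 - E6 ^ 2) / 1728. *)
Definition ramanujan_tau (n : nat) : rat :=
  (cauchy_product E4_coef (cauchy_product E4_coef E4_coef) n
   - cauchy_product E6_coef E6_coef n)%:~R / 1728.

(* If v is coprime to c then v * inv_mod c v = 1 %[mod c]; this holds
   trivially for c = 1, v = 0. *)
Definition inv_mod (c v : nat) : nat := (egcdn v c).1.

Section ModularForms.
Variable R : realType.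
Local Notation C := R[i].

Definition upper_half_plane : set C := [set z | 0 < complex.Im z].

Definition expC (z : C) : C :=
  (expR (complex.Re z))%:C * (cos (complex.Im z) +i* sin (complex.Im z)).

Definition e (z : C) : C := expC (2 * pi%:C * 'i * z).

Definition E4 (z : C) : C :=
  1 + 240 * \sum_(1 <= n <oo) ((sigma 3 n)%:R * e z ^+ n : C).

Definition E6 (z : C) : C :=
  1 - 504 * \sum_(1 <= n <oo) ((sigma 5 n)%:R * e z ^+ n : C).

Definition Delta (z : C) : C := (E4 z ^+ 3 - E6 z ^+ 2) / 1728.

Definition j (z : C) : C := E4 z ^+ 3 / Delta z.

Definition holomorphic_on (D : set C) (f : C -> C) : Prop :=
  forall z, D z -> derivable f z 1.

Definition SL2Z_invariant (f : C -> C) : Prop :=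
  forall a b c d : int, a * d - b * c = 1 ->
  forall z, upper_half_plane z ->
    f ((a%:~R * z + b%:~R) / (c%:~R * z + d%:~R)) = f z.

Definition is_j_fun (m : nat) (f : C -> C) : Prop :=
  [/\ holomorphic_on upper_half_plane f,
      SL2Z_invariant f &
      exists c : nat -> C, forall z, upper_half_plane z ->
        e z ^- m + \sum_(1 <= n < N) c n * e z ^+ n @[N --> \oo] --> f z].

(* Only the restriction of j_fun m to the upper half-plane is determined. *)
Definition j_fun (m : nat) : C -> C :=
  if m == 0%N then fun=> 1 else xget (fun=> 0) [set f | is_j_fun m f].

Definition psi (m : nat) : {poly C} :=
  xget 0 [set P : {poly C} |
            forall z, upper_half_plane z -> P.[j z] = j_fun m z].

Definition kloosterman (m n : int) (c : nat) : C :=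
  \sum_(v < c | coprime v c)
    e ((m * (inv_mod c v)%:Z + n * v%:Z)%:~R / c%:R).

(* The modified Bessel function I_nu of the first kind, of integral order. *)
Definition besselI (nu : nat) (x : R) : R :=
  \sum_(0 <= k <oo) ((x / 2) ^+ (2 * k + nu) / (k`! * (k + nu)`!)%:R : R).

(* The factor 11`! is Gamma(12). *)
Definition a_Delta (n : nat) : C :=
  (- (2 * pi * 11`!%:R * n%:R `^ (- (11 / 2))))%:C
  * \sum_(1 <= c <oo)
      (kloosterman (-1) n%:Z c / c%:R
       * (besselI 11 (4 * pi * Num.sqrt n%:R / c%:R))%:C : C).

(* B_12, the twelfth Bernoulli number. *)
Definition B12 : C := - (691 / 2730).

Definition M_Delta (z : C) : C :=
  11`!%:R * (e z)^-1 + 24 * 11`!%:R / B12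
  + \sum_(1 <= n <oo) (a_Delta n * e z ^+ n : C).

(* The pairs (a, d) with a * d = m are indexed by d, with a = m %/ d. *)
Definition hecke (k : int) (m : nat) (f : C -> C) (z : C) : C :=
  m%:R ^ (k - 1)
  * \sum_(d <- divisors m)
      (d%:R ^ k)^-1
      * \sum_(b < d) f (((m %/ d)%:R * z + b%:R) / d%:R).

End ModularForms.

(* Main.v *)
(* Let G = q^-m + O(q^-1) be the form E4^2 E6 / Delta^2 * P(j) of weight -10, with
   P an integral polynomial of degree m - 2, and F = X (X - 1728) P, so that
   F(j) = E4 E6 G. The constant term of a weakly holomorphic form of weight 2
   vanishes. Multiplying G by the weight 12 forms Delta, E12 and P_1 | T(n), where
   P_1 = q^-1 + O(q) is the Poincare series of index -1, this determines the
   coefficients of G at q^-1, q^0 and q^n. The coefficients of P_1 are the series of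
   Kloosterman sums and Bessel functions defining a_Delta, by Lipschitz's formula,
   hence G is the combination of M_Delta | T(m) and M_Delta in the theorem. The
   formula for F in terms of the psi_l follows by comparing the principal parts of
   both sides, using E4 E6 = E10: a modular function, holomorphic on the upper
   half-plane, that vanishes at the cusp is zero. *)

Require Import Defs.
From mathcomp Require Import all_boot all_order all_algebra.
From mathcomp Require Import complex ring lra zify.
From mathcomp Require Import all_classical all_reals all_analysis.

Set Implicit Arguments.
Unset Strict Implicit.
Unset Printing Implicit Defensive.

Import Order.TTheory GRing.Theory Num.Theory.
Import numFieldNormedType.Exports.

Local Open Scope ring_scope.
Local Open Scope complex_scope.

(** Dividing by Delta is the obstacle that shapes the analytic half: 1/Delta enters G and j, so
    Delta has to be bounded below. This is done numerically near the cusp, transported by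
    modularity, and then turned into convergence of the formal reciprocal series. Cauchy's estimate
    comes from averages over equidistant points. P is fixed by asking that G have no terms from
    q^(1-m) to q^-2. For h of weight 12, only the m-th coefficient of h, its coefficients at q and
    q^0 and its principal part then meet G in the constant term of G h: Delta, without constant
    term, isolates q^-1; E12 then gives q^0; P_1 | T(n), again without constant term, gives q^n.
    What comes out is the m-th coefficient of P_1 | T(n). Up to the factor -11! it is the n-th
    coefficient of m^11 M_Delta | T(m), since both are the same sum over the common divisors of m
    and n. The numbers 691 and 65520 come from the case m = 2, with E4^3 as a further form of weight
    12. *)

(** * The real-valued modulus and limits of complex sequences *)

Section Modulus.
Variable R : realType.
Local Notation C := R[i].
Implicit Types (x y z : C).

(** The norm of [R[i]] has complex values; this copy lives in the total order of [R], where [lra]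
    and [nra] apply. *)
Definition nm z : R := Num.sqrt (complex.Re z ^+ 2 + complex.Im z ^+ 2).

Lemma normE z : `|z| = (nm z)%:C. Proof. exact: normc_def. Qed.

Lemma nm_ge0 z : 0 <= nm z. Proof. exact: sqrtr_ge0. Qed.

Lemma nmM x y : nm (x * y) = nm x * nm y.
Proof. by apply: complexI; rewrite rmorphM /= -!normE normrM. Qed.

Lemma nmD x y : nm (x + y) <= nm x + nm y.
Proof. by rewrite -lecR rmorphD /= -!normE ler_normD. Qed.

Lemma nmN x : nm (- x) = nm x.
Proof. by apply: complexI; rewrite -!normE normrN. Qed.

Lemma nmB x y : nm (x - y) <= nm x + nm y.
Proof. by rewrite -(nmN y) nmD. Qed.

Lemma nm_distC x y : nm (x - y) = nm (y - x).
Proof. by rewrite -nmN opprB. Qed.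

Lemma nmB_ge x y : nm x - nm y <= nm (x - y).
Proof. by rewrite lerBlDr -{1}(subrK y x) nmD. Qed.

Lemma nm_real (a : R) : nm a%:C = `|a|.
Proof. by rewrite /nm /= expr0n addr0 sqrtr_sqr. Qed.

Lemma nm0 : nm 0 = 0.
Proof. by rewrite (nm_real 0) normr0. Qed.

Lemma nm1 : nm 1 = 1.
Proof. by rewrite (nm_real 1) normr1. Qed.

Lemma nm_eq0 z : (nm z == 0) = (z == 0).
Proof. by rewrite -(inj_eq (@complexI R)) -normE normr_eq0. Qed.

Lemma nm_gt0 z : (0 < nm z) = (z != 0).
Proof. by rewrite lt0r nm_eq0 nm_ge0 andbT. Qed.

Lemma nmV z : nm z^-1 = (nm z)^-1.
Proof.
have [->|z0] := eqVneq z 0; first by rewrite invr0 nm0 invr0.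
apply: (mulfI (x := nm z)); first by rewrite nm_eq0.
by rewrite -nmM mulfV // nm1 mulfV // nm_eq0.
Qed.

Lemma nmX z n : nm (z ^+ n) = nm z ^+ n.
Proof. by elim: n => [|n IH]; rewrite ?expr0 ?nm1 // !exprS nmM IH. Qed.

Lemma nm_nat n : nm n%:R = n%:R.
Proof. by rewrite -(rmorph_nat (real_complex R)) nm_real ger0_norm ?ler0n. Qed.

Lemma nm_int (n : int) : nm n%:~R = `|n|%:~R.
Proof. by rewrite -(rmorph_int (real_complex R)) nm_real intr_norm. Qed.

Lemma nm_i : nm 'i = 1.
Proof. by rewrite /nm /= expr0n expr1n add0r sqrtr1. Qed.

Lemma nm_sqr z : nm z ^+ 2 = complex.Re z ^+ 2 + complex.Im z ^+ 2.
Proof. by rewrite sqr_sqrtr // addr_ge0 ?sqr_ge0. Qed.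

Lemma Re_le_nm z : `|complex.Re z| <= nm z.
Proof. by rewrite -(@ler_pXn2r _ 2) ?nnegrE ?nm_ge0 // nm_sqr real_normK ?num_real // lerDl sqr_ge0. Qed.

Lemma Im_le_nm z : `|complex.Im z| <= nm z.
Proof. by rewrite -(@ler_pXn2r _ 2) ?nnegrE ?nm_ge0 // nm_sqr real_normK ?num_real // lerDr sqr_ge0. Qed.

Lemma nm_le_ReIm z : nm z <= `|complex.Re z| + `|complex.Im z|.
Proof.
rewrite {1}(complexE z); apply: (le_trans (nmD _ _)).
by rewrite nmM nm_i mul1r !nm_real.
Qed.

Lemma nm_sum (I : Type) (r : seq I) (P : pred I) (F : I -> C) :
  nm (\sum_(i <- r | P i) F i) <= \sum_(i <- r | P i) nm (F i).
Proof.
elim/big_ind2: _ => [|a b c d h1 h2|//]; first by rewrite nm0.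
by apply: (le_trans (nmD _ _)); apply: lerD.
Qed.

Lemma cReD x y : complex.Re (x + y) = complex.Re x + complex.Re y.
Proof. by case: x y => [? ?] [? ?]. Qed.
Lemma cImD x y : complex.Im (x + y) = complex.Im x + complex.Im y.
Proof. by case: x y => [? ?] [? ?]. Qed.
Lemma cReN x : complex.Re (- x) = - complex.Re x.
Proof. by case: x. Qed.
Lemma cImN x : complex.Im (- x) = - complex.Im x.
Proof. by case: x. Qed.
Lemma cReM x y : complex.Re (x * y) =
  complex.Re x * complex.Re y - complex.Im x * complex.Im y.
Proof. by case: x y => [? ?] [? ?]. Qed.
Lemma cImM x y : complex.Im (x * y) =
  complex.Re x * complex.Im y + complex.Im x * complex.Re y.
Proof. by case: x y => [a b] [c d] /=; rewrite mulrC [b * c]mulrC mulrC. Qed.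
Lemma Re_sum (I : Type) (r : seq I) (P : pred I) (F : I -> C) :
  complex.Re (\sum_(i <- r | P i) F i) = \sum_(i <- r | P i) complex.Re (F i).
Proof. by elim/big_rec2: _ => // i a b _ <-; rewrite cReD. Qed.
Lemma Im_sum (I : Type) (r : seq I) (P : pred I) (F : I -> C) :
  complex.Im (\sum_(i <- r | P i) F i) = \sum_(i <- r | P i) complex.Im (F i).
Proof. by elim/big_rec2: _ => // i a b _ <-; rewrite cImD. Qed.
Lemma Re_nat n : complex.Re (n%:R : C) = n%:R.
Proof. by rewrite -(rmorph_nat (real_complex R)). Qed.
Lemma Im_nat n : complex.Im (n%:R : C) = 0.
Proof. by rewrite -(rmorph_nat (real_complex R)). Qed.
Lemma Re_int (n : int) : complex.Re (n%:~R : C) = n%:~R.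
Proof. by rewrite -(rmorph_int (real_complex R)). Qed.
Lemma Im_int (n : int) : complex.Im (n%:~R : C) = 0.
Proof. by rewrite -(rmorph_int (real_complex R)). Qed.

Lemma nm_small0 z : (forall eps : R, 0 < eps -> nm z < eps) -> z = 0.
Proof.
move=> h; apply/eqP; rewrite -nm_eq0; apply: contraT => z0.
have p : 0 < nm z by rewrite lt0r z0 nm_ge0.
by have := h _ p; rewrite ltxx.
Qed.

(** Convergence with real tolerances; [cvs_cvg] identifies it with the filter convergence in which
    the notions of the theorem are phrased. *)
Definition cvs (u : nat -> C) (s : C) :=
  forall eps : R, 0 < eps -> exists N, forall n, (N <= n)%N -> nm (u n - s) < eps.

Lemma cvs_cvg u s : cvs u s <-> (u n @[n --> \oo] --> s)%classic.
Proof.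
split=> [h|/cvgrPdist_lt h].
  apply/cvgrPdist_lt => -[a b]; rewrite ltcE /= => /andP[/eqP-> a0].
  have [N hN] := h a a0; exists N => // n /= /hN.
  by rewrite -ltcR -normE distrC.
move=> eps e0; have e0' : 0 < eps%:C by rewrite ltcE /= eqxx.
have [N _ hN] := h _ e0'; exists N => n /hN.
by rewrite distrC normE ltcR.
Qed.

Lemma cvs_lim u s : cvs u s -> lim (u n @[n --> \oo])%classic = s.
Proof. by move/cvs_cvg => h; apply: (cvg_lim (@norm_hausdorff C C)). Qed.

Lemma cvs_uniq u s t : cvs u s -> cvs u t -> s = t.
Proof. by move=> /cvs_lim <- /cvs_lim. Qed.

Lemma cvs_ext u v s : (exists N, forall n, (N <= n)%N -> u n = v n) ->
  cvs u s -> cvs v s.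
Proof.
move=> [N h] hu eps e0; have [M hM] := hu _ e0.
exists (maxn N M) => n; rewrite geq_max => /andP[nN nM].
by rewrite -h // hM.
Qed.

Lemma cvs_cst s : cvs (fun=> s) s.
Proof. by move=> eps e0; exists 0%N => n _; rewrite subrr nm0. Qed.

Lemma cvsD u v s t : cvs u s -> cvs v t -> cvs (fun n => u n + v n) (s + t).
Proof.
move=> hu hv eps e0; have e2 : 0 < eps / 2 by lra.
have [N hN] := hu _ e2; have [M hM] := hv _ e2.
exists (maxn N M) => n; rewrite geq_max => /andP[/hN h1 /hM h2].
have -> : u n + v n - (s + t) = (u n - s) + (v n - t) by ring.
by apply: (le_lt_trans (nmD _ _)); lra.
Qed.

Lemma cvsM u v s t : cvs u s -> cvs v t -> cvs (fun n => u n * v n) (s * t).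
Proof.
move=> hu hv eps e0; pose K := 1 + nm s + nm t.
have s0 := nm_ge0 s; have t0 := nm_ge0 t.
have K1 : 1 <= K by rewrite /K; lra.
pose d := Num.min 1 (eps / (2 * K)).
have d0 : 0 < d by rewrite lt_min ltr01 divr_gt0 //; lra.
have d1 : d <= 1 by rewrite ge_min lexx.
have d2 : d * K < eps.
  have : d <= eps / (2 * K) by rewrite ge_min lexx orbT.
  rewrite ler_pdivlMr; last lra.
  by move=> h; nra.
have [N hN] := hu _ d0; have [M hM] := hv _ d0.
exists (maxn N M) => n; rewrite geq_max => /andP[/hN h1 /hM h2].
have -> : u n * v n - s * t = (u n - s) * (v n - t) + s * (v n - t) + t * (u n - s) by ring.
have := nmD ((u n - s) * (v n - t) + s * (v n - t)) (t * (u n - s)).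
have := nmD ((u n - s) * (v n - t)) (s * (v n - t)).
rewrite !nmM => h3 h4; have := nm_ge0 (u n - s); have := nm_ge0 (v n - t).
move: h1 h2 h3 h4 d2; rewrite /K.
set a := nm (u n - s); set b := nm (v n - t) => h1 h2 h3 h4 d2 h5 h6.
have : a * b <= d * 1 by apply: ler_pM => //; lra.
have : nm s * b <= nm s * d by apply: ler_wpM2l => //; lra.
have : nm t * a <= nm t * d by apply: ler_wpM2l => //; lra.
lra.
Qed.

Lemma cvsN u s : cvs u s -> cvs (fun n => - u n) (- s).
Proof.
move=> hu eps /hu [N hN]; exists N => n /hN.
by rewrite -opprD nmN.
Qed.

Lemma cvsB u v s t : cvs u s -> cvs v t -> cvs (fun n => u n - v n) (s - t).
Proof. by move=> hu hv; apply: cvsD => //; apply: cvsN. Qed.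

Lemma cvsV u s : s != 0 -> cvs u s -> cvs (fun n => (u n)^-1) s^-1.
Proof.
rewrite -nm_gt0 => s0 hu eps e0; pose d := Num.min (nm s / 2) (eps * nm s ^+ 2 / 2).
have d0 : 0 < d by rewrite lt_min !divr_gt0 // mulr_gt0 ?exprn_gt0.
have d1 : d <= nm s / 2 by rewrite ge_min lexx.
have d2 : d <= eps * nm s ^+ 2 / 2 by rewrite ge_min lexx orbT.
have [N hN] := hu _ d0; exists N => n /hN h.
have hu2 : nm s / 2 < nm (u n).
  by have := nmB_ge s (u n); rewrite nm_distC => h'; lra.
have u0 : 0 < nm (u n) by lra.
have -> : (u n)^-1 - s^-1 = (s - u n) / (u n * s).
  by field; rewrite -!nm_gt0 s0 u0.
rewrite nmM nmV nmM nm_distC ltr_pdivrMr ?mulr_gt0 //.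
apply: (lt_le_trans h); apply: (le_trans d2).
rewrite expr2; nra.
Qed.

Lemma cvsX u s k : cvs u s -> cvs (fun n => u n ^+ k) (s ^+ k).
Proof.
move=> h; elim: k => [|k IH]; first exact: cvs_cst.
by under [X in cvs X]eq_fun do rewrite exprS; rewrite exprS; apply: cvsM.
Qed.

Lemma cvs_sum (I : Type) (r : seq I) (u : I -> nat -> C) (s : I -> C) :
  (forall i, cvs (u i) (s i)) ->
  cvs (fun n => \sum_(i <- r) u i n) (\sum_(i <- r) s i).
Proof.
move=> h; elim: r => [|i r IH].
  by rewrite big_nil; under [X in cvs X]eq_fun do rewrite big_nil; apply: cvs_cst.
by rewrite big_cons; under [X in cvs X]eq_fun do rewrite big_cons; apply: cvsD.
Qed.

Lemma cvs_squeeze0 (u : nat -> C) (b : nat -> R) s :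
  (exists N, forall n, (N <= n)%N -> nm (u n - s) <= b n) ->
  (b n @[n --> \oo] --> (0 : R))%classic -> cvs u s.
Proof.
move=> [N hN] /cvgrPdist_lt hb eps e0; have [M _ hM] := hb _ e0.
exists (maxn N M) => n; rewrite geq_max => /andP[nN nM].
apply: (le_lt_trans (hN _ nN)); have := hM _ nM.
by rewrite sub0r normrN; apply: le_lt_trans; rewrite ler_norm.
Qed.

Lemma cvs_le u s (M : R) : cvs u s -> (exists N, forall n, (N <= n)%N -> nm (u n) <= M) -> nm s <= M.
Proof.
move=> hu [N hN]; apply/ler_addgt0Pr => eps e0.
have [K hK] := hu _ e0.
have {hN} := hN _ (leq_maxl N K); have {hK} := hK _ (leq_maxr N K).
set n := maxn N K => h1 h2.
have := nmB_ge s (u n); rewrite nm_distC => h3; lra.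
Qed.

Lemma cvs_subseq u s (k : nat -> nat) : (forall n, (n <= k n)%N) ->
  cvs u s -> cvs (fun n => u (k n)) s.
Proof.
move=> hk hu eps e0; have [N hN] := hu _ e0.
by exists N => n nN; apply: hN; rewrite (leq_trans nN).
Qed.

End Modulus.

(** * Unconditional sums *)

Section Sums.
Variable R : realType.
Local Notation C := R[i].

(** Convergence along the finite subsets of the index type, represented by duplicate-free lists.
    Sums over naturals, integers and pairs are thus treated alike and may be reindexed by any
    bijection. *)
Definition has_sum (T : eqType) (f : T -> C) (s : C) :=
  forall eps : R, 0 < eps -> exists A : seq T,
  forall B, uniq B -> {subset A <= B} -> nm (\sum_(x <- B) f x - s) < eps.

Definition summ (T : eqType) (b : T -> R) :=
  (forall x, 0 <= b x) /\
  exists M, forall B, uniq B -> \sum_(x <- B) b x <= M.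

Lemma summ_ge0 (T : eqType) (b : T -> R) x : summ b -> 0 <= b x.
Proof. by case. Qed.

Lemma summ_le (T : eqType) (b c : T -> R) : summ c ->
  (forall x, 0 <= b x <= c x) -> summ b.
Proof.
move=> [_ [M hM]] h; split=> [x|]; first by have /andP[] := h x.
exists M => B uB; apply: le_trans (hM B uB).
by apply: ler_sum => x _; have /andP[] := h x.
Qed.

Lemma summ_le_nm (T : eqType) (f : T -> C) (c : T -> R) : summ c ->
  (forall x, nm (f x) <= c x) -> summ (fun x => nm (f x)).
Proof. by move=> hc h; apply: (summ_le hc) => x; rewrite nm_ge0 h. Qed.

Lemma summD (T : eqType) (b c : T -> R) : summ b -> summ c ->
  summ (fun x => b x + c x).
Proof.
move=> [b0 [M hM]] [c0 [N hN]]; split=> [x|]; first exact: addr_ge0.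
by exists (M + N) => B uB; rewrite big_split lerD ?hM ?hN.
Qed.

Lemma summZ (T : eqType) (b : T -> R) k : 0 <= k -> summ b ->
  summ (fun x => k * b x).
Proof.
move=> k0 [b0 [M hM]]; split=> [x|]; first exact: mulr_ge0.
by exists (k * M) => B uB; rewrite -mulr_sumr ler_wpM2l ?hM.
Qed.

Lemma sum_uniq_sub (T : eqType) (b : T -> R) (A B : seq T) :
  (forall x, 0 <= b x) -> uniq A -> uniq B -> {subset A <= B} ->
  \sum_(x <- A) b x <= \sum_(x <- B) b x.
Proof.
move=> b0 uA uB AB.
have -> : \sum_(x <- A) b x = \sum_(x <- B | x \in A) b x.
  rewrite -[RHS]big_filter; apply: perm_big; apply: uniq_perm => //.
    exact: filter_uniq.
  by move=> x; rewrite mem_filter; case: (boolP (x \in A)) => // /AB ->.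
rewrite [leRHS](bigID (fun x => x \in A)) /= lerDl; exact: sumr_ge0.
Qed.

Lemma summ_supP (T : eqType) (b : T -> R) : summ b -> exists s : R,
  (forall B, uniq B -> \sum_(x <- B) b x <= s) /\
  forall eps, 0 < eps -> exists2 A : seq T, uniq A & s - eps < \sum_(x <- A) b x.
Proof.
move=> [b0 [M hM]].
pose E := [set r | exists2 B : seq T, uniq B & r = \sum_(x <- B) b x]%classic.
have hE : has_sup E.
  split; first by exists 0, [::]; rewrite // big_nil.
  by exists M => _ [B uB ->]; apply: hM.
exists (sup E); split=> [B uB|eps e0].
  by apply: sup_upper_bound => //; exists B.
have [_ [B uB ->] h] := sup_adherent e0 hE.
by exists B.
Qed.

Lemma summ_tail (T : eqType) (b : T -> R) eps : summ b -> 0 < eps ->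
  exists2 A : seq T, uniq A & forall B : seq T, uniq B -> (forall x, x \in B -> x \notin A) ->
    \sum_(x <- B) b x < eps.
Proof.
move=> hb e0; have [s [h1 h2]] := summ_supP hb.
have [A uA hA] := h2 _ e0; exists A => // B uB dis.
have uAB : uniq (A ++ B).
  rewrite cat_uniq uA uB andbT /=; apply/hasPn => x /dis; exact.
by have := h1 _ uAB; rewrite big_cat /= => h; lra.
Qed.

Lemma summ_rsum (T : eqType) (b : T -> R) : summ b -> exists s : R,
  forall eps, 0 < eps -> exists A : seq T, forall B : seq T, uniq B -> {subset A <= B} ->
    `|\sum_(x <- B) b x - s| < eps.
Proof.
move=> hb; have [s [h1 h2]] := summ_supP hb; exists s => eps e0.
have [A uA hA] := h2 _ e0; exists A => B uB AB.
have := h1 _ uB; have := sum_uniq_sub hb.1 uA uB AB.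
rewrite ltr_norml => ? ?; apply/andP; split; lra.
Qed.

Lemma summ_has_sum (T : eqType) (f : T -> C) :
  summ (fun x => nm (f x)) -> exists s, has_sum f s.
Proof.
move=> hf; pose b x := nm (f x).
have aux (h : T -> R) : (forall x, `|h x| <= b x) -> exists s : R,
  forall eps, 0 < eps -> exists A : seq T, forall B : seq T, uniq B -> {subset A <= B} ->
    `|\sum_(x <- B) h x - s| < eps.
  (* [h + b] is nonnegative and at most [2 b], so [h + b] and [b] both have sums, and [h] is their
     difference. *)
  move=> hh; have h2 : summ (fun x => h x + b x).
    apply: (summ_le (summD hf hf)) => x; have := hh x; rewrite ler_norml.
    rewrite -/(b x) => /andP[] ? ?; apply/andP; split; lra.
  have [s hs] := summ_rsum h2; have [t ht] := summ_rsum hf.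
  exists (s - t) => eps e0; have e2 : 0 < eps / 2 by lra.
  have [A1 h3] := hs _ e2; have [A2 h4] := ht _ e2.
  exists (A1 ++ A2) => B uB sub.
  have -> : \sum_(x <- B) h x = \sum_(x <- B) (h x + b x) - \sum_(x <- B) b x.
    by rewrite big_split /= addrK.
  have h5 : `|\sum_(x <- B) b x - t| < eps / 2.
    by apply: h4 => // x ?; apply: sub; rewrite mem_cat; apply/orP; right.
  have h6 : `|\sum_(x <- B) (h x + b x) - s| < eps / 2.
    by apply: h3 => // x ?; apply: sub; rewrite mem_cat; apply/orP; left.
  move: h5 h6; set u := \sum_(x <- B) _; set v := \sum_(x <- B) _.
  rewrite !ltr_norml => /andP[? ?] /andP[? ?]; apply/andP; split; lra.
have [s hs] := aux (fun x => complex.Re (f x)) (fun x => Re_le_nm _).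
have [t ht] := aux (fun x => complex.Im (f x)) (fun x => Im_le_nm _).
exists (s +i* t) => eps e0; have e2 : 0 < eps / 2 by lra.
have [A1 h3] := hs _ e2; have [A2 h4] := ht _ e2.
exists (A1 ++ A2) => B uB sub.
apply: (le_lt_trans (nm_le_ReIm _)).
rewrite cReD cImD cReN cImN /= Re_sum Im_sum.
have : `|\sum_(x <- B) complex.Re (f x) - s| < eps / 2.
  by apply: h3 => // x ?; apply: sub; rewrite mem_cat; apply/orP; left.
have : `|\sum_(x <- B) complex.Im (f x) - t| < eps / 2.
  by apply: h4 => // x ?; apply: sub; rewrite mem_cat; apply/orP; right.
by move=> ? ?; lra.
Qed.

Lemma subset_undup_catl (T : eqType) (A B : seq T) : {subset A <= undup (A ++ B)}.
Proof. by move=> x ?; rewrite mem_undup mem_cat; apply/orP; left. Qed.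

Lemma subset_undup_catr (T : eqType) (A B : seq T) : {subset B <= undup (A ++ B)}.
Proof. by move=> x ?; rewrite mem_undup mem_cat; apply/orP; right. Qed.

Lemma has_sum_uniq (T : eqType) (f : T -> C) s t :
  has_sum f s -> has_sum f t -> s = t.
Proof.
move=> hs ht; apply/eqP; rewrite -subr_eq0; apply/eqP; apply: nm_small0 => eps e0.
have e2 : 0 < eps / 2 by lra.
have [A1 h3] := hs _ e2; have [A2 h4] := ht _ e2.
have := h3 _ (undup_uniq _) (@subset_undup_catl _ A1 A2).
have := h4 _ (undup_uniq _) (@subset_undup_catr _ A1 A2).
set u := \sum_(x <- _) _ => h5 h6.
have -> : s - t = (u - t) - (u - s) by ring.
by apply: (le_lt_trans (nmB _ _)); lra.
Qed.

Lemma has_sum_ext (T : eqType) (f g : T -> C) s :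
  (forall x, f x = g x) -> has_sum f s -> has_sum g s.
Proof. by move=> /funext ->. Qed.

Lemma has_sumD (T : eqType) (f g : T -> C) s t :
  has_sum f s -> has_sum g t -> has_sum (fun x => f x + g x) (s + t).
Proof.
move=> hs ht eps e0; have e2 : 0 < eps / 2 by lra.
have [A1 h3] := hs _ e2; have [A2 h4] := ht _ e2.
exists (A1 ++ A2) => B uB sub; rewrite big_split /=.
have -> : \sum_(i <- B) f i + \sum_(i <- B) g i - (s + t) =
  (\sum_(i <- B) f i - s) + (\sum_(i <- B) g i - t) by ring.
apply: (le_lt_trans (nmD _ _)).
have : nm (\sum_(i <- B) f i - s) < eps / 2.
  by apply: h3 => // x ?; apply: sub; rewrite mem_cat; apply/orP; left.
have : nm (\sum_(i <- B) g i - t) < eps / 2.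
  by apply: h4 => // x ?; apply: sub; rewrite mem_cat; apply/orP; right.
by move=> ? ?; lra.
Qed.

Lemma has_sumZ (T : eqType) (f : T -> C) s k :
  has_sum f s -> has_sum (fun x => k * f x) (k * s).
Proof.
move=> hs eps e0; have k0 := nm_ge0 k.
have e2 : 0 < eps / (1 + nm k) by rewrite divr_gt0 //; lra.
have [A hA] := hs _ e2; exists A => B uB sub.
have := hA B uB sub; rewrite ltr_pdivlMr; last lra.
rewrite -mulr_sumr -mulrBr nmM; have := nm_ge0 (\sum_(x <- B) f x - s).
by set u := nm (_ - _) => ? ?; nra.
Qed.

Lemma has_sumZr (T : eqType) (f : T -> C) s k :
  has_sum f s -> has_sum (fun x => f x * k) (s * k).
Proof.
move=> /has_sumZ h; rewrite mulrC; apply: (has_sum_ext _ (h k)) => x.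
by rewrite mulrC.
Qed.

Lemma has_sumN (T : eqType) (f : T -> C) s :
  has_sum f s -> has_sum (fun x => - f x) (- s).
Proof.
move=> /has_sumZ h; rewrite -mulN1r; apply: (has_sum_ext _ (h (-1))) => x.
by rewrite mulN1r.
Qed.

Lemma has_sumB (T : eqType) (f g : T -> C) s t :
  has_sum f s -> has_sum g t -> has_sum (fun x => f x - g x) (s - t).
Proof. by move=> hf hg; apply: has_sumD => //; apply: has_sumN. Qed.

Lemma has_sum_fin (T : eqType) (A : seq T) (f : T -> C) : uniq A ->
  (forall x, x \notin A -> f x = 0) -> has_sum f (\sum_(x <- A) f x).
Proof.
move=> uA h eps e0; exists A => B uB AB.
rewrite [X in X - _](bigID (fun x => x \in A)) /=.
rewrite [X in _ + X - _]big1 //.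
have -> : \sum_(x <- B | x \in A) f x = \sum_(x <- A) f x.
  rewrite -[LHS]big_filter; apply: perm_big; apply: uniq_perm => //.
    exact: filter_uniq.
  move=> x; rewrite mem_filter; case: (boolP (x \in A)) => // /AB -> //.
by rewrite addr0 subrr nm0.
Qed.

Lemma has_sum0 (T : eqType) : has_sum (fun _ : T => 0) 0.
Proof. by have := @has_sum_fin T [::] (fun=> 0) isT (fun _ _ => erefl); rewrite big_nil. Qed.

Lemma has_sum1 (T : eqType) (f : T -> C) x0 :
  (forall x, x != x0 -> f x = 0) -> has_sum f (f x0).
Proof.
move=> h; have := @has_sum_fin T [:: x0] f isT; rewrite big_seq1; apply=> x.
by rewrite inE => /h.
Qed.

Lemma has_sum_sum (T : eqType) (I : Type) (r : seq I) (f : I -> T -> C) s :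
  (forall i, has_sum (f i) (s i)) ->
  has_sum (fun x => \sum_(i <- r) f i x) (\sum_(i <- r) s i).
Proof.
move=> h; elim: r => [|i r IH].
  by rewrite big_nil; apply: (has_sum_ext _ (@has_sum0 T)) => x; rewrite big_nil.
rewrite big_cons; apply: (has_sum_ext _ (has_sumD (h i) IH)) => x.
by rewrite big_cons.
Qed.

Lemma has_sum_le (T : eqType) (f : T -> C) s (M : R) : has_sum f s ->
  (forall B, uniq B -> nm (\sum_(x <- B) f x) <= M) -> nm s <= M.
Proof.
move=> hs h; apply/ler_addgt0Pr => eps e0; have [A hA] := hs _ e0.
have h1 : nm (\sum_(x <- undup A) f x - s) < eps.
  by apply: hA; [exact: undup_uniq | move=> x; rewrite mem_undup].
have := h _ (undup_uniq A); move: h1; set u := \sum_(_ <- _) _ => h1 h2.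
by have := nmB_ge s u; rewrite nm_distC => ?; lra.
Qed.

Lemma has_sum_leB (T : eqType) (f : T -> C) s (A : seq T) (M : R) :
  has_sum f s -> uniq A ->
  (forall B, uniq B -> (forall x, x \in B -> x \notin A) ->
     \sum_(x <- B) nm (f x) <= M) -> nm (s - \sum_(x <- A) f x) <= M.
Proof.
move=> hs uA h; apply/ler_addgt0Pr => eps e0; have [A1 hA] := hs _ e0.
pose B := undup (A ++ A1).
have h1 : nm (\sum_(x <- B) f x - s) < eps.
  by apply: hA; [exact: undup_uniq | exact: subset_undup_catr].
have uB : uniq B := undup_uniq _.
rewrite (bigID (fun x => x \in A)) /= in h1.
have e1 : \sum_(x <- B | x \in A) f x = \sum_(x <- A) f x.
  rewrite -[LHS]big_filter; apply: perm_big; apply: uniq_perm => //.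
    exact: filter_uniq.
  move=> x; rewrite mem_filter; case: (boolP (x \in A)) => // xA.
  by rewrite (@subset_undup_catl _ A A1 x xA).
rewrite e1 in h1; set v := \sum_(x <- A) f x in h1 *.
have h2 : nm (\sum_(x <- B | x \notin A) f x) <= M.
  apply: (le_trans (nm_sum _ _ _)); rewrite -big_filter; apply: h.
    exact: filter_uniq.
  by move=> x; rewrite mem_filter => /andP[].
set w := \sum_(x <- B | _) _ in h1 h2.
have -> : s - v = w - (v + w - s) by ring.
by apply: (le_trans (nmB _ _)); lra.
Qed.

Lemma sum_fiber (V : nmodType) (T U : eqType) (h : T -> U) (B : seq U) (D : seq T)
    (f : T -> V) : uniq B ->
  \sum_(t <- D | h t \in B) f t = \sum_(u <- B) \sum_(t <- D) if h t == u then f t else 0.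
Proof.
move=> uB; rewrite exchange_big /= [LHS]big_mkcond; apply: eq_bigr => t _.
case: ifP => htB.
  rewrite (bigD1_seq (h t)) //= eqxx big1 ?addr0 // => i.
  by rewrite eq_sym => /negPf ->.
rewrite big1_seq // => u /andP[_ uB']; case: eqP => // e.
by rewrite -e htB in uB'.
Qed.

(** For finitely many fibres, one finite list approximates the total and each fibre sum at once;
    restricting it to the fibres over [B] keeps it close to the total. Every interchange of
    summations below goes back to this regrouping. *)
Lemma has_sum_fiber (T U : eqType) (h : T -> U) (f : T -> C) (g : U -> C) s :
  has_sum f s -> (forall u, has_sum (fun t => if h t == u then f t else 0) (g u)) ->
  has_sum g s.
Proof.
move=> hs hg eps e0; have e2 : 0 < eps / 2 by lra.
have [A hA] := hs _ e2; exists (map h A) => B uB sub.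
(* [size B] errors of size [d] stay below [eps / 2], also when [B] is empty. *)
pose d := eps / (2 * (size B).+1%:R).
have d0 : 0 < d by rewrite divr_gt0 // mulr_gt0.
have /choice [Au hAu] : forall u, exists A : seq T, forall B, uniq B ->
    {subset A <= B} -> nm (\sum_(t <- B) (if h t == u then f t else 0) - g u) < d.
  by move=> u; apply: hg.
pose D := undup (A ++ flatten (map Au B)).
have h1 : nm (\sum_(t <- D | h t \in B) f t - s) < eps / 2.
  rewrite -big_filter; apply: hA; first exact/filter_uniq/undup_uniq.
  move=> t tA; rewrite mem_filter (subset_undup_catl _ tA) andbT.
  by apply: sub; apply: map_f.
rewrite sum_fiber // in h1.
have h2 : nm (\sum_(u <- B) (\sum_(t <- D) (if h t == u then f t else 0) - g u))
    <= \sum_(u <- B) d.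
  apply: (le_trans (nm_sum _ _ _)); rewrite big_seq [leRHS]big_seq.
  apply: ler_sum => u uB'; apply: ltW; apply: hAu; first exact: undup_uniq.
  move=> t tA; apply: subset_undup_catr; apply/flattenP; exists (Au u) => //.
  exact: map_f.
rewrite sumrB in h2; move: h1 h2; set v := \sum_(u <- B) \sum_(t <- D) _.
set w := \sum_(u <- B) g u; rewrite big_const_seq count_predT iter_addr_0 => h1 h2.
have h3 : d *+ size B < eps / 2.
  rewrite -mulr_natr /d mulrAC ltr_pdivrMr ?mulr_gt0 //.
  have : (size B)%:R < (size B).+1%:R :> R by rewrite ltr_nat.
  by set x := _%:R; set y := _%:R => ?; nra.
have -> : w - s = (v - s) - (v - w) by ring.
by apply: (le_lt_trans (nmB _ _)); lra.
Qed.

Lemma summ_fiber (T U : eqType) (h : T -> U) (b : T -> R) (c : U -> R) :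
  (forall t, 0 <= b t) -> summ c ->
  (forall u B, uniq B -> (forall t, t \in B -> h t = u) -> \sum_(t <- B) b t <= c u) ->
  summ b.
Proof.
move=> b0 [c0 [M hM]] hb; split=> //; exists M => B uB.
have -> : \sum_(t <- B) b t = \sum_(t <- B | h t \in undup (map h B)) b t.
  rewrite big_seq [RHS]big_seq_cond; apply: eq_bigl => t.
  by rewrite mem_undup; case: (boolP (t \in B)) => //= /(map_f h) ->.
rewrite sum_fiber ?undup_uniq //; apply: le_trans (hM _ (undup_uniq _)).
apply: ler_sum => u _; rewrite -big_mkcond -big_filter; apply: hb.
  exact: filter_uniq.
by move=> t; rewrite mem_filter => /andP[/eqP].
Qed.

Lemma summ_pair (T U : eqType) (b : T * U -> R) (c : T -> R) :
  (forall t, 0 <= b t) -> summ c ->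
  (forall t B, uniq B -> \sum_(u <- B) b (t, u) <= c t) -> summ b.
Proof.
move=> b0 hc hb; apply: (summ_fiber (h := fst) b0 hc) => t B uB ht.
have -> : \sum_(x <- B) b x = \sum_(u <- map snd B) b (t, u).
  rewrite big_map big_seq [RHS]big_seq; apply: eq_bigr => -[t' u] /ht /= <- //.
apply: hb; rewrite map_inj_in_uniq // => -[a1 a2] [b1 b2] /ht /= -> /ht /= -> -> //.
Qed.

Lemma summ_pair_prod (T U : eqType) (b : T -> R) (c : U -> R) :
  summ b -> summ c -> summ (fun p : T * U => b p.1 * c p.2).
Proof.
move=> hb [c0 [M hM]]; apply: (summ_pair (c := fun t => M * b t)).
- by move=> t; rewrite mulr_ge0 // (summ_ge0 _ hb).
- apply: summZ => //; have := hM [::] isT; by rewrite big_nil.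
- move=> t B uB; rewrite /= -mulr_sumr mulrC ler_wpM2r ?hM //.
  exact: (summ_ge0 _ hb).
Qed.

Lemma summ_inj (T U : eqType) (h : T -> U) (b : U -> R) : injective h ->
  summ b -> summ (fun t => b (h t)).
Proof.
move=> ih [b0 [M hM]]; split=> //; exists M => B uB.
by have := hM (map h B); rewrite map_inj_uniq // big_map; apply.
Qed.

Lemma has_sum_inj (T U : eqType) (h : T -> U) (f : U -> C) s : injective h ->
  (forall u, (forall t, h t != u) -> f u = 0) ->
  has_sum (fun t => f (h t)) s -> has_sum f s.
Proof.
move=> ih h0 hs; apply: (has_sum_fiber (h := h) hs) => u.
have [[t ht]|nt] := pselect (exists t, h t = u).
  have := @has_sum1 T (fun t => if h t == u then f (h t) else 0) t.
  rewrite ht eqxx; apply=> t' tt'; case: eqP => // ht'.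
  by move: tt'; rewrite -(inj_eq ih) ht ht' eqxx.
rewrite h0; last by move=> t; apply/eqP => e; apply: nt; exists t.
apply: (has_sum_ext _ (has_sum0 T)) => t; case: eqP => // e.
by case: nt; exists t.
Qed.

Lemma has_sum_inj_inv (T U : eqType) (h : T -> U) (f : U -> C) s : injective h ->
  (forall u, (forall t, h t != u) -> f u = 0) -> summ (fun u => nm (f u)) ->
  has_sum f s -> has_sum (fun t => f (h t)) s.
Proof.
move=> ih h0 sf hs.
have [s' hs'] := summ_has_sum (summ_inj ih sf).
by have := has_sum_inj ih h0 hs'; move/(has_sum_uniq hs) => ->.
Qed.

Lemma has_sum_bij (T U : eqType) (h : T -> U) (f : U -> C) s : bijective h ->
  has_sum f s -> has_sum (fun t => f (h t)) s.
Proof.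
move=> [g hg gh] hs; apply: (has_sum_inj (h := g) (can_inj gh)).
  by move=> u /(_ (h u)); rewrite hg eqxx.
by apply: (has_sum_ext _ hs) => x; rewrite gh.
Qed.

Lemma has_sum_pair (T U : eqType) (f : T * U -> C) (g : T -> C) s :
  has_sum f s -> (forall t, has_sum (fun u => f (t, u)) (g t)) -> has_sum g s.
Proof.
move=> hs hg; apply: (has_sum_fiber (h := fst) hs) => t.
apply: (has_sum_inj (h := fun u => (t, u))); first by move=> x y [].
  by move=> [t' u] hu /=; case: eqP => // e; have := hu u; rewrite e eqxx.
by apply: (has_sum_ext _ (hg t)) => u /=; rewrite eqxx.
Qed.

Lemma has_sum_pairI (T U : eqType) (f : T * U -> C) (g : T -> C) s :
  summ (fun p => nm (f p)) -> (forall t, has_sum (fun u => f (t, u)) (g t)) ->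
  has_sum g s -> has_sum f s.
Proof.
move=> /summ_has_sum [s' hs'] hg /has_sum_uniq hs.
by rewrite (hs _ (has_sum_pair hs' hg)).
Qed.

Lemma has_sum_pairC (T U : eqType) (f : T * U -> C) s :
  has_sum f s -> has_sum (fun p : U * T => f (p.2, p.1)) s.
Proof.
move=> h; apply: (has_sum_bij (h := fun p : U * T => (p.2, p.1))) h.
by exists (fun p : T * U => (p.2, p.1)) => -[].
Qed.

Lemma summ_pairC (T U : eqType) (f : T * U -> R) :
  summ f -> summ (fun p : U * T => f (p.2, p.1)).
Proof.
by apply: (summ_inj (h := fun p : U * T => (p.2, p.1))) => -[? ?] [? ?] [-> ->].
Qed.

Lemma has_sum_prod (T U : eqType) (f : T -> C) (g : U -> C) s t :
  summ (fun x => nm (f x)) -> summ (fun x => nm (g x)) ->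
  has_sum f s -> has_sum g t -> has_sum (fun p => f p.1 * g p.2) (s * t).
Proof.
move=> sf sg hf hg; apply: (has_sum_pairI (g := fun x => f x * t)).
- apply: (summ_le (summ_pair_prod sf sg)) => x.
  by rewrite nm_ge0 nmM lexx.
- by move=> x; exact: (has_sumZ (f x) hg).
- exact: has_sumZr.
Qed.

Lemma has_sum_cvs (f : nat -> C) s : has_sum f s -> cvs (fun n => \sum_(i < n) f i) s.
Proof.
move=> hs eps e0; have [A hA] := hs _ e0.
exists (\max_(i <- A) i).+1 => n hn.
rewrite -(big_mkord xpredT f); apply: hA; first exact: iota_uniq.
move=> x xA; rewrite mem_index_iota /=; apply: leq_trans hn.
by rewrite ltnS; apply: (@leq_bigmax_seq _ _ xpredT id).
Qed.

Lemma summ_nat (b : nat -> R) M : (forall n, 0 <= b n) ->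
  (forall n, \sum_(i < n) b i <= M) -> summ b.
Proof.
move=> b0 h; split=> //; exists M => B uB.
apply: le_trans (h (\max_(i <- B) i).+1); rewrite -(big_mkord xpredT b).
apply: sum_uniq_sub => //; first exact: iota_uniq.
move=> x xA; rewrite mem_index_iota /=.
by rewrite ltnS; apply: (@leq_bigmax_seq _ _ xpredT id).
Qed.

(** Dominated convergence for sums. Outside a finite list [A] the majorant, and with it both tails,
    contributes at most [eps / 4]; on [A] the limit is taken termwise. *)
Lemma tannery (T : eqType) (F : nat -> T -> C) (f : T -> C) (b : T -> R) sn s :
  summ b -> (exists N, forall n t, (N <= n)%N -> nm (F n t) <= b t) ->
  (forall t, cvs (fun n => F n t) (f t)) ->
  (forall n, has_sum (F n) (sn n)) -> has_sum f s -> cvs sn s.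
Proof.
move=> sb [N hN] hF hsn hs eps e0; have e4 : 0 < eps / 4 by lra.
have [A uA hA] := summ_tail sb e4.
have fb t : nm (f t) <= b t.
  by apply: (cvs_le (hF t)); exists N => n /hN.
have [M hM] := @cvs_sum R T A (fun t n => F n t) f hF _ e4.
exists (maxn N M) => n; rewrite geq_max => /andP[nN nM].
have h1 : nm (s - \sum_(t <- A) f t) <= eps / 4.
  apply: (has_sum_leB hs uA) => B uB dis; apply: le_trans (ltW (hA _ uB dis)).
  by apply: ler_sum => t _.
have h2 : nm (sn n - \sum_(t <- A) F n t) <= eps / 4.
  apply: (has_sum_leB (hsn n) uA) => B uB dis; apply: le_trans (ltW (hA _ uB dis)).
  by apply: ler_sum => t _; apply: hN.
have h3 := hM _ nM; move: h1 h2 h3; set x := \sum_(t <- A) _; set y := \sum_(t <- A) _.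
move=> h1 h2 h3; have -> : sn n - s = (sn n - y) + (y - x) - (s - x) by ring.
apply: (le_lt_trans (nmB _ _)); have := nmD (sn n - y) (y - x) => h4; lra.
Qed.

Lemma summ_has_sum_le (T : eqType) (f : T -> C) s (b : T -> R) M : has_sum f s ->
  (forall x, nm (f x) <= b x) -> (forall B, uniq B -> \sum_(x <- B) b x <= M) ->
  nm s <= M.
Proof.
move=> hs hb hM; apply: (has_sum_le hs) => B uB.
apply: (le_trans (nm_sum _ _ _)); apply: le_trans (hM _ uB); exact: ler_sum.
Qed.

Lemma summ_push (T U : eqType) (h : T -> U) (L : U -> seq T) (b : T -> R) :
  (forall u, uniq (L u)) -> (forall u t, t \in L u -> h t = u) -> summ b ->
  summ (fun u => \sum_(t <- L u) b t).
Proof.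
move=> uL hL [b0 [M hM]]; split=> [u|]; first exact: sumr_ge0.
exists M => B uB; rewrite -(big_map L xpredT (fun l => \sum_(t <- l) b t)).
rewrite -big_flatten; apply: hM; elim: B uB => //= u B IH /andP[uB /IH uF].
rewrite cat_uniq uL uF andbT /=; apply/hasPn => t /flattenP[l /mapP[u' u'B ->]].
by move=> /hL htu'; apply: contra uB => /hL <-; rewrite htu'.
Qed.

Lemma has_sum_push (T U : eqType) (h : T -> U) (L : U -> seq T) (f : T -> C) s :
  (forall u, uniq (L u)) -> (forall u t, (t \in L u) = (h t == u)) -> has_sum f s ->
  has_sum (fun u => \sum_(t <- L u) f t) s.
Proof.
move=> uL hL hs; apply: (has_sum_fiber (h := h) hs) => u.
rewrite (_ : \sum_(t <- L u) f t = \sum_(t <- L u) if h t == u then f t else 0).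
  by apply: has_sum_fin => // t; rewrite hL => /negPf ->.
by rewrite [LHS]big_seq [RHS]big_seq; apply: eq_bigr => t; rewrite hL => ->.
Qed.

Definition antidiag n := [seq (i, (n - i)%N) | i <- iota 0 n.+1].

Lemma antidiag_uniq n : uniq (antidiag n).
Proof. by rewrite map_inj_uniq ?iota_uniq // => a b []. Qed.

Lemma mem_antidiag n p : (p \in antidiag n) = (p.1 + p.2 == n)%N.
Proof.
case: p => a b; apply/mapP/eqP => [[k] | hn].
  by rewrite mem_iota add0n => /andP[_ hk] [-> ->] /=; rewrite subnKC.
have {}hn : (a + b = n)%N := hn.
by exists a; [rewrite mem_iota add0n ltnS -hn leq_addr | rewrite -hn addKn].
Qed.

Lemma sum_antidiag (V : nmodType) n (F : nat * nat -> V) :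
  \sum_(p <- antidiag n) F p = \sum_(i < n.+1) F (i : nat, (n - i)%N).
Proof. by rewrite big_map -[iota 0 n.+1]/(index_iota 0 n.+1) big_mkord. Qed.

Lemma summ_cauchy (b c : nat -> R) : summ b -> summ c ->
  summ (fun n => \sum_(i < n.+1) b i * c (n - i)%N).
Proof.
move=> hb hc; have := summ_pair_prod hb hc.
move/(summ_push (h := fun p : nat * nat => (p.1 + p.2)%N) antidiag_uniq) => h.
have {h}/h h : forall u t, t \in antidiag u -> (t.1 + t.2)%N = u.
  by move=> u t; rewrite mem_antidiag => /eqP.
apply: (summ_le h) => n; rewrite sum_antidiag /= lexx andbT.
by apply: sumr_ge0 => i _; rewrite mulr_ge0 ?(summ_ge0 _ hb) ?(summ_ge0 _ hc).
Qed.

Lemma has_sum_cauchy (f g : nat -> C) s t :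
  summ (fun x => nm (f x)) -> summ (fun x => nm (g x)) ->
  has_sum f s -> has_sum g t ->
  has_sum (fun n => \sum_(i < n.+1) f i * g (n - i)%N) (s * t).
Proof.
move=> sf sg hf hg; have := has_sum_prod sf sg hf hg.
move/(has_sum_push (h := fun p : nat * nat => (p.1 + p.2)%N) antidiag_uniq) => h.
by apply: (has_sum_ext _ (h mem_antidiag)) => n; rewrite sum_antidiag.
Qed.

Definition csum (T : eqType) (f : T -> C) : C := xget 0 [set s | has_sum f s]%classic.

Lemma csumE (T : eqType) (f : T -> C) s : has_sum f s -> csum f = s.
Proof.
move=> h; rewrite /csum; case: xgetP => [t -> /= ht|/(_ s)//].
exact: has_sum_uniq ht h.
Qed.

Lemma csumP (T : eqType) (f : T -> C) : summ (fun x => nm (f x)) -> has_sum f (csum f).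
Proof. by case/summ_has_sum => s hs; rewrite (csumE hs). Qed.

End Sums.

(** * The complex exponential and the function [e] *)

Section Exponential.
Variable R : realType.
Local Notation C := R[i].
Implicit Types (z w u : C).

Lemma expC0 : expC 0 = 1 :> C.
Proof. by rewrite /expC /= expR0 cos0 sin0 mul1r. Qed.

Lemma expCD z w : expC (z + w) = expC z * expC w.
Proof.
rewrite /expC cReD cImD expRD cosD sinD rmorphM /=.
rewrite mulrACA; congr (_ * _); simpc.
by congr (_ +i* _); ring.
Qed.

Lemma nm_expC z : nm (expC z) = expR (complex.Re z).
Proof.
rewrite /expC nmM nm_real ger0_norm ?expR_ge0 // [nm (_ +i* _)]/nm /= cos2Dsin2.
by rewrite sqrtr1 mulr1.
Qed.

Lemma expC_neq0 z : expC z != 0.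
Proof. by rewrite -nm_gt0 nm_expC expR_gt0. Qed.

Lemma expCN z : expC (- z) = (expC z)^-1.
Proof.
apply: (mulfI (expC_neq0 z)).
by rewrite -expCD subrr expC0 mulfV ?expC_neq0.
Qed.

Lemma cvs_ReIm (f : nat -> C) s :
  (complex.Re (f n) @[n --> \oo] --> complex.Re s)%classic ->
  (complex.Im (f n) @[n --> \oo] --> complex.Im s)%classic -> cvs f s.
Proof.
move=> /cvgrPdist_lt h1 /cvgrPdist_lt h2 eps e0.
have e2 : 0 < eps / 2 by lra.
have [N _ hN] := h1 _ e2; have [M _ hM] := h2 _ e2.
exists (maxn N M) => n; rewrite geq_max => /andP[/hN /= h3 /hM /= h4].
rewrite nm_distC; apply: (le_lt_trans (nm_le_ReIm _)).
by rewrite cReD cImD cReN cImN; lra.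
Qed.

Lemma summ_exp (t : R) : 0 <= t -> summ (fun k => t ^+ k / k`!%:R).
Proof.
move=> t0; apply: (@summ_nat _ _ (expR t)) => [n|n].
  by rewrite divr_ge0 ?exprn_ge0 ?ler0n.
have -> : \sum_(i < n) (t ^+ i / i`!%:R) = series (exp_coeff t) n.
  by rewrite /series /= big_mkord; apply: eq_bigr => i _; rewrite exp_coeffE mulrC.
apply: nondecreasing_cvgn_le; last exact: is_cvg_series_exp_coeff.
apply/nondecreasing_seqP => k; rewrite /series /= big_nat_recr //= lerDl.
by rewrite exp_coeffE mulr_ge0 ?invr_ge0 ?exprn_ge0 ?ler0n.
Qed.

Lemma sum_exp_le (t : R) B : 0 <= t -> uniq B ->
  \sum_(k <- B) (t ^+ k / k`!%:R) <= expR t.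
Proof.
move=> t0 uB; have b0 k : 0 <= t ^+ k / k`!%:R by rewrite divr_ge0 ?exprn_ge0 ?ler0n.
pose n := (\max_(i <- B) i).+1.
apply: (@le_trans _ _ (\sum_(0 <= k < n) (t ^+ k / k`!%:R))).
  apply: sum_uniq_sub => //; first exact: iota_uniq.
  move=> x xA; rewrite mem_index_iota /=.
  by rewrite ltnS; apply: (@leq_bigmax_seq _ _ xpredT id).
have -> : \sum_(0 <= i < n) (t ^+ i / i`!%:R) = series (exp_coeff t) n.
  by rewrite /series /=; apply: eq_bigr => i _; rewrite exp_coeffE mulrC.
apply: nondecreasing_cvgn_le; last exact: is_cvg_series_exp_coeff.
apply/nondecreasing_seqP => k; rewrite /series /= big_nat_recr //= lerDl.
by rewrite exp_coeffE mulr_ge0 ?invr_ge0 ?exprn_ge0 ?ler0n.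
Qed.

Lemma summ_expC z : summ (fun k => nm (z ^+ k / k`!%:R)).
Proof.
apply: (summ_le (summ_exp (nm_ge0 z))) => k.
by rewrite nm_ge0 nmM nmX nmV nm_nat lexx.
Qed.

Lemma has_sum_exp_real (t : R) : has_sum (fun k => (t%:C : C) ^+ k / k`!%:R) (expR t)%:C.
Proof.
have [s hs] := summ_has_sum (summ_expC t%:C).
suff -> : (expR t)%:C = s by [].
apply: (cvs_uniq _ (has_sum_cvs hs)).
have E n : \sum_(i < n) ((t%:C : C) ^+ i / i`!%:R) = (series (exp_coeff t) n)%:C.
  rewrite /series /= big_mkord rmorph_sum; apply: eq_bigr => i _.
  by rewrite exp_coeffE /= rmorphM /= rmorphXn fmorphV /= rmorph_nat mulrC.
apply: cvs_ReIm => /=; under eq_fun do rewrite E /=.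
  exact: is_cvg_series_exp_coeff.
exact: cvg_cst.
Qed.

Lemma has_sum_exp_imag (t : R) :
  has_sum (fun k => ('i * t%:C : C) ^+ k / k`!%:R) (cos t +i* sin t).
Proof.
have [s hs] := summ_has_sum (summ_expC ('i * t%:C)).
suff -> : cos t +i* sin t = s by [].
apply: (cvs_uniq _ (has_sum_cvs hs)).
have E k : ('i * t%:C : C) ^+ k / k`!%:R = cos_coeff t k +i* sin_coeff t k.
  rewrite exprMn -(rmorphXn (real_complex R)) -(rmorph_nat (real_complex R)).
  rewrite -(fmorphV (real_complex R)) -mulrA -(rmorphM (real_complex R)) /=.
  have e2 : 'i ^+ 2 = (-1)%:C :> C by rewrite sqr_i rmorphN.
  have ek : k = (odd k + k./2.*2)%N by rewrite odd_double_half.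
  rewrite {1}ek exprD -mul2n exprM e2 -(rmorphXn (real_complex R)) /= cos_coeffE sin_coeffE.
  have hk : odd k -> k.-1./2 = k./2.
    by move=> ok; have := odd_double_half k; rewrite ok add1n => <-; rewrite /= doubleK uphalf_double.
  case: (odd k) hk => [->//|_] /=; rewrite ?expr0 ?expr1 -?complexr0; simpc;
    by congr (_ +i* _); rewrite ?mul1r ?mul0r // ?mulrA mulrAC.
have E2 n : \sum_(i < n) (('i * t%:C : C) ^+ i / i`!%:R) =
    series (cos_coeff t) n +i* series (sin_coeff t) n.
  rewrite /series /= !big_mkord; elim: n => [|n IH]; first by rewrite !big_ord0.
  by rewrite !big_ord_recr IH E.
apply: cvs_ReIm => /=; under eq_fun do rewrite E2 /=.
  by rewrite cos.unlock; exact: is_cvg_series_cos_coeff.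
by rewrite sin.unlock; exact: is_cvg_series_sin_coeff.
Qed.

Lemma has_sum_expM z w s t :
  has_sum (fun k => z ^+ k / k`!%:R) s -> has_sum (fun k => w ^+ k / k`!%:R) t ->
  has_sum (fun k => (z + w) ^+ k / k`!%:R) (s * t).
Proof.
move=> hs ht; have hp := has_sum_cauchy (summ_expC z) (summ_expC w) hs ht.
apply: (has_sum_ext _ hp) => n; rewrite addrC exprDn mulr_suml.
apply: eq_bigr => i _; have hi : (i <= n)%N by rewrite -ltnS.
rewrite -mulr_natr -(bin_fact hi) !natrM; field.
by rewrite !pnatr_eq0 -!lt0n !fact_gt0 bin_gt0 hi.
Qed.

Lemma has_sum_expC z : has_sum (fun k => z ^+ k / k`!%:R) (expC z).
Proof.
have := has_sum_expM (has_sum_exp_real (complex.Re z)) (has_sum_exp_imag (complex.Im z)).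
by rewrite -complexE.
Qed.

(** From k = 2 on, [1 / k! <= 1 / (k - 2)!] compares the terms with [nm u ^+ 2] times the
    exponential series. *)
Lemma expC_taylor2 u : nm (expC u - 1 - u) <= nm u ^+ 2 * expR (nm u).
Proof.
have -> : expC u - 1 - u = expC u - \sum_(k <- [:: 0; 1]%N) u ^+ k / k`!%:R.
  by rewrite big_cons big_seq1 expr0 expr1 /= !divr1 opprD addrA.
apply: (has_sum_leB (has_sum_expC u)) => // B uB dis.
have hB k : k \in B -> (1 < k)%N.
  by move=> /dis; rewrite !inE; case: k => [//|[//|]].
apply: (@le_trans _ _ (\sum_(k <- B) nm u ^+ 2 * (nm u ^+ (k - 2) / (k - 2)`!%:R))).
  rewrite big_seq [leRHS]big_seq; apply: ler_sum => k /hB k2.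
  rewrite nmM nmX nmV nm_nat mulrA -exprD subnKC // ler_wpM2l ?exprn_ge0 ?nm_ge0 //.
  rewrite lef_pV2 ?posrE ?ltr0n ?fact_gt0 // ler_nat; apply: leq_fact; exact: leq_subr.
rewrite -mulr_sumr ler_wpM2l ?exprn_ge0 ?nm_ge0 //.
have := @sum_exp_le (nm u) [seq (k - 2)%N | k <- B] (nm_ge0 u); rewrite big_map; apply.
by rewrite map_inj_in_uniq // => a b /hB ? /hB ? ?; lia.
Qed.

Definition expK : R := 2 * expR 1 + 6.

Lemma expK_gt0 : 0 < expK.
Proof. by rewrite /expK; have := expR_gt0 (1 : R); lra. Qed.

(** The exponential is at most 1 in the left half-plane, so no growth factor is left: Taylor's
    formula serves for [nm u <= 1], and beyond it [2 + nm u <= 3 * nm u ^+ 2]. *)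
Lemma expC_taylor2_half u : complex.Re u <= 0 ->
  nm (expC u - 1 - u) <= (expR 1 + 3) * nm u ^+ 2 /\
  nm (expC u - 1) <= (expR 1 + 3) * nm u.
Proof.
move=> u0; have e1 := expR_gt0 (1 : R); have n0 := nm_ge0 u.
have h1 : nm (expC u) <= 1 by rewrite nm_expC expR_le1.
have t1 : nm (expC u - 1) <= 2.
  by apply: (le_trans (nmB _ _)); rewrite nm1; lra.
have [hu|hu] := leP (nm u) 1.
  have h2 : nm (expC u - 1 - u) <= nm u ^+ 2 * expR 1.
    apply: (le_trans (expC_taylor2 u)); rewrite ler_wpM2l ?exprn_ge0 //.
    by rewrite ler_expR.
  have e : nm u ^+ 2 <= nm u by rewrite expr2; nra.
  have e' : 0 <= nm u ^+ 2 by rewrite exprn_ge0.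
  split; first by nra.
  have -> : expC u - 1 = (expC u - 1 - u) + u by ring.
  by apply: (le_trans (nmD _ _)); nra.
have e : nm u <= nm u ^+ 2 by rewrite expr2; nra.
by split; [apply: (le_trans (nmB _ _)); nra | nra].
Qed.

(** The expansion is made at whichever of [a] and [b] has the larger real part, so that the
    exponential of the difference has modulus at most 1. If this is [b], the change of the
    derivative adds to the remainder; hence [expK], twice the constant of [expC_taylor2_half]. *)
Lemma expC_second_order a b (M : R) :
  expR (complex.Re a) <= M -> expR (complex.Re b) <= M ->
  nm (expC b - expC a - (b - a) * expC a) <= expK * nm (b - a) ^+ 2 * M.
Proof.
move=> ha hb; have e1 := expR_gt0 (1 : R).
have M0 : 0 <= M by apply: (le_trans (expR_ge0 _) ha).
have n0 := nm_ge0 (b - a).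
have s0 : 0 <= nm (b - a) ^+ 2 by rewrite exprn_ge0.
have [h|h] := leP (complex.Re b) (complex.Re a).
  have -> : expC b - expC a - (b - a) * expC a = expC a * (expC (b - a) - 1 - (b - a)).
    have -> : expC b = expC a * expC (b - a) by rewrite -expCD addrC subrK.
    by ring.
  rewrite nmM nm_expC; have [|h1 _] := @expC_taylor2_half (b - a).
    by rewrite cReD cReN; lra.
  rewrite mulrC ler_pM ?expR_ge0 ?nm_ge0 //; apply: (le_trans h1).
  by rewrite ler_wpM2r // /expK; lra.
have -> : expC b - expC a - (b - a) * expC a =
    expC b * (- (expC (a - b) - 1 - (a - b)) - (b - a) * (expC (a - b) - 1)).
  have -> : expC a = expC b * expC (a - b) by rewrite -expCD addrC subrK.
  by ring.
have [|h1 h2] := @expC_taylor2_half (a - b).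
  by rewrite cReD cReN; lra.
rewrite nmM nm_expC mulrC ler_pM ?expR_ge0 ?nm_ge0 //.
apply: (le_trans (nmB _ _)); rewrite nmN nmM.
move: h1 h2; rewrite (nm_distC a b); set x := nm (b - a) in n0 s0 *.
set p := nm _; set q := nm _ => h1 h2.
have : x * q <= x * ((expR 1 + 3) * x) by rewrite ler_wpM2l.
rewrite /expK expr2 in s0 h1 *; nra.
Qed.

Lemma eD z w : e (z + w) = e z * e w.
Proof. by rewrite /e mulrDr expCD. Qed.

Lemma Re_2pii z : complex.Re (2 * pi%:C * 'i * z) = - (2 * pi * complex.Im z).
Proof. by case: z => x y; rewrite -(rmorph_nat (real_complex R)); simpc => /=; ring. Qed.

Lemma Im_2pii z : complex.Im (2 * pi%:C * 'i * z) = 2 * pi * complex.Re z.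
Proof. by case: z => x y; rewrite -(rmorph_nat (real_complex R)); simpc => /=; ring. Qed.

Lemma nm_e z : nm (e z) = expR (- (2 * pi * complex.Im z)).
Proof. by rewrite /e nm_expC Re_2pii. Qed.

Lemma Re_e z : complex.Re (e z) =
  expR (- (2 * pi * complex.Im z)) * cos (2 * pi * complex.Re z).
Proof. by rewrite /e /expC Re_2pii Im_2pii cReM /= mul0r subr0. Qed.

Lemma Im_e z : complex.Im (e z) =
  expR (- (2 * pi * complex.Im z)) * sin (2 * pi * complex.Re z).
Proof. by rewrite /e /expC Re_2pii Im_2pii cImM /= mul0r addr0. Qed.

Lemma e0 : e 0 = 1 :> C.
Proof. by rewrite /e mulr0 expC0. Qed.

Lemma e_neq0 z : e z != 0.
Proof. exact: expC_neq0. Qed.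

Lemma eN z : e (- z) = (e z)^-1.
Proof. by rewrite /e mulrN expCN. Qed.

Lemma e_natM n z : e (n%:R * z) = e z ^+ n.
Proof.
by elim: n => [|n IH]; rewrite ?mul0r ?e0 ?expr0 // -natr1 mulrDl mul1r eD IH exprSr.
Qed.

Lemma e1 : e 1 = 1 :> C.
Proof.
rewrite /e mulr1 /expC; have := Re_2pii 1; have := Im_2pii 1; rewrite !mulr1 /= => -> ->.
by rewrite mulr0 oppr0 expR0 mul1r mulrC mulr_natr cos2pi sin2pi.
Qed.

Lemma e_nat n : e n%:R = 1 :> C.
Proof. by rewrite -[n%:R]mulr1 e_natM e1 expr1n. Qed.

Lemma e_int (n : int) : e n%:~R = 1 :> C.
Proof. by case: n => n; rewrite ?NegzE ?mulrNz ?eN e_nat ?invr1. Qed.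

Lemma eDint z (n : int) : e (z + n%:~R) = e z.
Proof. by rewrite eD e_int mulr1. Qed.

Lemma eDnat z n : e (z + n%:R) = e z.
Proof. by rewrite eD e_nat mulr1. Qed.

Lemma nm_e_lt1 z : 0 < complex.Im z -> nm (e z) < 1.
Proof. by move=> h; rewrite nm_e expR_lt1 oppr_lt0 !mulr_gt0 ?pi_gt0. Qed.

Lemma cos_lt1 (t : R) : 0 < t < 2 * pi -> cos t < 1.
Proof.
move=> /andP[t0 t1]; set u := t / 2; have -> : t = u *+ 2 by rewrite mulr2n /u; lra.
have s0 : 0 < sin u by apply: sin_gt0_pi; apply/andP; rewrite /u; split; lra.
have s2 : 0 < sin u ^+ 2 by rewrite exprn_gt0.
by rewrite cos_mulr2n mulr2n; have := cos2Dsin2 u; lra.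
Qed.

Lemma e_rat_neq1 (n d : nat) : (0 < n < d)%N -> e (n%:R / d%:R) != 1 :> C.
Proof.
move=> /andP[n0 nd]; apply/eqP => h.
have d0 : (0 < d)%N by lia.
have E : (n%:R / d%:R : C) = (n%:R / d%:R : R)%:C.
  by rewrite rmorphM /= fmorphV /= !rmorph_nat.
have := congr1 (@complex.Re R) h; rewrite /e /expC E Re_2pii Im_2pii /=.
rewrite mulr0 oppr0 expR0 mul1r /= mul0r subr0 => hc.
suff : cos (2 * pi * (n%:R / d%:R)) < 1 :> R by rewrite hc ltxx.
have p0 := pi_gt0 R; have x0 : 0 < (n%:R / d%:R : R) by rewrite divr_gt0 ?ltr0n.
have x1 : (n%:R / d%:R : R) < 1 by rewrite ltr_pdivrMr ?ltr0n // mul1r ltr_nat.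
by apply: cos_lt1; apply/andP; split; nra.
Qed.

Lemma sum_e_orth (n d : nat) : (0 < d)%N ->
  \sum_(b < d) e (n%:R * b%:R / d%:R) = (if (d %| n)%N then d%:R else 0) :> C.
Proof.
move=> d0; have d0' : d%:R != 0 :> C by rewrite pnatr_eq0 -lt0n.
have E (b : nat) : e (n%:R * b%:R / d%:R) = e (n%:R / d%:R) ^+ b :> C.
  by rewrite -e_natM; congr (e _); field.
have hd : e (n%:R / d%:R) ^+ d = 1 :> C by rewrite -E mulfK // e_nat.
rewrite (eq_bigr (fun b : 'I_d => e (n%:R / d%:R) ^+ b)) => [|b _]; last exact: E.
case: ifP => hn.
  have -> : e (n%:R / d%:R) = 1 :> C.
    case/dvdnP: hn => k ->; by rewrite natrM mulfK // e_nat.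
  rewrite (eq_bigr (fun=> 1)) ?sumr_const ?card_ord // => i _; exact: expr1n.
have n1 : e (n%:R / d%:R) != 1 :> C.
  have -> : e (n%:R / d%:R) = e ((n %% d)%:R / d%:R) :> C.
    rewrite {1}(divn_eq n d) natrD natrM mulrDl mulfK // addrC eDnat //.
  apply: e_rat_neq1; rewrite ltn_mod d0 andbT lt0n; move: hn; by rewrite /dvdn => ->.
apply: (mulfI (x := e (n%:R / d%:R) - 1)); first by rewrite subr_eq0.
by rewrite -subrX1 hd subrr mulr0.
Qed.

(** Serves to realise a given radius below 1 by a point of the half-plane, so that bounds on the
    half-plane become bounds for power series. *)
Lemma e_surj (q : C) : q != 0 -> nm q < 1 -> exists2 z, upper_half_plane z & e z = q.
Proof.
rewrite -nm_gt0 => q0 q1; have p0 := pi_gt0 R.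
pose y := - ln (nm q) / (2 * pi).
pose c := complex.Re q / nm q; pose s := complex.Im q / nm q.
have cs : c ^+ 2 + s ^+ 2 = 1.
  rewrite /c /s !expr_div_n -mulrDl -nm_sqr divff // expf_neq0 //; lra.
have hc : -1 <= c <= 1.
  have : c ^+ 2 <= 1 by have := sqr_ge0 s; lra.
  by rewrite -ler_norml -{1}(expr1n _ 2) -[leLHS]real_normK ?num_real // ler_pXn2r ?nnegrE.
have [t ht1 ht2] : exists2 t : R, cos t = c & sin t = s.
  have ha : sin (acos c) = `|s|.
    rewrite sin_acos //; have -> : 1 - c ^+ 2 = s ^+ 2 by rewrite -cs addrC addKr.
    by rewrite sqrtr_sqr.
  have hb : cos (acos c) = c by rewrite acosK // in_itv.
  have [hs|hs] := leP 0 s.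
    by exists (acos c) => //; rewrite ha ger0_norm.
  by exists (- acos c); rewrite ?cosN ?sinN // ha ltr0_norm // opprK.
pose x := t / (2 * pi).
exists (x +i* y).
  rewrite /upper_half_plane /=.
  by rewrite divr_gt0 ?mulr_gt0 // oppr_gt0 ln_lt0 // q0.
rewrite /e /expC Re_2pii Im_2pii /=.
have -> : 2 * pi * x = t by rewrite /x mulrC divfK // mulf_neq0 ?pnatr_eq0 // lt0r_neq0.
have -> : - (2 * pi * y) = ln (nm q) by rewrite /y mulrC divfK ?opprK // mulf_neq0 ?pnatr_eq0 // lt0r_neq0.
rewrite lnK ?posrE // ht1 ht2 /c /s; case: (q) q0 => a b /= q0.
rewrite -complexr0; simpc; by congr (_ +i* _); field; rewrite lt0r_neq0.
Qed.

(** Near 0 the linear term dominates; away from 0, either the imaginary part keeps [nm (e w)] away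
    from 1, or the real part keeps the cosine away from 1. The bound controls the poles of [polylog]
    in Lipschitz's formula. *)
Lemma one_sub_e_lb : exists2 k : R, 0 < k & forall w,
  `|complex.Re w| <= 1 / 2 -> 0 < complex.Im w <= 1 -> k * nm w <= nm (1 - e w).
Proof.
have p0 := pi_gt0 R; have e1 := expR_gt0 (1 : R).
(* For [nm w <= d] the quadratic Taylor error is at most half the linear term [2 * pi * nm w], which
   leaves [pi * nm w]. *)
pose d : R := 1 / (2 * pi * (2 * (expR 1 + 3))).
have d0 : 0 < d by rewrite divr_gt0 // !mulr_gt0 //; lra.
have dE : d * (2 * pi * (2 * (expR 1 + 3))) = 1.
  by rewrite /d mul1r mulVf // lt0r_neq0 // !mulr_gt0 //; lra.
have p2 := pi_ge2 R.
have d1 : d < 1 / 4.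
  have h24 : 24 <= 2 * pi * (2 * (expR 1 + 3)) :> R by nra.
  have : d * 24 <= d * (2 * pi * (2 * (expR 1 + 3))) by rewrite ler_wpM2l // ltW.
  by rewrite dE => h; lra.
pose k1 : R := 1 - expR (- (2 * pi * (d / 2))).
have k10 : 0 < k1 by rewrite subr_gt0 expR_lt1 oppr_lt0; nra.
pose k2 : R := 2 * expR (- (2 * pi)) * (1 - cos (2 * pi * (d / 2))).
have k20 : 0 < k2.
  rewrite !mulr_gt0 ?expR_gt0 // subr_gt0 cos_lt1 //; apply/andP; split; nra.
pose k : R := Num.min pi (Num.min (k1 / 2) (Num.sqrt k2 / 2)).
exists k; first by rewrite !lt_min p0 !divr_gt0 // sqrtr_gt0.
move=> w hx /andP[y0 y1].
have ka : k <= pi by rewrite ge_min lexx.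
have kb : k <= k1 / 2 by rewrite /k !ge_min lexx !orbT.
have kc : k <= Num.sqrt k2 / 2 by rewrite /k !ge_min lexx !orbT.
have w0 := nm_ge0 w.
have w2 : nm w <= 2 by apply: (le_trans (nm_le_ReIm _)); rewrite (ger0_norm (ltW y0)); lra.
have [hd|hd] := leP (nm w) d.
  pose u := 2 * pi%:C * 'i * w.
  have nu : nm u = 2 * pi * nm w.
    by rewrite /u !nmM nm_nat nm_real nm_i mulr1 ger0_norm ?pi_ge0.
  have [|h _] := @expC_taylor2_half u.
    by rewrite Re_2pii oppr_le0 !mulr_ge0 ?pi_ge0 // ltW.
  have := nmB_ge u (1 + u - expC u).
  have -> : u - (1 + u - expC u) = - (1 - e w) by rewrite /e -/u; ring.
  rewrite nmN => h2.
  have h3 : nm (1 + u - expC u) <= (expR 1 + 3) * nm u ^+ 2.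
    by rewrite -nmN; have -> : - (1 + u - expC u) = expC u - 1 - u by ring.
  apply: le_trans h2; apply: le_trans (lerB (lexx _) h3); rewrite nu.
  have : (2 * pi * nm w) * (expR 1 + 3) <= 1 / 2 by nra.
  rewrite expr2; set a := nm w in w0 *; set E := expR 1.
  move=> h4; have : k * a <= pi * a by rewrite ler_wpM2r.
  have : (2 * pi * a) * (E + 3) * (2 * pi * a) <= 1 / 2 * (2 * pi * a).
    by rewrite ler_wpM2r // !mulr_ge0 ?pi_ge0.
  by lra.
have [hy|hy] := leP (d / 2) (complex.Im w).
  apply: (@le_trans _ _ k1); first by nra.
  have := nmB_ge 1 (e w); rewrite nm1 nm_e => h; apply: le_trans h.
  rewrite lerB // ler_expR lerN2 !ler_pM2l //; lra.
have hx2 : d / 2 < `|complex.Re w|.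
  by have := nm_le_ReIm w; rewrite (gtr0_norm y0) => h; lra.
apply: (@le_trans _ _ (Num.sqrt k2)); first by have := sqrtr_ge0 k2; nra.
rewrite ler_sqrt ?addr_ge0 ?sqr_ge0 //.
rewrite cReD cImD cReN cImN Re_e Im_e /= sub0r sqrrN.
set r := expR _; set t := 2 * pi * complex.Re w.
have -> : (1 - r * cos t) ^+ 2 + (r * sin t) ^+ 2 =
    (1 - r) ^+ 2 + 2 * r * (1 - cos t).
  have := cos2Dsin2 t; rewrite !exprMn => h.
  have -> : sin t ^+ 2 = 1 - cos t ^+ 2 by lra.
  by ring.
have hr : expR (- (2 * pi)) <= r by rewrite /r ler_expR; nra.
have hcos : cos t <= cos (2 * pi * (d / 2)).
  rewrite -cos_norm /t normrM (ger0_norm (x := 2 * pi)); last nra.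
  apply: ltW; rewrite ltr_cos ?in_itv /=; first nra; apply/andP; split; nra.
have c1 := cos_le1 t; have r0 := expR_gt0 (- (2 * pi) : R).
have := sqr_ge0 (1 - r); rewrite /k2; set c2 := cos (2 * pi * (d / 2)) in hcos *.
set r1 := expR (- (2 * pi)) in hr r0 *.
move=> h; have : 2 * r1 * (1 - c2) <= 2 * r * (1 - cos t).
  by rewrite ler_pM //; [lra | have := cos_le1 (2 * pi * (d / 2)); rewrite -/c2; lra| lra |lra].
lra.
Qed.

End Exponential.

(** * Lipschitz's formula *)

Section Lipschitz.
Variable R : realType.
Local Notation C := R[i].
Implicit Types (z w q : C).

(** For [x >= 1], [1 / (1 + x^2) <= 2 / (x (x + 1))], which telescopes. *)
Lemma summ_invsq_nat : summ (fun n : nat => (1 + n%:R ^+ 2)^-1 : R).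
Proof.
apply: (@summ_nat _ _ 3) => [n|n]; first by rewrite invr_ge0 addr_ge0 // exprn_ge0.
have H m : \sum_(i < m.+1) (1 + i%:R ^+ 2 : R)^-1 <= 3 - 2 * m.+1%:R^-1.
  elim: m => [|m IH]; first by rewrite big_ord1 expr0n addr0 invr1; lra.
  rewrite big_ord_recr /=; apply: (le_trans (lerD IH (lexx _))).
  set x : R := m.+1%:R; have x1 : 1 <= x by rewrite ler1n.
  have -> : m.+2%:R = x + 1 :> R by rewrite /x natr1.
  have h : (1 + x ^+ 2)^-1 <= 2 * (x * (x + 1))^-1.
    have x2 : 0 < 1 + x ^+ 2 by rewrite ltr_pwDl ?sqr_ge0.
    have x3 : 0 < x * (x + 1) by rewrite mulr_gt0; lra.
    rewrite -div1r ler_pdivrMr // mulrAC ler_pdivlMr // mul1r expr2; nra.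
  have E : (x * (x + 1))^-1 = x^-1 - (x + 1)^-1 by field; apply/andP; split; lra.
  move: h; rewrite E; set A := (1 + _)^-1; set B := x^-1; set D := (x + 1)^-1.
  by move=> h; lra.
case: n => [|n]; first by rewrite big_ord0.
by apply: (le_trans (H n)); rewrite gerBl mulr_ge0 ?invr_ge0.
Qed.

Lemma summ_invsq_int : summ (fun n : int => (1 + n%:~R ^+ 2)^-1 : R).
Proof.
have g0 (x : R) : 0 < 1 + x ^+ 2 by rewrite ltr_pwDl ?sqr_ge0.
apply: (summ_fiber (h := absz) (c := fun n : nat => 2 * (1 + n%:R ^+ 2)^-1)).
- by move=> n; rewrite invr_ge0 ltW.
- by apply: summZ => //; exact: summ_invsq_nat.
move=> u B uB hB; apply: (@le_trans _ _ (\sum_(n <- undup [:: u%:Z; - u%:Z]) (1 + n%:~R ^+ 2)^-1)).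
  apply: sum_uniq_sub => //; first by move=> n; rewrite invr_ge0 ltW.
    exact: undup_uniq.
  by move=> n /hB hn; rewrite mem_undup !inE; lia.
apply: (@le_trans _ _ (\sum_(n <- undup [:: u%:Z; - u%:Z]) (1 + u%:R ^+ 2)^-1)).
  rewrite big_seq [leRHS]big_seq; apply: ler_sum => n; rewrite mem_undup !inE.
  by case/orP => /eqP ->; rewrite ?mulrNz ?sqrrN.
rewrite big_const_seq count_predT iter_addr_0 -[X in X <= _]mulr_natl.
apply: ler_wpM2r; first by rewrite invr_ge0 ltW.
by rewrite (ler_nat R _ 2); exact: size_undup.
Qed.

(** For z = x + i y, from [d^2 <= 2 (c x + d)^2 + 2 c^2 x^2] one gets [c^2 + d^2 <= 2 (c x + d)^2 +
    (2 x^2 + 1) c^2], and [c^2 = (c y)^2 / y^2]. *)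
Definition latK z : R := 2 + (2 * complex.Re z ^+ 2 + 1) / complex.Im z ^+ 2.

Lemma latK_gt0 z : 0 < latK z.
Proof.
by rewrite ltr_pwDl // divr_ge0 ?sqr_ge0 // addr_ge0 // mulr_ge0 // sqr_ge0.
Qed.

Lemma lattice_bound z (c d : R) : 0 < complex.Im z ->
  c ^+ 2 + d ^+ 2 <= latK z * nm (c%:C * z + d%:C) ^+ 2.
Proof.
move=> y0; rewrite nm_sqr cReD cImD cReM cImM /= !mul0r subr0 !addr0.
set x := complex.Re z; set y := complex.Im z; rewrite /latK -/x -/y.
have y2 : 0 < y ^+ 2 by rewrite exprn_gt0.
have h : (2 * x ^+ 2 + 1) / y ^+ 2 * (c * y) ^+ 2 = (2 * x ^+ 2 + 1) * c ^+ 2.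
  by field; rewrite lt0r_neq0.
rewrite mulrDl mulrDr [X in _ <= _ + X]mulrDr h.
have : 0 <= (2 * x ^+ 2 + 1) / y ^+ 2 * (c * x + d) ^+ 2.
  by rewrite mulr_ge0 ?sqr_ge0 // divr_ge0 ?sqr_ge0 // addr_ge0 // mulr_ge0 // sqr_ge0.
have := sqr_ge0 (c * y); have := sqr_ge0 (2 * c * x + d).
by rewrite !expr2; nra.
Qed.

Lemma nm_addint_ge z (n : int) : complex.Im z <= nm (z + n%:~R).
Proof.
apply: le_trans (Im_le_nm _); rewrite cImD Im_int addr0; exact: ler_norm.
Qed.

Lemma nm_addint_bound z (n : int) : 0 < complex.Im z ->
  (nm (z + n%:~R))^-1 ^+ 2 <= latK z * (1 + n%:~R ^+ 2)^-1.
Proof.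
move=> y0; have := lattice_bound 1 n%:~R y0; rewrite rmorph1 mul1r expr1n rmorph_int.
have h := nm_addint_ge z n; have K0 := latK_gt0 z.
have g0 : 0 < 1 + n%:~R ^+ 2 :> R by rewrite ltr_pwDl ?sqr_ge0.
have n0 : 0 < nm (z + n%:~R) ^+ 2 by rewrite exprn_gt0 //; lra.
by rewrite exprVn -div1r ler_pdivrMr // mulrAC ler_pdivlMr // mul1r.
Qed.

Lemma summ_lip z p : 0 < complex.Im z -> (0 < p)%N ->
  summ (fun n : int => nm ((z + n%:~R) ^- p.+1)).
Proof.
case: p => // p y0 _.
apply: (summ_le_nm (c := fun n : int => ((complex.Im z)^-1 ^+ p * latK z) * (1 + n%:~R ^+ 2)^-1)).
  apply: summZ; last exact: summ_invsq_int.
  by rewrite mulr_ge0 ?exprn_ge0 ?invr_ge0 ?ltW ?latK_gt0.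
move=> n; rewrite nmV nmX -exprVn -addn2 exprD -mulrA.
have h := nm_addint_ge z n.
rewrite ler_pM ?exprn_ge0 ?invr_ge0 ?nm_ge0 ?nm_addint_bound //.
have hi : (nm (z + n%:~R))^-1 <= (complex.Im z)^-1 by rewrite lef_pV2 ?posrE //; lra.
by rewrite lerXn2r ?nnegrE ?invr_ge0 ?nm_ge0 ?(ltW y0).
Qed.

Lemma summ_geo (t : R) : 0 <= t < 1 -> summ (fun n => t ^+ n).
Proof.
move=> /andP[t0 t1]; apply: (@summ_nat _ _ (1 - t)^-1) => [n|n]; first exact: exprn_ge0.
have h : (1 - t) * \sum_(i < n) t ^+ i = 1 - t ^+ n.
  by rewrite -opprB mulNr -subrX1 opprB.
have t1' : 0 < 1 - t by lra.
by rewrite -[leRHS]mul1r ler_pdivlMr // mulrC h gerBl exprn_ge0.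
Qed.

Lemma summ_geoC q : nm q < 1 -> summ (fun n => nm (q ^+ n)).
Proof.
move=> q1; apply: (summ_le (@summ_geo (nm q) _)); first by rewrite nm_ge0.
by move=> n; rewrite nm_ge0 nmX lexx.
Qed.

Lemma cvg_geo0 q : nm q < 1 -> cvs (fun n => q ^+ n) 0.
Proof.
move=> q1; apply: (cvs_squeeze0 (b := fun n => nm q ^+ n)).
  by exists 0%N => n _; rewrite subr0 nmX.
by apply: cvg_expr; rewrite ger0_norm ?nm_ge0.
Qed.

Lemma has_sum_geo q : nm q < 1 -> has_sum (fun n => q ^+ n) (1 - q)^-1.
Proof.
move=> q1; have [s hs] := summ_has_sum (summ_geoC q1).
suff -> : (1 - q)^-1 = s by [].
apply: (cvs_uniq _ (has_sum_cvs hs)).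
have d0 : 1 - q != 0.
  by rewrite subr_eq0; apply/eqP => e; move: q1; rewrite -e nm1 ltxx.
have E n : \sum_(i < n) q ^+ i = (1 - q ^+ n) * (1 - q)^-1.
  apply: (canRL (mulfK d0)); rewrite mulrC -opprB mulNr -subrX1 opprB //.
apply: (cvs_ext (u := fun n => (1 - q ^+ n) * (1 - q)^-1)).
  by exists 0%N => n _; rewrite E.
rewrite (_ : (1 - q)^-1 = (1 - 0) * (1 - q)^-1); last by rewrite subr0 mul1r.
apply: cvsM; last by rewrite subr0 mul1r; exact: cvs_cst.
apply: cvsB; first exact: cvs_cst.
exact: cvg_geo0.
Qed.

Lemma has_sum_bin q j : nm q < 1 ->
  summ (fun n => nm ('C(n + j, j)%:R * q ^+ n)) /\
  has_sum (fun n => 'C(n + j, j)%:R * q ^+ n) ((1 - q)^-1 ^+ j.+1).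
Proof.
move=> q1; elim: j => [|j [IH1 IH2]].
  split.
    by apply: (summ_le (summ_geoC q1)) => n; rewrite nm_ge0 bin0 mul1r lexx.
  by rewrite expr1; apply: (has_sum_ext _ (has_sum_geo q1)) => n; rewrite bin0 mul1r.
have E n : \sum_(i < n.+1) 'C(i + j, j)%:R * q ^+ i * q ^+ (n - i) =
    'C(n + j.+1, j.+1)%:R * q ^+ n.
  transitivity ((\sum_(i < n.+1) 'C(i + j, j))%:R * q ^+ n).
    rewrite natr_sum mulr_suml; apply: eq_bigr => i _.
    by rewrite -mulrA -exprD subnKC // -ltnS.
  congr (_%:R * _); elim: n => [|n IH]; first by rewrite big_ord1 !add0n !binn.
  by rewrite big_ord_recr /= IH [in RHS]addnS binS addSnnS.
split.
  apply: (summ_le (summ_cauchy IH1 (summ_geoC q1))) => n; rewrite nm_ge0 /= -E.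
  by apply: (le_trans (nm_sum _ _ _)); apply: ler_sum => i _; rewrite nmM.
rewrite exprSr; have := has_sum_cauchy IH1 (summ_geoC q1) IH2 (has_sum_geo q1).
by apply: has_sum_ext.
Qed.

(** Coefficient of the binomial ['C(n + j, j)] in [n ^ p]; the recursion is [n 'C(n + i, i) = (i +
    1) ('C(n + i + 1, i + 1) - 'C(n + i, i))]. *)
Fixpoint bcoef p j : int :=
  if p is p'.+1 then
    (if j is j'.+1 then j'.+1%:Z * bcoef p' j' else 0) - j.+1%:Z * bcoef p' j
  else (j == 0%N)%:Z.

Lemma bcoef_gt p j : (p < j)%N -> bcoef p j = 0.
Proof.
elim: p j => [|p IH] [|j] //= h; rewrite !IH ?mulr0 ?subr0 //; exact: ltnW.
Qed.

Lemma bcoef_diag p : bcoef p p = p`!%:Z.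
Proof.
by elim: p => [//|p IH] /=; rewrite IH bcoef_gt // mulr0 subr0 factS PoszM.
Qed.

Lemma pow_bin_basis p (n : nat) :
  n%:Z ^+ p = \sum_(j < p.+1) bcoef p j * 'C(n + j, j)%:Z.
Proof.
elim: p => [|p hb]; first by rewrite big_ord1 bin0 expr0.
have E1 : \sum_(j < p.+2) (if j : nat is j'.+1 then j'.+1%:Z * bcoef p j' else 0) * 'C(n + j, j)%:Z =
    \sum_(i < p.+1) i.+1%:Z * bcoef p i * 'C(n + i.+1, i.+1)%:Z.
  by rewrite big_ord_recl mul0r add0r.
have E2 : \sum_(j < p.+2) (j.+1%:Z * bcoef p j) * 'C(n + j, j)%:Z =
    \sum_(i < p.+1) i.+1%:Z * bcoef p i * 'C(n + i, i)%:Z.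
  by rewrite big_ord_recr /= bcoef_gt // mulr0 mul0r addr0.
rewrite exprSr hb mulr_suml; under [RHS]eq_bigr do rewrite mulrBl.
rewrite sumrB E1 E2 -sumrB; apply: eq_bigr => i _.
have := mul_bin_diag (n + i.+1) i; rewrite {2}addnS /= => /(congr1 Posz).
rewrite !PoszM; have -> : (n + i.+1)%N%:Z = n%:Z + i.+1%:Z by rewrite PoszD.
set A := 'C(_, _)%:Z; set B := 'C(_, _)%:Z => h.
by rewrite -[_ * bcoef p i * B]mulrA [bcoef p i * B]mulrC mulrA -h; ring.
Qed.

Lemma summ_powq q p : nm q < 1 -> summ (fun n => nm (n%:R ^+ p * q ^+ n)).
Proof.
move=> q1; have [h _] := has_sum_bin p q1.
apply: (summ_le (summZ (ler0n _ p`!) h)) => n; rewrite nm_ge0 !nmM mulrA.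
rewrite ler_wpM2r ?nm_ge0 // nmX !nm_nat -natrM -natrX ler_nat.
rewrite mulnC bin_ffact addnC; elim: p {h} => // p IH.
rewrite expnSr addSn ffactSS; apply: (leq_trans (leq_mul IH (leqnn n))).
by rewrite mulnC leq_mul // -addSn leq_addl.
Qed.

(** The polylogarithm of order -p at [e z]. By [polylog_rational] it is a polynomial of degree p + 1
    in [1 / (1 - e z)]. *)
Definition polylog p z : C := csum (fun r : nat => r%:R ^+ p * e z ^+ r).

Lemma has_sum_polylog p z : 0 < complex.Im z ->
  has_sum (fun r : nat => r%:R ^+ p * e z ^+ r) (polylog p z).
Proof. by move=> y0; apply: csumP; apply: summ_powq; apply: nm_e_lt1. Qed.

Lemma polylog_rational p z : 0 < complex.Im z ->
  polylog p z = \sum_(j < p.+1) (bcoef p j)%:~R * (1 - e z)^-1 ^+ j.+1.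
Proof.
move=> y0; apply: csumE; have q1 := nm_e_lt1 y0.
have H : has_sum (fun n => \sum_(j < p.+1) (bcoef p j)%:~R * ('C(n + j, j)%:R * e z ^+ n))
    (\sum_(j < p.+1) (bcoef p j)%:~R * (1 - e z)^-1 ^+ j.+1).
  by apply: has_sum_sum => j; apply: has_sumZ; have [_] := has_sum_bin j q1.
apply: (has_sum_ext _ H) => n.
have := congr1 (fun x : int => x%:~R : C) (pow_bin_basis p n); rewrite rmorphXn /= => ->.
rewrite rmorph_sum mulr_suml; apply: eq_bigr => i _.
by rewrite rmorphM /= mulrA.
Qed.

Lemma polylogDint p z (n : int) : polylog p (z + n%:~R) = polylog p z.
Proof. by rewrite /polylog eDint. Qed.

(** By orthogonality only the exponents divisible by [M] survive. The shift [a] allows a range of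
    translates symmetric about 0. *)
Lemma polylog_distrib p z (M : nat) (a : int) : 0 < complex.Im z -> (0 < M)%N -> (0 < p)%N ->
  \sum_(i < M) polylog p ((z + i%:R + a%:~R) / M%:R) = M%:R ^+ p.+1 * polylog p z.
Proof.
move=> y0 M0 p0; have M0' : M%:R != 0 :> C by rewrite pnatr_eq0 -lt0n.
have hIm i : 0 < complex.Im ((z + i%:R + a%:~R) / M%:R : C).
  have -> : (M%:R : C)^-1 = (M%:R^-1)%:C by rewrite fmorphV /= rmorph_nat.
  rewrite cImM !cImD Im_nat Im_int /= mulr0 add0r !addr0.
  by rewrite mulr_gt0 // invr_gt0 ltr0n.
have h1 := has_sum_sum (index_enum 'I_M) (fun i : 'I_M => has_sum_polylog p (hIm i)).
apply: (has_sum_uniq h1).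
apply: (has_sum_inj (h := fun s : nat => (M * s)%N)).
- by move=> x y /eqP; rewrite eqn_pmul2l // => /eqP.
- move=> r hr; rewrite -mulr_sumr.
  have -> : \sum_(i < M) e ((z + i%:R + a%:~R) / M%:R) ^+ r =
     e (r%:R * (z + a%:~R) / M%:R) * \sum_(i < M) e (r%:R * i%:R / M%:R).
    rewrite mulr_sumr; apply: eq_bigr => i _; rewrite -e_natM -eD; congr (e _).
    by field.
  rewrite sum_e_orth //; case: ifP => [/dvdnP[s hs]|_]; last by rewrite !mulr0.
  by have := hr s; rewrite hs mulnC eqxx.
have := has_sumZ (M%:R ^+ p.+1) (has_sum_polylog p y0).
apply: has_sum_ext => s.
rewrite (eq_bigr (fun=> (M * s)%:R ^+ p * e z ^+ s)).
  rewrite sumr_const card_ord -[RHS]mulr_natl natrM [(M%:R * s%:R) ^+ p]exprMn exprS; ring.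
move=> i _; congr (_ * _); rewrite -!e_natM natrM.
have -> : M%:R * s%:R * ((z + i%:R + a%:~R) / M%:R) =
   s%:R * z + (s%:R * i%:R + s%:R * a%:~R) by field.
by rewrite -natrM -[s%:R]/(s%:Z%:~R) -rmorphM /= -[(s * i)%:R]/((s * i)%N%:Z%:~R) -rmorphD /= eDint.
Qed.

Definition lipK p : C := (- (2 * pi%:C * 'i)) ^+ p.+1 / p`!%:R.

Lemma cvs_natV (k : C) : cvs (fun n => k / n.+1%:R) 0.
Proof.
apply: (cvs_squeeze0 (b := fun n => nm k * n.+1%:R^-1)).
  by exists 0%N => n _; rewrite subr0 nmM nmV nm_nat.
rewrite -[X in (_ --> X)%classic](mulr0 (nm k)).
apply: cvgM; first exact: cvg_cst.
exact: cvg_harmonic.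
Qed.

Lemma cvs_one_sub_e w :
  cvs (fun n => n.+1%:R * (1 - e (w / n.+1%:R))) (- (2 * pi%:C * 'i * w)).
Proof.
pose u : C := 2 * pi%:C * 'i * w.
apply: (cvs_squeeze0 (b := fun n => (nm u ^+ 2 * expR (nm u)) * n.+1%:R^-1)).
  exists 0%N => n _; have n0 : n.+1%:R != 0 :> C by rewrite pnatr_eq0.
  have n0' : 0 < n.+1%:R :> R by rewrite ltr0n.
  have -> : e (w / n.+1%:R) = expC (u / n.+1%:R).
    by rewrite /e /u; congr expC; field.
  have -> : n.+1%:R * (1 - expC (u / n.+1%:R)) - - (2 * pi%:C * 'i * w) =
     - (n.+1%:R * (expC (u / n.+1%:R) - 1 - u / n.+1%:R)).
    by rewrite -/u; field.
  rewrite nmN nmM nm_nat; have := expC_taylor2 (u / n.+1%:R).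
  rewrite nmM nmV nm_nat exprMn => h.
  apply: (le_trans (ler_wpM2l (ltW n0') h)).
  have h2 : expR (nm u / n.+1%:R) <= expR (nm u).
    rewrite ler_expR ler_pdivrMr // -[leLHS]mulr1 ler_wpM2l ?nm_ge0 //.
    by rewrite ler1n.
  have -> : n.+1%:R * (nm u ^+ 2 * n.+1%:R^-1 ^+ 2 * expR (nm u / n.+1%:R)) =
     nm u ^+ 2 * expR (nm u / n.+1%:R) / n.+1%:R by field; rewrite lt0r_neq0.
  apply: ler_wpM2r; first by rewrite invr_ge0 ltW.
  by apply: ler_wpM2l; rewrite ?exprn_ge0 ?nm_ge0.
rewrite -[X in (_ --> X)%classic](mulr0 (nm u ^+ 2 * expR (nm u))).
apply: cvgM; first exact: cvg_cst.
exact: cvg_harmonic.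
Qed.

Lemma nm_addint_neq0 z (n : int) : 0 < complex.Im z -> z + n%:~R != 0.
Proof. by move=> y0; rewrite -nm_gt0 (lt_le_trans y0) // nm_addint_ge. Qed.

(** By the distribution relation for the [2 n + 1] points [(z + t) / (2 n + 1)], [|t| <= n], the
    right-hand side is, for every n, a finite sum over t. Its t-th term tends to [(z + t) ^- p.+1],
    because [polylog] has a pole of order p + 1 with leading coefficient p!. [tannery] exchanges
    limit and sum. *)
Lemma lipschitz_strip z p : 0 < complex.Im z -> `|complex.Re z| <= 1 / 2 -> (0 < p)%N ->
  has_sum (fun n : int => (z + n%:~R) ^- p.+1) (lipK p * polylog p z).
Proof.
move=> y0 x12 p0.
have [k k0 hk] := one_sub_e_lb R.
pose M n := (n.*2.+1)%N.
pose F n (t : int) : C := if (`|t| <= n)%N then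
   lipK p / (M n)%:R ^+ p.+1 * polylog p ((z + t%:~R) / (M n)%:R) else 0.
have M0 n : (M n)%:R != 0 :> C by rewrite pnatr_eq0.
have M0' n : 0 < (M n)%:R :> R by rewrite ltr0n.
have [s hs] := summ_has_sum (summ_lip y0 p0).
suff: cvs (fun=> lipK p * polylog p z) s by move=> /(cvs_uniq (cvs_cst _)) ->.
have Mc n : (M n)%:R^-1 = ((M n)%:R^-1)%:C :> C by rewrite fmorphV /= rmorph_nat.
have Imw n (t : int) : complex.Im ((z + t%:~R) / (M n)%:R) = complex.Im z / (M n)%:R.
  by rewrite Mc cImM cImD Im_int /= mulr0 add0r addr0.
have Rew n (t : int) : complex.Re ((z + t%:~R) / (M n)%:R) = (complex.Re z + t%:~R) / (M n)%:R.
  by rewrite Mc cReM cReD Re_int /= mulr0 subr0.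
have Imw0 n (t : int) : 0 < complex.Im ((z + t%:~R) / (M n)%:R).
  by rewrite Imw divr_gt0.
pose K : R := nm (lipK p) * \sum_(j < p.+1) nm ((bcoef p j)%:~R) * (k^-1 ^+ j.+1 * 2 ^+ (p - j)).
apply: (@tannery _ _ F _ (fun t => K * nm ((z + t%:~R) ^- p.+1))) hs.
- apply: summZ (summ_lip y0 p0); rewrite mulr_ge0 ?nm_ge0 //.
  apply: sumr_ge0 => j _; rewrite !mulr_ge0 ?nm_ge0 ?exprn_ge0 ?invr_ge0 ?ler0n ?ltW //.
(* Once n is at least [Im z], all the points [(z + t) / (2 n + 1)] lie in the box where
   [one_sub_e_lb] applies. *)
- have [N hN] : exists N : nat, complex.Im z <= N%:R.
    by exists (Num.bound (complex.Im z)); apply: ltW; apply: archi_boundP; apply: ltW.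
  exists N => n t nN; rewrite /F; case: ifP => [tn|_]; last first.
    rewrite nm0 mulr_ge0 ?nm_ge0 // mulr_ge0 ?nm_ge0 //.
    by apply: sumr_ge0 => j _; rewrite !mulr_ge0 ?nm_ge0 ?exprn_ge0 ?invr_ge0 ?ler0n ?ltW.
  have tn' : `|t%:~R| <= n%:R :> R by rewrite -intr_norm (ler_int R _ n); lia.
  have ME : (M n)%:R = 2 * n%:R + 1 :> R by rewrite /M -natr1 -muln2 natrM mulrC.
  set w := (z + t%:~R) / (M n)%:R.
  have hx : `|complex.Re w| <= 1 / 2.
    rewrite Rew normrM normfV (gtr0_norm (M0' n)) ler_pdivrMr // ME.
    by apply: (le_trans (ler_normD _ _)); lra.
  have hy : 0 < complex.Im w <= 1.
    rewrite Imw0 Imw ler_pdivrMr // mul1r ME; apply: (le_trans hN).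
    have Nn : N%:R <= n%:R :> R by rewrite ler_nat.
    by have : 0 <= n%:R :> R by []; lra.
  have hw := hk w hx hy.
  have w0 : 0 < nm w by rewrite nm_gt0 -nm_gt0 (lt_le_trans (Imw0 n t)) //; apply: le_trans (Im_le_nm _); rewrite ler_norm.
  have w2 : nm w <= 2.
    apply: (le_trans (nm_le_ReIm _)); case/andP: hy => ? ?.
    by rewrite (gtr0_norm (x := complex.Im w)) //; lra.
  have e0 : 0 < nm (1 - e w) by apply: lt_le_trans hw; rewrite mulr_gt0.
  have Ew : nm (z + t%:~R) = (M n)%:R * nm w.
    by rewrite /w nmM nmV nm_nat mulrC mulfVK // lt0r_neq0.
  rewrite nmM [nm (lipK p / _)]nmM !nmV !nmX nm_nat Ew /K -!mulrA ler_wpM2l ?nm_ge0 //.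
  rewrite exprMn invfM [X in _ <= X]mulrCA.
  apply: ler_wpM2l; first by rewrite invr_ge0 exprn_ge0 // ltW.
  rewrite polylog_rational //; last by case/andP: hy.
  apply: (le_trans (nm_sum _ _ _)); rewrite mulr_suml; apply: ler_sum => j _.
  rewrite nmM -mulrA ler_wpM2l ?nm_ge0 // nmX nmV.
  have jp : (j <= p)%N by rewrite -ltnS.
  have -> : nm w ^- p.+1 = (nm w)^-1 ^+ j.+1 * (nm w)^-1 ^+ (p - j).
    by rewrite -exprD addSn subnKC // exprVn.
  rewrite mulrACA -!exprMn.
  have h1 : (nm (1 - e w))^-1 <= k^-1 * (nm w)^-1.
    by rewrite -invfM lef_pV2 ?posrE ?mulr_gt0.
  have h2 : 1 <= 2 * (nm w)^-1 by rewrite ler_pdivlMr // mul1r.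
  rewrite -[leLHS]mulr1 ler_pM ?exprn_ge0 ?invr_ge0 ?nm_ge0 //.
    by rewrite lerXn2r ?nnegrE ?invr_ge0 ?nm_ge0 // mulr_ge0 ?invr_ge0 ?nm_ge0 // ltW.
  by rewrite exprn_ege1.
- move=> t; set w := z + t%:~R.
  have w0 : w != 0 by exact: nm_addint_neq0.
  have c0 : - (2 * pi%:C * 'i * w) != 0 :> C.
    rewrite oppr_eq0 !mulf_neq0 ?pnatr_eq0 //.
      by rewrite -nm_gt0 nm_real normr_gt0 lt0r_neq0 // pi_gt0.
    by rewrite -nm_gt0 nm_i.
  pose G m : C := lipK p * \sum_(j < p.+1) (bcoef p j)%:~R *
     (m.+1%:R^-1 ^+ (p - j) * (m.+1%:R * (1 - e (w / m.+1%:R)))^-1 ^+ j.+1).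
  apply: (cvs_ext (u := fun n => G n.*2)).
    exists `|t|%N => n tn; rewrite /F tn /G polylog_rational //.
    rewrite -mulrA; congr (_ * _); rewrite mulr_sumr; apply: eq_bigr => j _.
    have jp : (j <= p)%N by rewrite -ltnS.
    rewrite [in RHS]mulrCA; congr (_ * _); rewrite -/(M n) -/w invfM exprMn mulrA.
    by rewrite -[in RHS]exprVn -exprD addnS subnK.
  apply: (cvs_subseq (u := G)) => [n|]; first by rewrite -addnn leq_addl.
  (* Only the pole of highest order survives in the limit; the lower ones carry a positive power of
     the inverse of the number of points. *)
  have -> : w ^- p.+1 = lipK p * \sum_(j < p.+1) (bcoef p j)%:~R *
     ((if (j : nat) == p then 1 else 0) * (- (2 * pi%:C * 'i * w))^-1 ^+ j.+1).
    rewrite big_ord_recr /= big1 ?add0r => [|j _]; last first.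
      by rewrite ltn_eqF // mul0r mulr0.
    rewrite eqxx mul1r bcoef_diag /lipK -[(p`!%:Z)%:~R]/(p`!%:R) mulrA divfK; last first.
      by rewrite pnatr_eq0 -lt0n fact_gt0.
    rewrite -(mulNr _ w) invfM exprMn mulrA -exprMn mulfV ?expr1n ?mul1r ?exprVn //.
    rewrite oppr_eq0 !mulf_neq0 ?pnatr_eq0 //.
      by rewrite -nm_gt0 nm_real normr_gt0 lt0r_neq0 // pi_gt0.
    by rewrite -nm_gt0 nm_i.
  apply: cvsM; first exact: cvs_cst.
  apply: cvs_sum => j; apply: cvsM; first exact: cvs_cst.
  apply: cvsM; last by apply: cvsX; apply: cvsV => //; exact: cvs_one_sub_e.
  case: eqP => [->|/eqP jp]; first by rewrite subnn; exact: cvs_cst.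
  have jp' : (0 < p - j)%N by rewrite subn_gt0 ltn_neqAle jp -ltnS ltn_ord.
  rewrite (_ : 0 = 0 ^+ (p - j)); last by rewrite expr0n eqn0Ngt jp'.
  apply: cvsX; apply: (cvs_ext _ (cvs_natV 1)).
  by exists 0%N => n _; rewrite mul1r.
- move=> n; pose A : seq int := [seq i%:Z - n%:Z | i <- iota 0 (M n)].
  have uA : uniq A by rewrite map_inj_uniq ?iota_uniq // => x y ?; lia.
  have := @has_sum_fin R _ A (F n) uA.
  have -> : \sum_(x <- A) F n x = lipK p * polylog p z.
    rewrite big_map -[iota 0 _]/(index_iota 0 (M n)) big_mkord.
    transitivity (\sum_(i < M n) lipK p / (M n)%:R ^+ p.+1 *
        polylog p ((z + i%:R + (- n%:Z)%:~R) / (M n)%:R)).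
      apply: eq_bigr => i _; rewrite /F ifT.
        by rewrite rmorphD /= addrA.
      by have := ltn_ord i; rewrite /M; lia.
    rewrite -mulr_sumr polylog_distrib // mulrA divfK // expf_neq0 //.
  apply=> t nA; rewrite /F ifF //; apply/negP => tn; case/negP: nA.
  apply/mapP; exists (absz (t + n%:Z)); last by lia.
  by rewrite mem_iota /M; lia.
Qed.

(** Both sides are invariant under integral translations, so [z] may be moved into the strip. *)
Lemma lipschitz z p : 0 < complex.Im z -> (0 < p)%N ->
  has_sum (fun n : int => (z + n%:~R) ^- p.+1) (lipK p * polylog p z).
Proof.
move=> y0 p0.
pose a : int := Num.floor (complex.Re z + 1 / 2).
have h : has_sum (fun n : int => (z - a%:~R + n%:~R) ^- p.+1)
    (lipK p * polylog p (z - a%:~R)).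
  apply: lipschitz_strip => //; first by rewrite cImD cImN Im_int subr0.
  rewrite cReD cReN Re_int.
  have := Num.Theory.floor_le (complex.Re z + 1 / 2).
  have := Num.Theory.lt_succ_floor (complex.Re z + 1 / 2).
  by rewrite -/a ler_norml rmorphD /= => ? ?; apply/andP; split; lra.
rewrite -mulrNz polylogDint in h.
have bij : bijective (fun n : int => n + a) by exists (fun n => n - a) => n; [rewrite addrK|rewrite subrK].
apply: (has_sum_ext _ (has_sum_bij bij h)) => n /=.
by rewrite rmorphD /= mulrNz [n%:~R + _]addrC addrA subrK.
Qed.

End Lipschitz.

(** * Eisenstein series *)

Section Eisenstein.
Variable R : realType.
Local Notation C := R[i].
Implicit Types (z w q : C).
Opaque e.

Definition cxd (c d : int) z : C := c%:~R * z + d%:~R.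

Lemma cxdE c d z : cxd c d z = (c%:~R)%:C * z + (d%:~R)%:C.
Proof. by rewrite /cxd !rmorph_int. Qed.

Lemma cxd_lb (c d : int) z : 0 < complex.Im z -> (c, d) != (0, 0) ->
  1 <= latK z * nm (cxd c d z) ^+ 2.
Proof.
move=> y0 cd; have := lattice_bound c%:~R d%:~R y0; rewrite -cxdE.
apply: le_trans; rewrite -!rmorphXn -rmorphD /= ler1z.
move: cd; rewrite xpair_eqE negb_and; case/orP => h; nia.
Qed.

Lemma cxd_neq0 (c d : int) z : 0 < complex.Im z -> (c, d) != (0, 0) -> cxd c d z != 0.
Proof.
move=> y0 cd; apply/eqP => h; have := cxd_lb y0 cd.
by rewrite h nm0 expr0n mulr0 ler10.
Qed.

Definition lat k (p : int * int) z : C :=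
  if p == (0, 0) then 0 else (cxd p.1 p.2 z) ^- k.

(** With [s = c^2 + d^2 >= 1] one has [(1 + c^2) (1 + d^2) <= 3 s^2], and [s] is at most [latK z]
    times the square of [|c z + d|]. Four powers thus give a product of summable functions of [c]
    and of [d]; the others are bounded by a constant. *)
Lemma lat_bound z (p : int * int) k : 0 < complex.Im z -> (3 < k)%N ->
  nm (lat k p z) <= ((1 + latK z) ^+ (k - 4) * (3 * latK z ^+ 2)) *
    ((1 + p.1%:~R ^+ 2)^-1 * (1 + p.2%:~R ^+ 2)^-1).
Proof.
move=> y0 k3; have K0 := latK_gt0 z.
have g0 (x : R) : 0 < 1 + x ^+ 2 by rewrite ltr_pwDl ?sqr_ge0.
rewrite /lat; case: eqP => [_|/eqP cd].
  have K0' := ltW K0; have g0' x := ltW (g0 x).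
  have K1 : 0 <= 1 + latK z by lra.
  by rewrite nm0 !mulr_ge0 ?invr_ge0 ?g0' ?(exprn_ge0 _ K1) ?(exprn_ge0 _ K0').
case: p cd => c d /= cd.
have h1 := cxd_lb y0 cd; have h2 := lattice_bound c%:~R d%:~R y0; rewrite -cxdE in h2.
have N0 : 0 < nm (cxd c d z) by rewrite nm_gt0 cxd_neq0.
set N := nm (cxd c d z) in h1 h2 N0 *.
have h3 : N^-1 <= 1 + latK z.
  rewrite -(@ler_pXn2r _ 2) ?nnegrE ?invr_ge0; [|by []|lra|lra].
  rewrite exprVn -div1r ler_pdivrMr ?exprn_gt0 //; apply: (le_trans h1).
  by rewrite ler_wpM2r ?exprn_ge0 1?ltW //; rewrite expr2; nra.
rewrite nmV nmX -exprVn -/N -{1}(subnK k3) exprD.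
rewrite -[leRHS]mulrA; apply: ler_pM; rewrite ?exprn_ge0 ?invr_ge0 ?(ltW N0) //.
  by rewrite lerXn2r ?nnegrE ?invr_ge0 ?(ltW N0) //; lra.
set s : R := c%:~R ^+ 2 + d%:~R ^+ 2 in h2 *.
have s1 : 1 <= s.
  rewrite /s -!rmorphXn -rmorphD /= ler1z; move: cd; rewrite xpair_eqE negb_and.
  by case/orP => h; nia.
rewrite -invfM ler_pdivlMr ?mulr_gt0 // exprVn mulrC ler_pdivrMr ?exprn_gt0 //.
have e4 : N ^+ 4 = (N ^+ 2) ^+ 2 by rewrite -exprM.
rewrite e4 -mulrA -exprMn.
have h4 : s ^+ 2 <= (latK z * N ^+ 2) ^+ 2 by rewrite lerXn2r ?nnegrE //; lra.
apply: (@le_trans _ _ (3 * s ^+ 2)); last by rewrite ler_pM2l.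
have := sqr_ge0 (c%:~R ^+ 2 - d%:~R ^+ 2 : R).
rewrite /s !expr2 in s1 *; set a := c%:~R * c%:~R : R in s1 *; set b := d%:~R * d%:~R : R in s1 *.
have a0 : 0 <= a by rewrite /a -expr2 sqr_ge0.
have b0 : 0 <= b by rewrite /b -expr2 sqr_ge0.
nra.
Qed.

Lemma summ_lat z k : 0 < complex.Im z -> (3 < k)%N -> summ (fun p => nm (lat k p z)).
Proof.
move=> y0 k3; have K0 := latK_gt0 z.
apply: (@summ_le_nm _ _ _ (fun p => _) _ (fun p => lat_bound p y0 k3)).
apply: summZ; last exact: (summ_pair_prod (summ_invsq_int R) (summ_invsq_int R)).
have K0' := ltW K0; have K1 : 0 <= 1 + latK z by lra.
by rewrite !mulr_ge0 ?(exprn_ge0 _ K1) ?(exprn_ge0 _ K0').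
Qed.

Definition latG k z : C := csum (fun p => lat k p z).

Lemma has_sum_lat z k : 0 < complex.Im z -> (3 < k)%N ->
  has_sum (fun p => lat k p z) (latG k z).
Proof. by move=> y0 k3; apply: csumP; apply: summ_lat. Qed.

Definition moeb (a b c d : int) z : C := cxd a b z / cxd c d z.

Lemma det_cd_neq0 (a b c d : int) : a * d - b * c = 1 -> (c, d) != (0, 0).
Proof. by move=> h; apply/eqP => -[hc hd]; move: h; rewrite hc hd !mulr0. Qed.

Lemma Im_moeb (a b c d : int) z : a * d - b * c = 1 -> 0 < complex.Im z ->
  complex.Im (moeb a b c d z) = complex.Im z / nm (cxd c d z) ^+ 2.
Proof.
move=> h y0; have N0 := cxd_neq0 y0 (det_cd_neq0 h).
have N1 : nm (cxd c d z) ^+ 2 != 0 by rewrite expf_neq0 // nm_eq0.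
have hR : a%:~R * d%:~R - b%:~R * c%:~R = 1 :> R by rewrite -!rmorphM -rmorphB h.
apply: (mulIf N1); rewrite divfK // nm_sqr.
have : moeb a b c d z * cxd c d z = cxd a b z by rewrite /moeb divfK.
rewrite /cxd; set w := moeb a b c d z; case: w => u v; case: z y0 {N0 N1} => x y /= y0 hE.
have h1 := congr1 (@complex.Re R) hE; have h2 := congr1 (@complex.Im R) hE.
move: h1 h2; rewrite !(cReM, cImM, cReD, cImD, Re_int, Im_int) /= !mul0r !addr0 !subr0 => h1 h2.
set C' := c%:~R in hR h1 h2 *; set D := d%:~R in hR h1 h2 *.
set A := a%:~R in hR h1 h2; set B := b%:~R in hR h1 h2.
have hy : y = A * y * (C' * x + D) - (A * x + B) * (C' * y).
  by rewrite -[LHS]mul1r -hR; ring.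
by rewrite [RHS]hy -h1 -h2; ring.
Qed.

Lemma Im_moeb_gt0 (a b c d : int) z : a * d - b * c = 1 -> 0 < complex.Im z ->
  0 < complex.Im (moeb a b c d z).
Proof.
move=> h y0; rewrite Im_moeb // divr_gt0 // exprn_gt0 // nm_gt0.
exact: cxd_neq0 (det_cd_neq0 h).
Qed.

(** Multiplication by the matrix permutes the nonzero pairs. *)
Lemma latG_modular (a b c d : int) z k : a * d - b * c = 1 -> 0 < complex.Im z ->
  (3 < k)%N -> latG k (moeb a b c d z) = cxd c d z ^+ k * latG k z.
Proof.
move=> h y0 k3; have N0 := cxd_neq0 y0 (det_cd_neq0 h).
pose g (p : int * int) := (p.1 * a + p.2 * c, p.1 * b + p.2 * d).
have bij : bijective g.
  exists (fun p => (p.1 * d - p.2 * c, p.2 * a - p.1 * b)) => -[m n]; rewrite /g /=; congr (_, _).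
  - by rewrite -[RHS]mulr1 -h; ring.
  - by rewrite -[RHS]mulr1 -h; ring.
  - by rewrite -[RHS]mulr1 -h; ring.
  - by rewrite -[RHS]mulr1 -h; ring.
have g0 : g (0, 0) = (0, 0) by rewrite /g /= !mul0r.
apply: csumE.
have := has_sumZ (cxd c d z ^+ k) (has_sum_bij bij (has_sum_lat y0 k3)).
apply: has_sum_ext => p; rewrite /lat -{1}g0 (inj_eq (bij_inj bij)).
case: eqP => _; first by rewrite mulr0.
have -> : cxd p.1 p.2 (moeb a b c d z) = cxd (g p).1 (g p).2 z / cxd c d z.
  rewrite /moeb /g /= /cxd; rewrite /cxd in N0; rewrite !rmorphD /= !rmorphM /=; field.
  exact: N0.
by rewrite expr_div_n invf_div.
Qed.

Definition zetaZ k : C := csum (fun d : int => if d == 0 then 0 else (d%:~R : C) ^- k).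

Lemma summ_zetaZ k : (1 < k)%N ->
  summ (fun d : int => nm (if d == 0 then 0 else (d%:~R : C) ^- k)).
Proof.
move=> k1; apply: (@summ_le_nm _ _ _ (fun d : int => 2 * (1 + d%:~R ^+ 2)^-1)).
  by apply: summZ => //; exact: summ_invsq_int.
move=> d; have g0 : 0 < 1 + d%:~R ^+ 2 :> R by rewrite ltr_pwDl ?sqr_ge0.
case: eqP => [_|/eqP d0]; first by rewrite nm0 mulr_ge0 ?invr_ge0 1?ltW.
have a1 : 1 <= `|d|%:~R :> R by rewrite ler1z; lia.
rewrite nmV nmX nm_int; set A : R := `|d|%:~R in a1 *.
have -> : d%:~R ^+ 2 = A ^+ 2 :> R by rewrite /A intr_norm real_normK ?num_real.
have A2 : A ^+ 2 <= A ^+ k by rewrite ler_weXn2l.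
have A3 : 0 < A ^+ 2 by rewrite exprn_gt0; lra.
rewrite -div1r ler_pdivrMr; last by lra.
rewrite mulrAC ler_pdivlMr; last by lra.
rewrite expr2 in A2 A3 *; nra.
Qed.

Lemma lipK_neq0 p : lipK R p != 0.
Proof.
rewrite /lipK mulf_neq0 ?invr_eq0 ?pnatr_eq0 -?lt0n ?fact_gt0 // expf_neq0 //.
rewrite oppr_eq0 !mulf_neq0 ?pnatr_eq0 //.
  by rewrite -nm_gt0 nm_real normr_gt0 lt0r_neq0 // pi_gt0.
by rewrite -nm_gt0 nm_i.
Qed.

Lemma Im_natM (u : nat) z : complex.Im (u%:R * z) = u%:R * complex.Im z.
Proof. by rewrite cImM Re_nat Im_nat mul0r addr0. Qed.

(** The row [c] is Lipschitz's formula at [|c| z]. As p + 1 is even, the rows [c] and [-c] agree. *)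
Lemma latG_polylog p z : 0 < complex.Im z -> (2 < p)%N -> odd p ->
  has_sum (fun u : nat => if u == 0%N then zetaZ p.+1 else
    2 * (lipK R p * polylog p (u%:R * z))) (latG p.+1 z).
Proof.
move=> y0 p2 op.
pose g (c : int) : C := if c == 0 then zetaZ p.+1 else lipK R p * polylog p (`|c|%N%:R * z).
have hy (c : int) : c != 0 -> 0 < complex.Im (`|c|%N%:R * z).
  by move=> c0; rewrite Im_natM mulr_gt0 // ltr0n; lia.
have hg : has_sum g (latG p.+1 z).
  apply: (has_sum_pair (has_sum_lat y0 _)) => // c.
  rewrite /g /lat /cxd /=; have [->|c0] := eqVneq c 0.
    have H := csumP (@summ_zetaZ p.+1 (ltnW (ltnW p2))).
    apply: (has_sum_ext _ H) => d.
    by rewrite mul0r add0r xpair_eqE eqxx.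
  have H := lipschitz (hy c c0) (ltn_trans (isT : 0 < 2)%N p2).
  have [cp|cn] := leP 0 c.
    apply: (has_sum_ext _ H) => d; rewrite xpair_eqE (negPf c0) /=.
    by congr (_ ^- _); congr (_ * _ + _); rewrite -[in RHS](gez0_abs cp).
  have bij : bijective (fun d : int => - d) by exists (fun d => - d) => x; rewrite opprK.
  apply: (has_sum_ext _ (has_sum_bij bij H)) => d; rewrite xpair_eqE (negPf c0) /=.
  have -> : `|c|%N%:R * z + (- d)%:~R = - (c%:~R * z + d%:~R).
    have E : `|c|%N%:R = - c%:~R :> C by rewrite -mulrNz -(ltz0_abs cn).
    by rewrite E mulrNz; ring.
  by rewrite exprNn -signr_odd /= op /= expr0 mul1r.
apply: (has_sum_fiber (h := absz) hg) => u.
pose A : seq int := undup [:: u%:Z; - u%:Z].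
rewrite (_ : (if _ then _ else _) = \sum_(t <- A) if `|t|%N == u then g t else 0).
  apply: has_sum_fin; first exact: undup_uniq.
  by move=> t; rewrite mem_undup !inE => ht; rewrite ifF //; apply/negP => hu; lia.
rewrite {}/A; case: u => [|u].
  by rewrite (_ : undup [:: 0%:Z; - 0%:Z] = [:: 0]) // big_seq1 /g eqxx.
rewrite (_ : undup [:: u.+1%:Z; - u.+1%:Z] = [:: u.+1%:Z; - u.+1%:Z]) //.
by rewrite big_cons big_seq1 /g abszN /= eqxx /= mulr2n mulrDl !mul1r.
Qed.

(* [divisors 0] is the junk list [:: 1], so that [sigma p 0] is not 0. *)
Definition sig p n : nat := if n == 0%N then 0%N else sigma p n.

Lemma sig_gt0 p n : (0 < n)%N -> sig p n = sigma p n.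
Proof. by case: n. Qed.

Lemma sig_le p n : (sig p n <= n ^ p.+1)%N.
Proof.
case: n => [//|n].
rewrite /sig /sigma expnS; apply: (@leq_trans (\sum_(d <- divisors n.+1) n.+1 ^ p)).
  rewrite big_seq [X in (_ <= X)%N]big_seq; apply: leq_sum => d.
  rewrite -dvdn_divisors // => /dvdn_leq h; case: (p) => [//|p'].
  by rewrite leq_exp2r // h.
rewrite big_const_seq count_predT iter_addn_0 mulnC leq_mul2r; apply/orP; right.
have := uniq_leq_size (divisors_uniq n.+1) (s2 := iota 1 n.+1).
rewrite size_iota; apply=> d; rewrite -dvdn_divisors // => h.
by rewrite mem_iota add1n ltnS (dvdn_gt0 _ h) // dvdn_leq.
Qed.

Lemma has_sum_sigma p z : 0 < complex.Im z ->
  summ (fun n => nm ((sig p n)%:R * e z ^+ n)) /\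
  forall s, has_sum (fun u : nat => if u == 0%N then 0 else polylog p (u%:R * z)) s ->
    (0 < p)%N ->
  has_sum (fun n => (sig p n)%:R * e z ^+ n) s.
Proof.
move=> y0; have q1 := nm_e_lt1 y0; have q0 := nm_ge0 (e z).
split.
  apply: (summ_le (summ_powq p.+1 q1)) => n; rewrite nm_ge0 !nmM ler_wpM2r ?nm_ge0 //.
  by rewrite nmX !nm_nat -natrX ler_nat sig_le.
move=> s hS p0.
pose F (t : nat * nat) : C := if t.1 == 0%N then 0 else t.2%:R ^+ p * e z ^+ (t.1 * t.2).
have sF : summ (fun t => nm (F t)).
  (* For [u, r >= 1] one has [u r >= (u - 1) + r], so the powers of [nm (e z)] are dominated by a
     product of one-variable terms. *)
  have sg : summ (fun u : nat => if u == 0%N then 0 else nm (e z) ^+ u.-1).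
    apply: (@summ_nat _ _ (1 - nm (e z))^-1) => [n|n]; first by case: ifP => // _; rewrite exprn_ge0.
    case: n => [|n]; first by rewrite big_ord0 invr_ge0; lra.
    rewrite big_ord_recl /= add0r.
    have h : (1 - nm (e z)) * \sum_(i < n) nm (e z) ^+ i = 1 - nm (e z) ^+ n.
      by rewrite -opprB mulNr -subrX1 opprB.
    have t1' : 0 < 1 - nm (e z) by lra.
    by rewrite -[leRHS]mul1r ler_pdivlMr // mulrC h gerBl exprn_ge0.
  apply: (summ_le (summ_pair_prod sg (summ_powq p q1))) => -[u r]; rewrite nm_ge0 /F /=.
  case: u => [|u] /=; first by rewrite nm0 mul0r.
  case: r => [|r]; first by rewrite expr0n eqn0Ngt p0 !mul0r nm0 mulr0.
  rewrite nmM [nm (r.+1%:R ^+ p * e z ^+ r.+1)]nmM [leRHS]mulrCA.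
  apply: ler_wpM2l; rewrite ?nm_ge0 // !nmX -exprD.
  by rewrite ler_wiXn2l // ?(ltW q1) //; lia.
have hF : has_sum F s.
  apply: (has_sum_pairI sF _ hS) => u; rewrite /F /=; case: ifP => u0.
    exact: has_sum0.
  have yu : 0 < complex.Im (u%:R * z).
    by rewrite Im_natM mulr_gt0 // ltr0n lt0n u0.
  apply: (has_sum_ext _ (has_sum_polylog p yu)) => r.
  by rewrite e_natM -exprM.
apply: (has_sum_fiber (h := fun t : nat * nat => (t.1 * t.2)%N) hF) => n.
case: n => [|n].
  rewrite (_ : (sig p 0)%:R = 0) // mul0r.
  apply: (@has_sum_ext _ _ (fun=> 0)); last exact: has_sum0.
  move=> [u r]; rewrite /F /=; case: eqP => //; case: u => //= u; case: r => // _.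
  by rewrite expr0n eqn0Ngt p0 mul0r.
pose A := [seq (n.+1 %/ d, d)%N | d <- divisors n.+1].
have uA : uniq A by rewrite map_inj_uniq ?divisors_uniq // => a b [].
rewrite (_ : _ * _ = \sum_(t <- A) if (t.1 * t.2)%N == n.+1 then F t else 0).
  apply: has_sum_fin => // -[u r] /= nA; case: eqP => // hur; case/negP: nA.
  apply/mapP; exists r; first by rewrite -dvdn_divisors // -hur dvdn_mull.
  by rewrite -hur mulnK //; case: r hur => //; rewrite muln0.
rewrite big_map /sig /= /sigma natr_sum mulr_suml big_seq [RHS]big_seq; apply: eq_bigr => d.
rewrite -dvdn_divisors // => hd.
have hd0 : (n.+1 %/ d == 0)%N = false.
  by apply/negbTE; rewrite -lt0n divn_gt0 ?(dvdn_leq _ hd) // (dvdn_gt0 _ hd).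
by rewrite /F [_.1]/= [_.2]/= divnK // eqxx hd0 natrX.
Qed.

Definition sigq p z : C := csum (fun n => (sig p n)%:R * e z ^+ n).

Lemma has_sum_sigq p z : 0 < complex.Im z ->
  has_sum (fun n => (sig p n)%:R * e z ^+ n) (sigq p z).
Proof. by move=> y0; apply: csumP; have [] := has_sum_sigma p y0. Qed.

(** Constant term of the Eisenstein series of weight p + 1 whose coefficient at q is 1, classically
    [- B_(p+1) / (2 (p + 1))]. The values at 3 and 5 come from half-integer sums, those at 9 and 11
    from modular identities. *)
Definition eisC p : C := zetaZ p.+1 / (2 * lipK R p).

Definition phi p z : C := eisC p + sigq p z.

Lemma phiE p z : 0 < complex.Im z -> (2 < p)%N -> odd p ->
  latG p.+1 z = 2 * lipK R p * phi p z.
Proof.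
move=> y0 p2 op; have h := latG_polylog y0 p2 op.
have l0 : 2 * lipK R p != 0 :> C by rewrite mulf_neq0 ?pnatr_eq0 ?lipK_neq0.
have h0 := @has_sum1 R _ (fun u : nat => if u == 0%N then zetaZ p.+1 else 0) 0%N.
have {}h0 := h0 (fun x (hx : x != 0%N) => ifN _ _ hx).
have h1 := has_sumZ (2 * lipK R p)^-1 (has_sumB h h0).
have [_ H] := has_sum_sigma p y0.
have H1 := H ((2 * lipK R p)^-1 * (latG p.+1 z - zetaZ p.+1)).
have H2 : has_sum (fun n => (sig p n)%:R * e z ^+ n) ((2 * lipK R p)^-1 * (latG p.+1 z - zetaZ p.+1)).
  apply: H1; last exact: ltn_trans p2.
  apply: (has_sum_ext _ h1) => u; case: ifP => _; first by rewrite subrr mulr0.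
  by rewrite subr0 [2 * (_ * _)]mulrA mulKf.
rewrite /phi (has_sum_uniq (has_sum_sigq p y0) H2) /eisC mulrC [_ / _]mulrC -mulrDr.
by rewrite addrC subrK mulrC mulVKf.
Qed.

Lemma phi_modular (a b c d : int) z p : a * d - b * c = 1 -> 0 < complex.Im z ->
  (2 < p)%N -> odd p -> phi p (moeb a b c d z) = cxd c d z ^+ p.+1 * phi p z.
Proof.
move=> h y0 p2 op; have l0 : 2 * lipK R p != 0 :> C by rewrite mulf_neq0 ?pnatr_eq0 ?lipK_neq0.
have M := latG_modular h y0 (p2 : (3 < p.+1)%N).
rewrite (phiE (Im_moeb_gt0 h y0) p2 op) (phiE y0 p2 op) in M.
exact: (mulfI l0 (etrans M (mulrCA _ _ _))).
Qed.

End Eisenstein.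

(** * Constant terms in weights 4 and 6, modularity of E4, E6 and Delta *)

Section EisensteinConstants.
Variable R : realType.
Local Notation C := R[i].
Implicit Types (z w q : C).
Opaque e.

Lemma e_half : e (1 / 2) = -1 :> C.
Proof.
have h : e (1 / 2) ^+ 2 = 1 :> C.
  by rewrite -e_natM mulrC divfK ?pnatr_eq0 // e1.
have h2 : e (1 / 2) != 1 :> C by rewrite -[1]/(1%:R); exact: e_rat_neq1.
by move/eqP: h; rewrite sqrf_eq1 (negPf h2) => /eqP.
Qed.

Lemma summ_half p : (0 < p)%N -> summ (fun n : int => (`|2^-1 + n%:~R|^-1 ^+ p.+1 : R)).
Proof.
case: p => // p _; have g0 (x : R) : 0 < 1 + x ^+ 2 by rewrite ltr_pwDl ?sqr_ge0.
apply: (@summ_le _ _ _ (fun n : int => (2 ^+ p * 8) * (1 + n%:~R ^+ 2)^-1)).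
  by apply: summZ; [rewrite mulr_ge0 ?exprn_ge0 | exact: summ_invsq_int].
move=> n; rewrite exprn_ge0 ?invr_ge0 //= -[p.+2]addn2 exprD -mulrA.
have h : (1 + n%:~R ^+ 2) / 8 <= `|2^-1 + n%:~R : R| ^+ 2.
  rewrite real_normK ?num_real //.
  have : 0 <= ((7 * n + 1) * (n + 1))%:~R :> R.
    rewrite ler0z; have [h0|h0] : (0 <= n) \/ (n <= -1) by lia.
      by nia.
    by nia.
  rewrite rmorphM !rmorphD !rmorphM /= !expr2; set x : R := n%:~R.
  by rewrite -[7%:~R]/(7%:R) => h; lra.
have h1 : 2^-1 <= `|2^-1 + n%:~R : R|.
  rewrite -(@ler_pXn2r _ 2) ?nnegrE // ?invr_ge0 //; rewrite real_normK ?num_real //.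
  have : 0 <= (n * (n + 1))%:~R :> R.
    rewrite ler0z; have [h0|h0] : (0 <= n) \/ (n <= -1) by lia.
      by nia.
    by nia.
  rewrite rmorphM rmorphD /= !expr2; set x : R := n%:~R => h2; nra.
have p0 : 0 < `|2^-1 + n%:~R : R| by apply: lt_le_trans h1; rewrite invr_gt0.
have hA : `|2^-1 + n%:~R : R|^-1 <= 2 by rewrite -[leRHS]invrK lef_pV2 ?posrE ?invr_gt0.
have hB : `|2^-1 + n%:~R : R|^-1 ^+ p <= 2 ^+ p by rewrite lerXn2r ?nnegrE ?invr_ge0.
have hC : `|2^-1 + n%:~R : R|^-1 ^+ 2 <= 8 * (1 + n%:~R ^+ 2)^-1.
  rewrite exprVn -div1r ler_pdivrMr ?exprn_gt0 // mulrAC ler_pdivlMr // mul1r; lra.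
by apply: (ler_pM _ _ hB hC); rewrite exprn_ge0 ?invr_ge0.
Qed.

Lemma cvs_e_small w : cvs (fun n => e (w / n.+1%:R)) 1.
Proof.
have h : cvs (fun n => 1 - (1 / n.+1%:R) * (n.+1%:R * (1 - e (w / n.+1%:R)))) (1 - 0 * - (2 * pi%:C * 'i * w)).
  apply: cvsB; first exact: cvs_cst.
  by apply: cvsM; [exact: cvs_natV | exact: cvs_one_sub_e].
rewrite mul0r subr0 in h; apply: (cvs_ext _ h); exists 0%N => n _.
have n0 : n.+1%:R != 0 :> C by rewrite pnatr_eq0.
by rewrite mulrA mul1r mulVf // mul1r opprB addrC subrK.
Qed.

(** Lipschitz's formula at the boundary point 1/2, as the limit along [1/2 + i / (n + 1)]. There [e]
    is -1, and the rational expression of [polylog] has a finite value. *)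
Lemma has_sum_half p : (0 < p)%N ->
  has_sum (fun n : int => (2^-1 + n%:~R : C) ^- p.+1)
    (lipK R p * \sum_(j < p.+1) (bcoef p j)%:~R * 2^-1 ^+ j.+1).
Proof.
move=> p0.
have nmh (n : int) : nm (2^-1 + n%:~R : C) = `|2^-1 + n%:~R|.
  by rewrite -nm_real rmorphD /= fmorphV /= rmorph_nat rmorph_int.
have half0 (n : int) : (2^-1 + n%:~R : R) != 0.
  apply/eqP => h; have : (1 + 2 * n)%:~R = 0 :> R.
    rewrite rmorphD rmorphM /= -[2%:~R]/(2%:R) -[1%:~R]/1.
    have -> : n%:~R = - 2^-1 :> R by lra.
    by lra.
  by move/eqP; rewrite intr_eq0; lia.
have [s hs] : exists s, has_sum (fun n : int => (2^-1 + n%:~R : C) ^- p.+1) s.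
  apply: summ_has_sum; apply: (summ_le (summ_half p0)) => n.
  by rewrite nm_ge0 nmV nmX nmh exprVn lexx.
suff -> : lipK R p * \sum_(j < p.+1) (bcoef p j)%:~R * 2^-1 ^+ j.+1 = s by [].
pose zn n : C := 2^-1 + 'i / n.+1%:R.
have zE n : zn n = 2^-1 +i* (n.+1%:R^-1).
  by rewrite [RHS]complexE /= !fmorphV /= !rmorph_nat.
have y0 n : 0 < complex.Im (zn n) by rewrite zE /= invr_gt0 ltr0n.
have : cvs (fun n => lipK R p * polylog p (zn n)) s.
  apply: (@tannery _ _ (fun n t => (zn n + t%:~R) ^- p.+1) _ (fun n : int => (`|2^-1 + n%:~R|^-1 ^+ p.+1 : R))) hs.
  - exact: summ_half.
  - exists 0%N => n t _; rewrite nmV nmX exprVn lef_pV2 ?posrE ?exprn_gt0 ?normr_gt0 ?half0 //.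
      rewrite lerXn2r ?nnegrE ?nm_ge0 //; apply: le_trans (Re_le_nm _).
      by rewrite cReD Re_int zE.
    by rewrite nm_gt0; exact: nm_addint_neq0.
  - move=> t.
    have w0 : 2^-1 + t%:~R != 0 :> C by rewrite -nm_gt0 nmh normr_gt0.
    under [X in cvs X]eq_fun do rewrite -exprVn; rewrite -exprVn; apply: cvsX.
    apply: cvsV => //; apply: cvsD; last exact: cvs_cst.
    rewrite -[X in cvs _ X]addr0; apply: cvsD; first exact: cvs_cst.
    exact: cvs_natV.
  - by move=> n; exact: lipschitz.
apply: cvs_uniq; apply: cvsM; first exact: cvs_cst.
have E n : polylog p (zn n) = \sum_(j < p.+1) (bcoef p j)%:~R * (1 - e (zn n))^-1 ^+ j.+1.
  exact: polylog_rational.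
apply: (cvs_ext (u := fun n => \sum_(j < p.+1) (bcoef p j)%:~R * (1 - e (zn n))^-1 ^+ j.+1)).
  by exists 0%N => n _; rewrite E.
apply: cvs_sum => j; apply: cvsM; first exact: cvs_cst.
apply: cvsX; apply: cvsV; first by rewrite pnatr_eq0.
have -> : 2 = 1 - (-1) * 1 :> C by rewrite mulr1 opprK.
apply: cvsB; first exact: cvs_cst.
apply: (cvs_ext (u := fun n => (-1) * e ('i / n.+1%:R))).
  by exists 0%N => n _; rewrite /zn eD -[2^-1]mul1r e_half.
apply: cvsM; [exact: cvs_cst | exact: cvs_e_small].
Qed.

(** The odd integers are [2 (1/2 + n)], and the even ones reproduce the whole sum with the factor
    [2 ^- k]. *)
Lemma zetaZ_half k s : (1 < k)%N ->
  has_sum (fun n : int => (2^-1 + n%:~R : C) ^- k) s -> (2 ^+ k - 1) * zetaZ R k = s.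
Proof.
move=> k1 hs; have hz := csumP (@summ_zetaZ R k k1); rewrite -/(zetaZ R k) in hz.
pose f (d : int) : C := if d == 0 then 0 else (d%:~R : C) ^- k.
have k0 : 2 ^+ k != 0 :> C by rewrite expf_neq0 // pnatr_eq0.
have par (d : int) : (exists2 m, d = 2 * m & ~~ odd `|d|%N) \/ (exists2 m, d = 2 * m + 1 & odd `|d|%N).
  case: (boolP (odd `|d|%N)) => h.
    by right; exists ((d - 1) %/ 2)%Z => //; lia.
  by left; exists (d %/ 2)%Z => //; lia.
have hev : has_sum (fun t => if odd `|t|%N == false then f t else 0) (2 ^- k * zetaZ R k).
  apply: (has_sum_inj (h := fun m : int => 2 * m)).
  - by move=> x y; lia.
  - move=> d hd; case: ifP => // /eqP ho; case: (par d) => -[m e1 o1].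
      by have := hd m; rewrite -e1 eqxx.
    by rewrite ho in o1.
  apply: (has_sum_ext _ (has_sumZ _ hz)) => m.
  rewrite [in RHS]ifT; last by apply/eqP; apply/negbTE; rewrite abszM oddM.
  rewrite /f mulf_eq0 /=; case: eqP => _; first by rewrite mulr0.
  by rewrite rmorphM /= exprMn invfM.
have hod : has_sum (fun t => if odd `|t|%N == true then f t else 0) (2 ^- k * s).
  apply: (has_sum_inj (h := fun m : int => 2 * m + 1)).
  - by move=> x y; lia.
  - move=> d hd; case: ifP => // /eqP ho; case: (par d) => -[m e1 o1].
      by rewrite ho in o1.
    by have := hd m; rewrite -e1 eqxx.
  apply: (has_sum_ext _ (has_sumZ _ hs)) => m; rewrite ifT; last by apply/eqP; lia.
  rewrite /f ifF; last by lia.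
  rewrite -invfM -exprMn mulrDr mulfV ?pnatr_eq0 // addrC.
  by rewrite rmorphD rmorphM.
pose g (b : bool) : C := if b then 2 ^- k * s else 2 ^- k * zetaZ R k.
have hb : has_sum g (zetaZ R k).
  by apply: (has_sum_fiber (h := fun t : int => odd `|t|%N) hz) => -[].
have hb2 : has_sum g (\sum_(b <- [:: true; false]) g b) by apply: has_sum_fin => // -[].
have := has_sum_uniq hb hb2; rewrite big_cons big_seq1 /g => h.
have : 2 ^+ k * zetaZ R k = s + zetaZ R k by rewrite {1}h mulrDr !mulrA mulfV // !mul1r.
by rewrite mulrBl mul1r => ->; rewrite addrK.
Qed.

(** [lipK] occurs in the half-integer sum and in the definition of [eisC]; it cancels, together with
    all powers of pi. *)
Lemma eisC_val p : (0 < p)%N ->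
  (2 ^+ p.+1 - 1) * (2 * eisC R p) = \sum_(j < p.+1) (bcoef p j)%:~R * 2^-1 ^+ j.+1.
Proof.
move=> p0; have := @zetaZ_half p.+1 _ p0 (has_sum_half p0) => h.
have l0 := lipK_neq0 R p.
apply: (mulfI l0); rewrite -h /eisC; set L := lipK R p in l0 *; set Z := zetaZ R p.+1.
by field.
Qed.

Lemma eisC3 : eisC R 3 = 240^-1.
Proof.
have S4 (F : nat -> C) : \sum_(j < 4) F j = F 0%N + F 1%N + F 2%N + F 3%N.
  by rewrite !big_ord_recl big_ord0 /= addr0 !addrA.
have := @eisC_val 3 isT; rewrite (S4 (fun j => (bcoef 3 j)%:~R * 2^-1 ^+ j.+1)).
rewrite (_ : bcoef 3 0 = -1) // (_ : bcoef 3 1 = 7) // (_ : bcoef 3 2 = -12) //.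
rewrite (_ : bcoef 3 3 = 6) //; move: (eisC R 3) => x h.
have -> : x = 30^-1 * ((2 ^+ 4 - 1) * (2 * x)) by field.
by rewrite h; field.
Qed.

Lemma eisC5 : eisC R 5 = - 504^-1.
Proof.
have S6 (F : nat -> C) : \sum_(j < 6) F j = F 0%N + F 1%N + F 2%N + F 3%N + F 4%N + F 5%N.
  by rewrite !big_ord_recl big_ord0 /= addr0 !addrA.
have := @eisC_val 5 isT; rewrite (S6 (fun j => (bcoef 5 j)%:~R * 2^-1 ^+ j.+1)).
rewrite (_ : bcoef 5 0 = -1) // (_ : bcoef 5 1 = 31) // (_ : bcoef 5 2 = -180) //.
rewrite (_ : bcoef 5 3 = 390) // (_ : bcoef 5 4 = -360) // (_ : bcoef 5 5 = 120) //.
move: (eisC R 5) => x h.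
have -> : x = 126^-1 * ((2 ^+ 6 - 1) * (2 * x)) by field.
by rewrite h; field.
Qed.

(** The sum of [(1/2 + n)^-4] over the integers is [pi^4 / 3], and the terms n = 0 and n = -1 alone
    give 32. The bound feeds the numerical estimate of [nm_e_200]. *)
Lemma pi4_ge : 96 <= (pi : R) ^+ 4.
Proof.
have := @has_sum_half 3 isT.
set s := _ * _ => hs.
have sE : s = ((2 * pi) ^+ 4 / 48 : R)%:C.
  have S4 (F : nat -> C) : \sum_(j < 4) F j = F 0%N + F 1%N + F 2%N + F 3%N.
    by rewrite !big_ord_recl big_ord0 /= addr0 !addrA.
  rewrite /s (S4 (fun j => (bcoef 3 j)%:~R * 2^-1 ^+ j.+1)) (_ : bcoef 3 0 = -1) // (_ : bcoef 3 1 = 7) // (_ : bcoef 3 2 = -12) //.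
  rewrite (_ : bcoef 3 3 = 6) // /lipK; set w : C := - (2 * pi%:C * 'i).
  have w2 : w ^+ 2 = - ((2 * pi) ^+ 2 : R)%:C.
    by rewrite /w sqrrN exprMn sqr_i mulrN1 rmorphXn /= rmorphM /= rmorph_nat.
  have -> : (((2 * pi) ^+ 4 / 48 : R)%:C : C) = ((2 * pi) ^+ 4 : R)%:C / 48.
    by rewrite rmorphM /= fmorphV /= rmorph_nat.
  rewrite (exprM w 2 2) w2 sqrrN -rmorphXn /= -exprM.
  by move: ((2 * pi) ^+ _)%:C => P; rewrite (_ : 3`! = 6%N) //; field.
have h : 32 <= complex.Re s.
  apply/ler_addgt0Pr => eps e0; have [A hA] := hs _ e0.
  pose B := undup ([:: 0; -1] ++ A).
  have := hA B (undup_uniq _) (@subset_undup_catr _ _ _) => hB.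
  have := le_lt_trans (Re_le_nm _) hB; rewrite cReD cReN Re_sum => h1.
  have E (n : int) : complex.Re ((2^-1 + n%:~R : C) ^- 4) = (2^-1 + n%:~R : R) ^- 4.
    have -> : (2^-1 + n%:~R : C) = (2^-1 + n%:~R : R)%:C.
      by rewrite rmorphD /= fmorphV /= rmorph_nat rmorph_int.
    by rewrite -rmorphXn -fmorphV.
  have h2 : 32 <= \sum_(n <- B) complex.Re ((2^-1 + n%:~R : C) ^- 4).
    apply: (@le_trans _ _ (\sum_(n <- [:: 0; -1] : seq int) complex.Re ((2^-1 + n%:~R : C) ^- 4))).
      rewrite big_cons big_seq1 !E; have -> : (2^-1 + 0%:~R : R) = 2^-1 by rewrite addr0.
      have -> : (2^-1 + (-1)%:~R : R) = - 2^-1 by rewrite rmorphN /= rmorph1; lra.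
      rewrite exprNn -signr_odd /= expr0 mul1r exprVn invrK.
      by rewrite -natrX -natrD ler_nat.
    apply: sum_uniq_sub => //; first by move=> n; rewrite E invr_ge0 -[4%N]/(2 * 2)%N exprM sqr_ge0.
      exact: undup_uniq.
    exact: subset_undup_catl.
  move: h1; rewrite ltr_norml => /andP[? ?]; lra.
by move: h; rewrite sE /= exprMn => h; lra.
Qed.

(** Passes from the limits of the definitions, whose index starts at 1, to sums over all of [nat]
    with a vanishing term at 0. *)
Lemma lim_sum1 (f g : nat -> C) s : has_sum g s -> g 0%N = 0 ->
  (forall n, (0 < n)%N -> f n = g n) -> (\big[+%R/0%R]_(1 <= i <oo) f i)%R = s.
Proof.
move=> hs g0 fg; apply: cvs_lim; apply: (cvs_ext _ (has_sum_cvs hs)).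
exists 1%N => n n1; rewrite -(big_mkord xpredT g) big_ltn // g0 add0r.
by rewrite big_nat [RHS]big_nat; apply: eq_bigr => i /andP[i0 _]; rewrite fg.
Qed.

Lemma lim_sigq p z : 0 < complex.Im z ->
  (\big[+%R/0%R]_(1 <= n <oo) ((sigma p n)%:R * e z ^+ n : C))%R = sigq p z.
Proof.
move=> y0; apply: (lim_sum1 (has_sum_sigq p y0)); first by rewrite mul0r.
by move=> n n0; rewrite sig_gt0.
Qed.

Lemma E4E z : 0 < complex.Im z -> E4 z = 240 * phi 3 z.
Proof.
by move=> y0; rewrite /E4 /phi eisC3 lim_sigq // mulrDr mulfV // pnatr_eq0.
Qed.

Lemma E6E z : 0 < complex.Im z -> E6 z = - 504 * phi 5 z.
Proof.
move=> y0; rewrite /E6 /phi eisC5 lim_sigq // mulrDr mulrNN mulfV ?pnatr_eq0 //.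
by rewrite mulNr.
Qed.

Lemma E4_modular (a b c d : int) z : a * d - b * c = 1 -> 0 < complex.Im z ->
  E4 (moeb a b c d z) = cxd c d z ^+ 4 * E4 z.
Proof.
move=> h y0; rewrite !E4E ?Im_moeb_gt0 // phi_modular //; exact: mulrCA.
Qed.

Lemma E6_modular (a b c d : int) z : a * d - b * c = 1 -> 0 < complex.Im z ->
  E6 (moeb a b c d z) = cxd c d z ^+ 6 * E6 z.
Proof.
move=> h y0; rewrite !E6E ?Im_moeb_gt0 // phi_modular //; exact: mulrCA.
Qed.

Lemma Delta_modular (a b c d : int) z : a * d - b * c = 1 -> 0 < complex.Im z ->
  Delta (moeb a b c d z) = cxd c d z ^+ 12 * Delta z.
Proof.
move=> h y0; rewrite /Delta E4_modular // E6_modular //.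
by move: (cxd c d z) (E4 z) (E6 z) => x u v; ring.
Qed.

End EisensteinConstants.

(** * q-expansions *)

Section QSeries.
Variable R : realType.
Local Notation C := R[i].
Implicit Types (z w : C) (c d : nat -> C).
Opaque e.

Definition qs c := forall r : R, 0 <= r < 1 -> summ (fun n => nm (c n) * r ^+ n).

Definition qv c z : C := csum (fun n => c n * e z ^+ n).

Lemma summ_qterm c z : summ (fun n => nm (c n) * nm (e z) ^+ n) ->
  summ (fun n => nm (c n * e z ^+ n)).
Proof. by move=> h; apply: (summ_le h) => n; rewrite nm_ge0 nmM nmX lexx. Qed.

Lemma qs_summ c z : qs c -> 0 < complex.Im z -> summ (fun n => nm (c n * e z ^+ n)).
Proof. by move=> h y0; apply: summ_qterm; apply: h; rewrite nm_ge0 nm_e_lt1. Qed.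

Lemma qs_has_sum c z : qs c -> 0 < complex.Im z ->
  has_sum (fun n => c n * e z ^+ n) (qv c z).
Proof. by move=> h y0; apply: csumP; apply: qs_summ. Qed.

(** A bound on the terms at a larger radius [t < 1] gives comparison with the geometric series of
    ratio [r / t]. *)
Lemma qs_bounded c : (forall r : R, 0 < r < 1 -> exists K, forall n, nm (c n) * r ^+ n <= K) -> qs c.
Proof.
move=> h r /andP[r0 r1].
have [t ht rt] : exists2 t : R, 0 < t < 1 & r < t.
  by exists ((r + 1) / 2); last lra; apply/andP; split; lra.
have [K hK] := h t ht; case/andP: ht => t0 t1.
have K0 : 0 <= K by apply: le_trans (hK 0%N); rewrite expr0 mulr1 nm_ge0.
have g : summ (fun n => (r / t) ^+ n).
  by apply: summ_geo; rewrite divr_ge0 ?(ltW t0) //= ltr_pdivrMr // mul1r.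
apply: (summ_le (summZ K0 g)) => n; rewrite mulr_ge0 ?nm_ge0 ?exprn_ge0 //=.
have -> : nm (c n) * r ^+ n = nm (c n) * t ^+ n * (r / t) ^+ n.
  by rewrite expr_div_n -mulrA [t ^+ n * _]mulrCA mulfV ?mulr1 // expf_neq0 // lt0r_neq0.
by rewrite ler_wpM2r ?exprn_ge0 ?divr_ge0 ?(ltW t0).
Qed.

Definition conv (V : pzSemiRingType) (c d : nat -> V) (n : nat) : V :=
  \sum_(i < n.+1) c i * d (n - i)%N.

Lemma summ_conv c d (r : R) : 0 <= r -> summ (fun n => nm (c n) * r ^+ n) ->
  summ (fun n => nm (d n) * r ^+ n) -> summ (fun n => nm (conv c d n) * r ^+ n).
Proof.
move=> r0 hc hd; apply: (summ_le (summ_cauchy hc hd)) => n.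
rewrite mulr_ge0 ?nm_ge0 ?exprn_ge0 //=.
apply: (le_trans (ler_wpM2r (exprn_ge0 n r0) (nm_sum _ _ _))).
rewrite mulr_suml; apply: ler_sum => i _; rewrite nmM mulrACA -exprD subnKC //.
by rewrite -ltnS.
Qed.

Lemma qs_conv c d : qs c -> qs d -> qs (conv c d).
Proof. by move=> hc hd r hr; apply: summ_conv; [case/andP: hr | exact: hc | exact: hd]. Qed.

Lemma has_sum_conv c d z s t : summ (fun n => nm (c n) * nm (e z) ^+ n) ->
  summ (fun n => nm (d n) * nm (e z) ^+ n) ->
  has_sum (fun n => c n * e z ^+ n) s -> has_sum (fun n => d n * e z ^+ n) t ->
  has_sum (fun n => conv c d n * e z ^+ n) (s * t).
Proof.
move=> /summ_qterm sc /summ_qterm sd hc hd.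
apply: (has_sum_ext _ (has_sum_cauchy sc sd hc hd)) => n.
rewrite mulr_suml; apply: eq_bigr => i _; rewrite mulrACA -exprD subnKC //.
by rewrite -ltnS.
Qed.

Lemma qv_conv c d z : qs c -> qs d -> 0 < complex.Im z -> qv (conv c d) z = qv c z * qv d z.
Proof.
move=> hc hd y0; apply: csumE; have hr : 0 <= nm (e z) < 1 by rewrite nm_ge0 nm_e_lt1.
by apply: has_sum_conv; [exact: hc | exact: hd | exact: qs_has_sum | exact: qs_has_sum].
Qed.

Lemma qsD c d : qs c -> qs d -> qs (fun n => c n + d n).
Proof.
move=> hc hd r hr; apply: (summ_le (summD (hc r hr) (hd r hr))) => n.
case/andP: hr => r0 _; rewrite mulr_ge0 ?nm_ge0 ?exprn_ge0 //=.
by rewrite -mulrDl ler_wpM2r ?exprn_ge0 ?nmD.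
Qed.

Lemma qsZ k c : qs c -> qs (fun n => k * c n).
Proof.
move=> hc r hr; apply: (summ_le (summZ (nm_ge0 k) (hc r hr))) => n.
case/andP: hr => r0 _; rewrite mulr_ge0 ?nm_ge0 ?exprn_ge0 //=.
by rewrite nmM mulrA.
Qed.

Lemma qvD c d z : qs c -> qs d -> 0 < complex.Im z ->
  qv (fun n => c n + d n) z = qv c z + qv d z.
Proof.
move=> hc hd y0; apply: csumE.
have := has_sumD (qs_has_sum hc y0) (qs_has_sum hd y0).
by apply: has_sum_ext => n; rewrite mulrDl.
Qed.

Lemma qvZ k c z : qs c -> 0 < complex.Im z -> qv (fun n => k * c n) z = k * qv c z.
Proof.
move=> hc y0; apply: csumE; have := has_sumZ k (qs_has_sum hc y0).
by apply: has_sum_ext => n; rewrite mulrA.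
Qed.

Lemma qs_ext c d : c =1 d -> qs c -> qs d.
Proof. by move=> /funext ->. Qed.

Definition shq (V : nmodType) (M : nat) (c : nat -> V) n : V := if (n < M)%N then 0 else c (n - M)%N.

Lemma shq_addl (V : nmodType) M (c : nat -> V) n : shq M c (M + n)%N = c n.
Proof. by rewrite /shq ltnNge leq_addr /= addKn. Qed.

Lemma qs_sh M c : qs c -> qs (shq M c).
Proof.
move=> hc; apply: qs_bounded => r /andP[r0 r1].
have [_ [K hK]] := hc r (introT andP (conj (ltW r0) r1)); exists K => n.
have K0 : 0 <= K by have := hK [::] isT; rewrite big_nil.
rewrite /shq; case: ltnP => hn; first by rewrite nm0 mul0r.
apply: (@le_trans _ _ (nm (c (n - M)%N) * r ^+ (n - M))).
  rewrite ler_wpM2l ?nm_ge0 // ler_wiXn2l ?(ltW r0) ?(ltW r1) // leq_subr //.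
by have := hK [:: (n - M)%N] isT; rewrite big_seq1.
Qed.

Lemma qv_sh M c z : qs c -> 0 < complex.Im z -> qv (shq M c) z = e z ^+ M * qv c z.
Proof.
move=> hc y0; apply: csumE; apply: (has_sum_inj (h := fun n => (M + n)%N)).
- by move=> a b /addnI.
- move=> n hn; rewrite /shq; case: ltnP => h; first by rewrite mul0r.
  by have := hn (n - M)%N; rewrite subnKC // eqxx.
apply: (has_sum_ext _ (has_sumZ (e z ^+ M) (qs_has_sum hc y0))) => n.
by rewrite shq_addl exprD mulrCA.
Qed.

Definition cst1 (V : pzSemiRingType) (k : V) (n : nat) : V := if n == 0%N then k else 0.

Lemma qs_cst1 (k : C) : qs (cst1 k).
Proof.
move=> r /andP[r0 r1]; apply: (summ_le (summZ (nm_ge0 k) (summ_geo (introT andP (conj r0 r1))))) => n.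
rewrite mulr_ge0 ?nm_ge0 ?exprn_ge0 //= ler_wpM2r ?exprn_ge0 // /cst1.
by case: ifP => // _; rewrite nm0 nm_ge0.
Qed.

Lemma qv_cst1 (k : C) z : qv (cst1 k) z = k.
Proof.
apply: csumE; have := @has_sum1 R _ (fun n => cst1 k n * e z ^+ n) 0%N.
rewrite {2}/cst1 /= expr0 mulr1; apply=> n n0.
by rewrite /cst1 (negPf n0) mul0r.
Qed.

(* [f] has the Laurent expansion [\sum_n c n * q ^ (n - N)] on the upper half-plane:
   indices are shifted by [N], so the constant term is [c N]. *)
Definition lq N c (f : C -> C) :=
  qs c /\ forall z, 0 < complex.Im z -> f z * e z ^+ N = qv c z.

Lemma lq_ext N c d f g : c =1 d -> (forall z, 0 < complex.Im z -> f z = g z) ->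
  lq N c f -> lq N d g.
Proof.
move=> /funext <- fg [h1 h2]; split=> // z y0; by rewrite -fg ?h2.
Qed.

Lemma lqM N M c d f g : lq N c f -> lq M d g ->
  lq (N + M) (conv c d) (fun z => f z * g z).
Proof.
move=> [c1 c2] [d1 d2]; split=> [|z y0]; first exact: qs_conv.
by rewrite qv_conv // -c2 // -d2 // exprD mulrACA.
Qed.

Lemma lqD N c d f g : lq N c f -> lq N d g ->
  lq N (fun n => c n + d n) (fun z => f z + g z).
Proof.
move=> [c1 c2] [d1 d2]; split=> [|z y0]; first exact: qsD.
by rewrite qvD // -c2 // -d2 // mulrDl.
Qed.

Lemma lqZ k N c f : lq N c f -> lq N (fun n => k * c n) (fun z => k * f z).
Proof.
move=> [c1 c2]; split=> [|z y0]; first exact: qsZ.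
by rewrite qvZ // -c2 // mulrA.
Qed.

Lemma lq_sh M N c f : lq N c f -> lq (M + N) (shq M c) f.
Proof.
move=> [c1 c2]; split=> [|z y0]; first exact: qs_sh.
by rewrite qv_sh // -c2 // exprD mulrCA.
Qed.

Lemma lq_cst k : lq 0 (cst1 k) (fun=> k).
Proof. by split=> [|z y0]; [exact: qs_cst1 | rewrite qv_cst1 expr0 mulr1]. Qed.

(* Cauchy's estimate, by averaging over the points [z + k / N] and letting [N]
   grow, rather than by integrating over a circle. *)
Lemma cauchy_estimate c z0 (B : R) n : 0 < complex.Im z0 ->
  summ (fun n => nm (c n) * nm (e z0) ^+ n) ->
  (forall z, complex.Im z = complex.Im z0 -> nm (qv c z) <= B) ->
  nm (c n) * nm (e z0) ^+ n <= B.
Proof.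
move=> y0 sc hB.
have nmE z : complex.Im z = complex.Im z0 -> nm (e z) = nm (e z0).
  by move=> h; rewrite !nm_e h.
have hs z : complex.Im z = complex.Im z0 -> has_sum (fun n => c n * e z ^+ n) (qv c z).
  by move=> h; apply: csumP; apply: summ_qterm; rewrite nmE.
pose S N := (n + N).+1.
pose pt N k : C := z0 + k%:R / (S N)%:R.
have Impt N k : complex.Im (pt N k) = complex.Im z0.
  have -> : pt N k = z0 + (k%:R / (S N)%:R : R)%:C by rewrite rmorphM fmorphV /= !rmorph_nat.
  by rewrite cImD /= addr0.
(* In [nat], divisibility of [l + (S N - n)] by [S N] expresses that [l] and [n] are congruent
   modulo [S N]. *)
pose F N l : C := if (S N %| l + (S N - n))%N then c l * e z0 ^+ l else 0.
pose av N : C := (S N)%:R^-1 * \sum_(k < S N) e ((S N - n)%:R * k%:R / (S N)%:R) * qv c (pt N k).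
have hav N : has_sum (F N) (av N).
  have S0 : (S N)%:R != 0 :> C by rewrite pnatr_eq0.
  have := has_sumZ (S N)%:R^-1 (has_sum_sum (index_enum 'I_(S N))
     (fun k : 'I_(S N) => has_sumZ (e ((S N - n)%:R * k%:R / (S N)%:R)) (hs _ (Impt N k)))).
  apply: has_sum_ext => l.
  transitivity ((S N)%:R^-1 * (c l * e z0 ^+ l) * \sum_(k < S N) e ((l + (S N - n))%:R * k%:R / (S N)%:R)).
    rewrite -mulrA; apply: congr1; rewrite mulr_sumr; apply: eq_bigr => k _.
    have E1 : (S N - n)%:R * k%:R / (S N)%:R + l%:R * pt N k =
       l%:R * z0 + (l + (S N - n))%:R * k%:R / (S N)%:R :> C by rewrite /pt natrD; field.
    have E : e ((S N - n)%:R * k%:R / (S N)%:R) * e (pt N k) ^+ l =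
       e z0 ^+ l * e ((l + (S N - n))%:R * k%:R / (S N)%:R) by rewrite -!e_natM -!eD E1.
    by rewrite mulrCA E mulrA.
  rewrite sum_e_orth // /F; case: ifP => _; last by rewrite mulr0.
  by rewrite mulrC mulrA mulfV // mul1r.
have avB N : nm (av N) <= B.
  have S0 : 0 < (S N)%:R :> R by rewrite ltr0n.
  rewrite nmM nmV nm_nat mulrC ler_pdivrMr //; apply: (le_trans (nm_sum _ _ _)).
  apply: (@le_trans _ _ (\sum_(k < S N) B)); last by rewrite sumr_const card_ord mulr_natr.
  apply: ler_sum => k _; rewrite nmM nm_e.
  have -> : complex.Im ((S N - n)%:R * k%:R / (S N)%:R : C) = 0.
    have -> : ((S N - n)%:R * k%:R / (S N)%:R : C) = ((S N - n)%:R * k%:R / (S N)%:R : R)%:C.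
      by rewrite !rmorphM fmorphV /= !rmorph_nat.
    by [].
  by rewrite mulr0 oppr0 expR0 mul1r hB.
rewrite -nmX -nmM; apply: (cvs_le (u := av)); last by exists 0%N.
have sc' := summ_qterm sc.
apply: (@tannery _ _ F (fun l => if l == n then c n * e z0 ^+ n else 0) _ _ _ sc' _ _ hav).
- by exists 0%N => N l _; rewrite /F; case: ifP => // _; rewrite nm0 nm_ge0.
- move=> l; apply: (cvs_ext _ (cvs_cst _)); exists l => N lN; rewrite /F.
  have -> : (S N %| l + (S N - n))%N = (l == n).
    have [->|ln] := eqVneq l n; first by rewrite subnKC ?dvdnn // /S; lia.
    apply/negP => /dvdnP[m hm]; move/eqP: ln; apply.
    have [m0|m1] : (m = 0 \/ m = 1)%N \/ (1 < m)%N by lia.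
      by case: m0 => ?; subst m; rewrite /S in hm *; lia.
    have : (2 * S N <= m * S N)%N by rewrite leq_mul2r m1 orbT.
    by rewrite /S in hm *; lia.
  by case: eqP => // ->.
have := @has_sum1 R _ (fun l => if l == n then c n * e z0 ^+ n else 0) n.
by rewrite eqxx; apply=> l /negPf ->.
Qed.

Lemma qv_eq0 c z0 : 0 < complex.Im z0 ->
  summ (fun n => nm (c n) * nm (e z0) ^+ n) ->
  (forall z, complex.Im z = complex.Im z0 -> qv c z = 0) -> forall n, c n = 0.
Proof.
move=> y0 sc h n; have := @cauchy_estimate c z0 0 n y0 sc.
have q0 : 0 < nm (e z0) ^+ n by rewrite exprn_gt0 // nm_gt0 e_neq0.
move=> /(_ _) h1; apply/eqP; rewrite -nm_eq0 eq_le nm_ge0 andbT.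
rewrite -(ler_pM2r q0) mul0r; apply: h1 => z /h ->; by rewrite nm0.
Qed.

Lemma Im_i : complex.Im ('i : C) = 1. Proof. by []. Qed.

Lemma qs_at c z : qs c -> 0 < complex.Im z -> summ (fun n => nm (c n) * nm (e z) ^+ n).
Proof. by move=> h y0; apply: h; rewrite nm_ge0 nm_e_lt1. Qed.

Lemma lq_inj N c d f : lq N c f -> lq N d f -> c =1 d.
Proof.
move=> [c1 c2] [d1 d2] n; apply/eqP; rewrite -subr_eq0; apply/eqP.
have y0 : 0 < complex.Im ('i : C) by rewrite Im_i.
have hq : qs (fun n => c n + (-1) * d n) by apply: qsD => //; apply: qsZ.
have := qv_eq0 y0 (qs_at hq y0) _ n; rewrite mulN1r; apply=> z hz.
by rewrite qvD ?qvZ ?hz //; [rewrite -c2 -?d2 ?hz // mulN1r subrr | exact: qsZ].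
Qed.

(** * The fundamental domain and a Liouville theorem *)

Lemma seq_argmin (T : eqType) (s : seq T) (f : T -> R) x0 : x0 \in s ->
  exists2 x, x \in s & forall y, y \in s -> f x <= f y.
Proof.
elim: s x0 => // a s IH x0 _; case: s IH => [|b s] IH.
  by exists a; rewrite ?mem_head // => y; rewrite inE => /eqP ->.
have [x xs hx] := IH b (mem_head _ _).
have [h|h] := leP (f a) (f x).
  exists a; rewrite ?mem_head // => y; rewrite inE => /orP[/eqP -> //|/hx].
  exact: le_trans.
exists x; first by rewrite inE xs orbT.
by move=> y; rewrite inE => /orP[/eqP ->|/hx //]; exact: ltW.
Qed.

(** Pairs with [|c z + d| <= 1] lie in a finite box by [lattice_bound], and [(0, 1)] is one of them,
    so a minimum over the box is global. *)
Lemma lattice_min z : 0 < complex.Im z -> exists p : int * int, p != (0, 0) /\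
  forall p', p' != (0, 0) -> nm (cxd p.1 p.2 z) <= nm (cxd p'.1 p'.2 z).
Proof.
move=> y0; pose N := Num.bound (latK z).
have hN : latK z < N%:R by apply: archi_boundP; exact/ltW/latK_gt0.
pose L := [seq p : int * int <- [seq (i%:Z - N%:Z, k%:Z - N%:Z) | i <- iota 0 (2 * N).+1, k <- iota 0 (2 * N).+1] | p != (0, 0)].
have N0 : (0 < N)%N by rewrite -(ltr0n R) (lt_trans (latK_gt0 z)).
have inL (p : int * int) : p != (0, 0) -> nm (cxd p.1 p.2 z) <= 1 -> p \in L.
  case: p => c d p0 h1; rewrite mem_filter p0 andTb.
  have h := lattice_bound c%:~R d%:~R y0; rewrite -cxdE in h.
  have h2 : (c ^+ 2 + d ^+ 2)%:~R <= (N%:Z)%:~R :> R.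
    rewrite rmorphD !rmorphXn /=; apply: (le_trans h); apply: le_trans (ltW hN).
    rewrite -[leRHS]mulr1 ler_wpM2l ?(ltW (latK_gt0 z)) //.
    by rewrite expr_le1 ?nm_ge0.
  rewrite ler_int in h2.
  have hc : (`|c| <= N)%N by nia.
  have hd : (`|d| <= N)%N by nia.
  apply/allpairsPdep; exists (absz (c + N%:Z)), (absz (d + N%:Z)); rewrite !mem_iota.
  by split; [lia | lia | congr (_, _); lia].
have h01 : ((0 : int), (1 : int)) \in L.
  by apply: inL => //; rewrite /cxd /= mul0r add0r nm1.
have [p pL hp] := seq_argmin (fun p : int * int => nm (cxd p.1 p.2 z)) h01.
exists p; split; first by move: pL; rewrite mem_filter => /andP[].
move=> p' p'0; have [h|h] := leP (nm (cxd p'.1 p'.2 z)) 1.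
  exact/hp/inL.
apply: le_trans (ltW h); have := hp _ h01.
by rewrite /cxd /= mul0r add0r nm1.
Qed.

Lemma cxd_moeb (a b c d m n : int) z : a * d - b * c = 1 -> 0 < complex.Im z ->
  cxd m n (moeb a b c d z) * cxd c d z = cxd (m * a + n * c) (m * b + n * d) z.
Proof.
move=> h y0; have N0 := cxd_neq0 y0 (det_cd_neq0 h).
rewrite /moeb; move: N0; rewrite /cxd => N0; rewrite !rmorphD /= !rmorphM /=.
by field.
Qed.

(** The bottom row minimises [|c z + d|], which maximises the imaginary part; a translation then
    brings the real part into [-1/2, 1/2]. The bound [nm (cxd c d z) <= 1], by comparison with
    [(0, 1)], serves in the lower bound for Delta. *)
Lemma reduction z : 0 < complex.Im z -> exists a b c d : int,
  [/\ a * d - b * c = 1, 3 / 4 <= complex.Im (moeb a b c d z) ^+ 2 & nm (cxd c d z) <= 1].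
Proof.
move=> y0; have [[c d] [/= cd0 hmin]] := lattice_min y0.
have N1 : 0 < nm (cxd c d z) by rewrite nm_gt0 cxd_neq0.
(* Dividing by a gcd larger than 1 would give a shorter vector. *)
have cop : coprimez c d.
  have [c' hc] := dvdzP (dvdz_gcdl c d); have [d' hd] := dvdzP (dvdz_gcdr c d).
  have g0 : gcdz c d != 0.
    by apply/negP; rewrite gcdz_eq0 => /andP[/eqP h1 /eqP h2]; rewrite h1 h2 eqxx in cd0.
  have cd' : (c', d') != (0, 0).
    by apply/eqP => -[h1 h2]; rewrite h1 mul0r in hc; rewrite h2 mul0r in hd; rewrite hc hd eqxx in cd0.
  have hE : cxd c d z = (gcdz c d)%:~R * cxd c' d' z.
    rewrite /cxd {1}hc {2}hd !rmorphM /=; ring.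
  have := hmin _ cd'; rewrite /= hE nmM nm_int => h.
  have N2 : 0 < nm (cxd c' d' z) by rewrite nm_gt0 cxd_neq0.
  have hg : `|gcdz c d|%:~R <= 1%:~R :> R by rewrite -(ler_pM2r N2) mul1r.
  rewrite ler_int ger0_norm // in hg; move: hg g0; rewrite /coprimez /gcdz.
  by case: (gcdn _ _) => [|[|]].
have [u [v]] := Bezoutz c d; rewrite (eqP cop) => huv.
have hdet : v * d - (- u) * c = 1 by rewrite mulNr opprK addrC.
pose z1 := moeb v (- u) c d z.
have y1 : 0 < complex.Im z1 by exact: Im_moeb_gt0.
pose t : int := - Num.floor (complex.Re z1 + 1 / 2).
exists (v + t * c), (- u + t * d), c, d; split.
- by rewrite -hdet; ring.
- have -> : moeb (v + t * c) (- u + t * d) c d z = cxd 1 t z1.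
    rewrite /z1 /moeb; have := cxd_neq0 y0 cd0; rewrite /cxd => N0.
    by rewrite !rmorphD /= !rmorphM /= mul1r; field.
  set z2 := cxd 1 t z1.
  (* [z2 * (c z + d)] is again the value of a nonzero pair, hence not shorter than [c z + d]. *)
  have h1 : 1 <= nm z2.
    have := cxd_moeb 1 t hdet y0; rewrite -/z1 -/z2 !mul1r => hE.
    have nz : (v + t * c, - u + t * d) != (0, 0).
      apply/eqP => -[e1 e2]; have : (v + t * c) * d - (- u + t * d) * c = 1 by rewrite -hdet; ring.
      by rewrite e1 e2 !mul0r.
    by have := hmin _ nz; rewrite /= -hE nmM -[leLHS]mul1r ler_pM2r.
  have h2 : `|complex.Re z2| <= 1 / 2.
    rewrite /z2 /cxd cReD cReM Re_int Im_int Re_int /= mul0r subr0 mul1r.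
    have := Num.Theory.floor_le (complex.Re z1 + 1 / 2).
    have := Num.Theory.lt_succ_floor (complex.Re z1 + 1 / 2).
    by rewrite /t rmorphN ler_norml rmorphD /= => ? ?; apply/andP; split; lra.
  have : 1 <= nm z2 ^+ 2 by rewrite exprn_ege1.
  rewrite nm_sqr; move: h2; rewrite ler_norml => /andP[? ?].
  have : complex.Re z2 ^+ 2 <= 1 / 4 by rewrite expr2; nra.
  by move=> ? ?; lra.
- have := hmin (0, 1) isT; by rewrite /cxd /= mul0r add0r nm1.
Qed.

Lemma nm_e_quarter z : 0 < complex.Im z -> 3 / 4 <= complex.Im z ^+ 2 -> nm (e z) <= 1 / 4.
Proof.
move=> y0 h; rewrite nm_e expRN div1r lef_pV2 ?posrE ?expR_gt0 //.
apply: le_trans (expR_ge1Dx _); have := pi_ge2 R.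
have : 3 / 4 <= complex.Im z by rewrite expr2 in h; nra.
by move=> ? ?; nra.
Qed.

(** If [nm f <= B] everywhere, Cauchy's estimate at radius 3/4 gives [nm (c n) <= B (4/3)^n]. On the
    reduced points [nm (e z) <= 1/4], so the terms from n = 1 on sum to at most [B] times the sum of
    [(1/3)^n], that is [B / 2]. Invariance spreads this bound to the half-plane, and iteration
    brings it to 0. *)
Lemma modular_liouville c f : lq 0 c f -> c 0%N = 0 ->
  (forall (a b c d : int) z, a * d - b * c = 1 -> 0 < complex.Im z -> f (moeb a b c d z) = f z) ->
  forall z, 0 < complex.Im z -> f z = 0.
Proof.
move=> [hq hf] c0 inv.
have fE z : 0 < complex.Im z -> f z = qv c z by move=> y0; rewrite -hf // expr0 mulr1.
have red (B : R) : (forall z, 0 < complex.Im z -> 3 / 4 <= complex.Im z ^+ 2 -> nm (f z) <= B) ->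
    forall z, 0 < complex.Im z -> nm (f z) <= B.
  move=> h z y0; have [a [b [c' [d [hd h34 _]]]]] := reduction y0.
  by rewrite -(inv _ _ _ _ _ hd y0) h // Im_moeb_gt0.
have step (B : R) : (forall z, 0 < complex.Im z -> nm (f z) <= B) ->
    forall z, 0 < complex.Im z -> nm (f z) <= B / 2.
  move=> hB; apply: red => z y0 y34.
  have q34 : (3 / 4 : C) != 0 by rewrite mulf_neq0 ?invr_eq0 ?pnatr_eq0.
  have n34 : nm (3 / 4 : C) = 3 / 4 by rewrite nmM nmV !nm_nat.
  have [|z1 y1 hz1] := e_surj q34; first by rewrite n34; lra.
  have y1' : 0 < complex.Im z1 := y1.
  have hc n : nm (c n) <= B * (4 / 3) ^+ n.
    have := @cauchy_estimate c z1 B n y1' (qs_at hq y1').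
    rewrite hz1 n34 => /(_ _) h.
    have p0 : 0 < (3 / 4 : R) ^+ n by rewrite exprn_gt0 //; lra.
    rewrite -(ler_pM2r p0) -mulrA -exprMn.
    have -> : (4 / 3 * (3 / 4) : R) = 1 by field.
    rewrite expr1n mulr1; apply: h => w hw; rewrite -fE; last by rewrite hw.
    by apply: hB; rewrite hw.
  have B0 : 0 <= B by apply: le_trans (hB _ y0); exact: nm_ge0.
  rewrite fE //; have q4 := nm_e_quarter y0 y34.
  apply: (@summ_has_sum_le _ _ _ _ (fun n => if n == 0%N then 0 else B * (1 / 3) ^+ n) _ (qs_has_sum hq y0)).
    move=> n; case: eqP => [->|_]; first by rewrite c0 mul0r nm0.
    rewrite nmM nmX; apply: (@le_trans _ _ (B * (4 / 3) ^+ n * (1 / 4) ^+ n)).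
      apply: ler_pM => //; rewrite ?exprn_ge0 ?nm_ge0 //.
      by rewrite lerXn2r ?nnegrE ?nm_ge0 //; lra.
    rewrite -mulrA -exprMn; have -> : (4 / 3 * (1 / 4) : R) = 1 / 3 by field.
    by [].
  move=> S uS; pose m := (\max_(i <- S) i).+1.
  apply: (@le_trans _ _ (\sum_(0 <= n < m) (if n == 0%N then 0 else B * (1 / 3) ^+ n))).
    apply: sum_uniq_sub => //; first by move=> n; case: ifP => // _; rewrite mulr_ge0 ?exprn_ge0 //; lra.
      exact: iota_uniq.
    move=> n nS; rewrite mem_index_iota /=.
    by rewrite ltnS; apply: (@leq_bigmax_seq _ _ xpredT id).
  have H k : \sum_(0 <= n < k.+1) (if n == 0%N then 0 else B * (1 / 3) ^+ n) = B / 2 * (1 - (1 / 3) ^+ k).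
    elim: k => [|k IH]; first by rewrite big_nat1 /= expr0; ring.
    by rewrite big_nat_recr //= IH exprS; field.
  rewrite H; have : 0 <= (1 / 3 : R) ^+ (\max_(i <- S) i) by rewrite exprn_ge0 //; lra.
  by set x := _ ^+ _ => ?; nra.
have [B hB] : exists B, forall z, 0 < complex.Im z -> nm (f z) <= B.
  have [_ [B hB]] := hq (1 / 4) ltac:(by apply/andP; split; lra).
  exists B; apply: red => z y0 y34; rewrite fE //.
  apply: (@summ_has_sum_le _ _ _ _ (fun n => nm (c n) * (1 / 4) ^+ n) _ (qs_has_sum hq y0)) => // n.
  rewrite nmM nmX ler_wpM2l ?nm_ge0 // lerXn2r ?nnegrE ?nm_ge0 //; have := nm_e_quarter y0 y34; lra.
have it k : forall z, 0 < complex.Im z -> nm (f z) <= B / 2 ^+ k.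
  elim: k => [|k IH]; first by move=> z; rewrite expr0 divr1; exact: hB.
  by move=> z y0; rewrite exprSr invfM mulrA; exact: step.
move=> z y0; apply: nm_small0 => eps e0.
have B0 : 0 <= B by apply: le_trans (hB _ y0); exact: nm_ge0.
pose k := Num.bound (B / eps).
have hk : B / eps < k%:R by apply: archi_boundP; rewrite divr_ge0 // ltW.
apply: (le_lt_trans (it k z y0)); rewrite ltr_pdivrMr ?exprn_gt0 //.
rewrite ltr_pdivrMr // in hk; apply: (lt_le_trans hk); rewrite mulrC ler_wpM2l ?(ltW e0) //.
by rewrite -natrX ler_nat ltnW // ltn_expl.
Qed.

End QSeries.

(** * Reciprocals of q-series and integral expansions *)

Section InverseSeries.
Variable R : realType.
Local Notation C := R[i].
Implicit Types (z w : C) (c d : nat -> C).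
Opaque e.

Lemma conv_recl (V : comPzRingType) (d w : nat -> V) n : d 0%N = 1 ->
  conv d w n = w n + \sum_(i < n) d i.+1 * w (n - i.+1)%N.
Proof. by move=> d0; rewrite /conv big_ord_recl d0 mul1r subn0. Qed.

Lemma geo_root (rho : C) z : nm (e z) < nm rho ->
  summ (fun n => nm (rho^-1 ^+ n) * nm (e z) ^+ n) /\
  has_sum (fun n => rho^-1 ^+ n * e z ^+ n) (1 - rho^-1 * e z)^-1.
Proof.
move=> h; have r0 : 0 < nm rho by apply: le_lt_trans h; exact: nm_ge0.
have q1 : nm (rho^-1 * e z) < 1 by rewrite nmM nmV mulrC ltr_pdivrMr // mul1r.
split.
  apply: (summ_le (summ_geoC q1)) => n.
  by rewrite [(rho^-1 * e z) ^+ n]exprMn [nm (rho^-1 ^+ n * _)]nmM [nm (e z ^+ n)]nmX lexx andbT mulr_ge0 ?exprn_ge0 ?nm_ge0.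
by apply: (has_sum_ext _ (has_sum_geo q1)) => n; rewrite exprMn.
Qed.

(** All [rho] lie outside the circle through [e z0], so each factor is inverted on it by a geometric
    series. *)
Lemma poly_inverse_series (s : seq C) z0 :
  (forall rho, rho \in s -> nm (e z0) < nm rho) ->
  exists2 v : nat -> C, summ (fun n => nm (v n) * nm (e z0) ^+ n) &
  forall z, complex.Im z = complex.Im z0 ->
    has_sum (fun n => v n * e z ^+ n) (\prod_(rho <- s) (1 - rho^-1 * e z))^-1.
Proof.
have nmE z : complex.Im z = complex.Im z0 -> nm (e z) = nm (e z0).
  by move=> h; rewrite !nm_e h.
elim: s => [|rho s IH] hs.
  exists (cst1 1) => [|z _].
    have := @has_sum_fin R _ [:: 0%N] (fun n => cst1 1 n * e z0 ^+ n) isT => _.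
    split=> [n|]; first by rewrite mulr_ge0 ?nm_ge0 ?exprn_ge0 ?nm_ge0.
    exists 1 => B uB; have -> : \sum_(x <- B) nm (cst1 1 x : C) * nm (e z0) ^+ x =
        \sum_(x <- B) (if x == 0%N then 1 else 0).
      by apply: eq_bigr => -[|x] _; rewrite /cst1 /= ?nm1 ?expr0 ?mulr1 ?nm0 ?mul0r.
    rewrite -big_mkcond /= big_const_seq iter_addr_0.
    by rewrite (ler_nat R _ 1) count_uniq_mem // leq_b1.
  rewrite big_nil invr1; have := @has_sum1 R _ (fun n => cst1 1 n * e z ^+ n) 0%N.
  rewrite {2}/cst1 /= expr0 mulr1; apply=> n n0.
  by rewrite /cst1 (negPf n0) mul0r.
have [v sv hv] := IH (fun r hr => hs r (mem_behead (s := rho :: s) hr)).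
have [g1 g2] := geo_root (hs rho (mem_head _ _)).
exists (conv (fun n => rho^-1 ^+ n) v); first by apply: summ_conv => //; exact: nm_ge0.
move=> z hz; rewrite big_cons invfM; apply: has_sum_conv.
- by rewrite nmE.
- by rewrite nmE.
- have h' : nm (e z) < nm rho by rewrite nmE // hs ?mem_head.
  by have [] := geo_root h'.
- exact: hv.
Qed.

(* The reciprocal of a power series without zeros in the open unit disc
   converges there: on a circle, the reciprocals of the truncations are bounded
   uniformly, and Cauchy's estimate bounds their first coefficients, which are
   those of the reciprocal series. *)
Lemma qs_inverse d (w : nat -> C) : qs d -> d 0%N = 1 -> (forall n, conv d w n = cst1 1 n) ->
  (forall r : R, 0 < r < 1 -> exists2 eps : R, 0 < eps & forall z,
    0 < complex.Im z -> nm (e z) <= r -> eps <= nm (qv d z)) ->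
  qs w.
Proof.
move=> hd d0 hw hlb; apply: qs_bounded => r hr.
have [eps e0 heps] := hlb r hr; case/andP: hr => r0 r1.
have r0' : (r%:C : C) != 0 by rewrite -nm_gt0 nm_real gtr0_norm.
have [|z0 y0 hz0] := e_surj r0'; first by rewrite nm_real gtr0_norm.
have {}y0 : 0 < complex.Im z0 := y0.
have nr : nm (e z0) = r by rewrite hz0 nm_real gtr0_norm.
have sr := hd r (introT andP (conj (ltW r0) r1)).
have e2 : 0 < eps / 2 by lra.
have [A uA hA] := summ_tail sr e2.
exists (2 / eps) => n.
(* Beyond [A], so that truncation costs at most [eps / 2], and beyond [n], so that the reciprocal of
   the truncation has the right coefficient there. *)
pose N := (maxn n (\max_(i <- A) i)).+1.
pose DN : {poly C} := \poly_(i < N) d i.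
have DNh z : 0 < complex.Im z -> nm (e z) <= r -> eps / 2 <= nm DN.[e z].
  move=> yz qz; have h1 := heps z yz qz.
  have h2 : nm (qv d z - DN.[e z]) <= eps / 2.
    rewrite horner_poly -(big_mkord xpredT (fun i => d i * e z ^+ i)).
    apply: (has_sum_leB (qs_has_sum hd yz)); first exact: iota_uniq.
    move=> B uB dis; apply: (@le_trans _ _ (\sum_(x <- B) nm (d x) * r ^+ x)).
      apply: ler_sum => x _; rewrite nmM nmX ler_wpM2l ?nm_ge0 //.
      by rewrite lerXn2r ?nnegrE ?nm_ge0 ?(ltW r0).
    apply: ltW; apply: hA => // x /dis; apply: contra => xA.
    rewrite mem_index_iota /= ltnS leq_max; apply/orP; right.
    exact: (@leq_bigmax_seq _ _ xpredT id).
  have := nmB_ge (qv d z) (qv d z - DN.[e z]); rewrite subKr => h3; lra.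
have DN0 : DN.[0] = 1 by rewrite horner_coef0 coef_poly.
have DNnz : DN != 0 by apply/eqP => h; move: DN0; rewrite h horner0 => /eqP; rewrite eq_sym oner_eq0.
have [s hs] := closed_field_poly_normal DN.
have rho_r rho : rho \in s -> nm (e z0) < nm rho.
  move=> rs; have rt : DN.[rho] = 0.
    rewrite hs hornerZ horner_prod; apply/eqP; rewrite mulf_eq0; apply/orP; right.
    by rewrite prodf_seq_eq0; apply/hasP; exists rho => //=; rewrite hornerXsubC subrr.
  rewrite nr ltNge; apply/negP => h.
  have [hr0|hr0] := eqVneq rho 0; first by move: rt; rewrite hr0 DN0 => /eqP; rewrite oner_eq0.
  have [|z1 y1 hz1] := e_surj hr0; first by apply: le_lt_trans h r1.
  by have := DNh z1 y1; rewrite hz1 rt nm0 => /(_ h); lra.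
have rho_nz rho : rho \in s -> rho != 0.
  by move=> /rho_r h; rewrite -nm_gt0; apply: le_lt_trans h; exact: nm_ge0.
have DNE q : DN.[q] = \prod_(rho <- s) (1 - rho^-1 * q).
  have P0 q' : DN.[q'] = lead_coef DN * (\prod_(rho <- s) - rho) * \prod_(rho <- s) (1 - rho^-1 * q').
    rewrite {1}hs hornerZ horner_prod -mulrA -big_split /=; congr (_ * _).
    rewrite big_seq [RHS]big_seq; apply: eq_bigr => rho /rho_nz hr.
    by rewrite hornerXsubC; field.
  have := P0 0; rewrite DN0 [X in _ * X]big1 ?mulr1 => [h|rho _]; last by rewrite mulr0 subr0.
  by rewrite P0 -h mul1r.
have [v sv hv] := poly_inverse_series rho_r.
have hv' z : complex.Im z = complex.Im z0 -> has_sum (fun n => v n * e z ^+ n) (DN.[e z])^-1.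
  by move=> hz; rewrite DNE; exact: hv.
pose dN i : C := if (i < N)%N then d i else 0.
have sdN : summ (fun n => nm (dN n) * nm (e z0) ^+ n).
  rewrite nr; apply: (summ_le sr) => x; rewrite mulr_ge0 ?nm_ge0 ?exprn_ge0 ?(ltW r0) //=.
  by rewrite ler_wpM2r ?exprn_ge0 ?(ltW r0) // /dN; case: ifP => // _; rewrite nm0 nm_ge0.
have hdN z : has_sum (fun n => dN n * e z ^+ n) DN.[e z].
  have := @has_sum_fin R _ (index_iota 0 N) (fun n => dN n * e z ^+ n) (iota_uniq _ _).
  rewrite big_mkord horner_poly (eq_bigr (fun i : 'I_N => d i * e z ^+ i)).
    by apply=> x; rewrite mem_index_iota /= /dN => /negPf ->; rewrite mul0r.
  by move=> i _; rewrite /dN ltn_ord.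
have nmE z : complex.Im z = complex.Im z0 -> nm (e z) = nm (e z0).
  by move=> h; rewrite !nm_e h.
have convE m : conv dN v m = cst1 1 m.
  apply/eqP; rewrite -subr_eq0; apply/eqP.
  have s1 := summ_conv (nm_ge0 _) sdN sv.
  have sc : summ (fun m => nm (cst1 1 m : C) * nm (e z0) ^+ m) by exact: qs_at (qs_cst1 _) y0.
  apply: (@qv_eq0 _ (fun m => conv dN v m - cst1 1 m) z0 y0).
    apply: (summ_le (summD s1 sc)) => x; rewrite mulr_ge0 ?nm_ge0 ?exprn_ge0 ?nm_ge0 //=.
    by rewrite -mulrDl ler_wpM2r ?exprn_ge0 ?nm_ge0 // nmB.
  move=> z hz; apply: csumE.
  have yz : 0 < complex.Im z by rewrite hz.
  have DNz : DN.[e z] != 0.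
    by rewrite -nm_gt0; apply: lt_le_trans (DNh z yz _); rewrite // nmE // nr.
  have h1 : has_sum (fun n => conv dN v n * e z ^+ n) (DN.[e z] * DN.[e z]^-1).
    by apply: has_sum_conv; rewrite ?nmE //; exact: hv'.
  rewrite mulfV // in h1.
  have h2 := qs_has_sum (@qs_cst1 R 1) yz; rewrite qv_cst1 in h2.
  have := has_sumB h1 h2; rewrite subrr; apply: has_sum_ext => x.
  by rewrite mulrBl.
have vw m : (m < N)%N -> v m = w m.
  elim/ltn_ind: m => m IH mN.
  have dN0 : dN 0%N = 1 by rewrite /dN.
  have := convE m; rewrite -hw !conv_recl // => h.
  apply: (addIr (\sum_(i < m) d i.+1 * w (m - i.+1)%N)); rewrite -h; congr (_ + _).
  apply: eq_bigr => i _; rewrite /dN ifT; last by apply: leq_ltn_trans mN; exact: ltn_ord.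
  by rewrite IH //; have := ltn_ord i; lia.
rewrite -(vw n); last by rewrite /N ltnS leq_maxl.
rewrite -nr; apply: (@cauchy_estimate _ v z0 (2 / eps) n y0 sv) => z hz.
have yz : 0 < complex.Im z by rewrite hz.
have h := DNh z yz; rewrite nmE // nr lexx in h; have {}h := h isT.
rewrite /qv (csumE (hv' z hz)) nmV -[2 / eps]invrK lef_pV2 ?posrE ?invr_gt0 ?divr_gt0 //.
  by rewrite invf_div.
by lra.
Qed.

(** The recursion for the reciprocal refers to all earlier coefficients, so the list of the first n
    is built; constant term 1 keeps it over the integers. *)
Fixpoint invl (d : nat -> int) n : seq int :=
  if n is m.+1 then
    rcons (invl d m) (cst1 1 m - \sum_(i < m) d i.+1 * nth 0 (invl d m) (m - i.+1)%N)
  else [::].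

Definition invs (d : nat -> int) n : int := nth 0 (invl d n.+1) n.

Lemma size_invl (d : nat -> int) n : size (invl d n) = n.
Proof. by elim: n => //= n IH; rewrite size_rcons IH. Qed.

Lemma nth_invl (d : nat -> int) n i : (i < n)%N -> nth 0 (invl d n) i = invs d i.
Proof.
elim: n => // n IH; rewrite ltnS leq_eqVlt => /orP[/eqP -> //|hi].
by rewrite /= nth_rcons size_invl hi IH.
Qed.

Lemma conv_invs (d : nat -> int) n : d 0%N = 1 -> conv d (invs d) n = cst1 1 n.
Proof.
move=> d0; rewrite conv_recl // {1}/invs /= nth_rcons size_invl ltnn eqxx.
rewrite [X in _ - X + _](eq_bigr (fun i : 'I_n => d i.+1 * invs d (n - i.+1)%N)) ?subrK //.
by move=> i _; rewrite nth_invl //; have := ltn_ord i; lia.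
Qed.

(** Expansions with integral coefficients, kept apart because the integrality of the final
    polynomial is read off from them. *)
Definition il N (a : nat -> int) (f : C -> C) := lq N (fun n => (a n)%:~R) f.

Lemma intr_conv (a b : nat -> int) n :
  conv (fun n => (a n)%:~R : C) (fun n => (b n)%:~R) n = (conv a b n)%:~R.
Proof. by rewrite /conv rmorph_sum; apply: eq_bigr => i _; rewrite rmorphM. Qed.

Lemma ilM N M a b f g : il N a f -> il M b g -> il (N + M) (conv a b) (fun z => f z * g z).
Proof.
by move=> ha hb; apply: (lq_ext _ _ (lqM ha hb)) => // n; rewrite intr_conv.
Qed.

Lemma ilD N a b f g : il N a f -> il N b g ->
  il N (fun n => a n + b n) (fun z => f z + g z).
Proof.
by move=> ha hb; apply: (lq_ext _ _ (lqD ha hb)) => // n; rewrite rmorphD.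
Qed.

Lemma ilZ (k : int) N a f : il N a f -> il N (fun n => k * a n) (fun z => k%:~R * f z).
Proof. by move=> ha; apply: (lq_ext _ _ (lqZ k%:~R ha)) => // n; rewrite rmorphM. Qed.

Lemma il_sh M N a f : il N a f -> il (M + N) (shq M a) f.
Proof.
by move=> ha; apply: (lq_ext _ _ (lq_sh M ha)) => // n; rewrite /shq; case: ifP.
Qed.

Lemma il_cst (k : int) : il 0 (cst1 k) (fun=> k%:~R).
Proof. by apply: (lq_ext _ _ (lq_cst k%:~R)) => // n; rewrite /cst1; case: ifP. Qed.

Lemma il_ext N a b f g : a =1 b -> (forall z, 0 < complex.Im z -> f z = g z) ->
  il N a f -> il N b g.
Proof. by move=> ab; apply: lq_ext => n; rewrite ab. Qed.

End InverseSeries.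

(** * The discriminant *)

Section ConvAlgebra.
Variable V : comPzRingType.
Implicit Types (a b : nat -> V).

Lemma conv_cst1l k a n : conv (cst1 k) a n = k * a n.
Proof.
rewrite /conv big_ord_recl /= subn0 big1 ?addr0 // => i _.
by rewrite /cst1 /= mul0r.
Qed.

Lemma convC a b n : conv a b n = conv b a n.
Proof.
rewrite /conv (reindex_inj rev_ord_inj); apply: eq_bigr => i _ /=.
by rewrite subSS subKn 1?mulrC // -ltnS.
Qed.

Lemma conv_cst1r k a n : conv a (cst1 k) n = k * a n.
Proof. by rewrite convC conv_cst1l. Qed.

Lemma convDl a a' b n : conv (fun n => a n + a' n) b n = conv a b n + conv a' b n.
Proof. by rewrite /conv -big_split; apply: eq_bigr => i _; rewrite mulrDl. Qed.

Lemma convDr a a' b n : conv b (fun n => a n + a' n) n = conv b a n + conv b a' n.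
Proof. by rewrite convC convDl !(convC b). Qed.

Lemma convZl k a b n : conv (fun n => k * a n) b n = k * conv a b n.
Proof. by rewrite /conv mulr_sumr; apply: eq_bigr => i _; rewrite mulrA. Qed.

Lemma convZr k a b n : conv b (fun n => k * a n) n = k * conv b a n.
Proof. by rewrite convC convZl (convC b). Qed.

Lemma eq_conv a a' b b' n : a =1 a' -> b =1 b' -> conv a b n = conv a' b' n.
Proof. by move=> ha hb; apply: eq_bigr => i _; rewrite ha hb. Qed.

End ConvAlgebra.

(** * Integrality of Ramanujan's tau and bounds for divisor sums *)

Section TauInteger.

Definition sigz p n : int := (sig p n)%:Z.

Lemma E4_coefE n : E4_coef n = cst1 1 n + 240 * sigz 3 n.
Proof. by case: n => [|n]; rewrite /E4_coef /cst1 /sigz /sig /= ?mulr0 ?addr0 ?add0r. Qed.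

Lemma E6_coefE n : E6_coef n = cst1 1 n + (- 504) * sigz 5 n.
Proof. by case: n => [|n]; rewrite /E6_coef /cst1 /sigz /sig /= ?mulr0 ?addr0 ?add0r ?mulNr. Qed.

(** 12 divides [5 d^3 + 7 d^5] for each divisor d, by inspection of the residues. *)
Lemma dvd12_sigma n : (12 %| 5 * sigz 3 n + 7 * sigz 5 n)%Z.
Proof.
rewrite /sigz -!PoszM -PoszD.
suff: (12 %| 5 * sig 3 n + 7 * sig 5 n)%N by [].
case: n => [//|n]; rewrite /sig /= /sigma !big_distrr /= -big_split /=.
apply: dvdn_sum => d _.
have h3 : d ^ 3 = (d %% 12) ^ 3 %[mod 12] by rewrite modnXm.
have h5 : d ^ 5 = (d %% 12) ^ 5 %[mod 12] by rewrite modnXm.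
rewrite /dvdn -modnDm -(modnMmr 5) h3 modnMmr -(modnMmr 7) h5 modnMmr modnDm.
have : (d %% 12 < 12)%N by rewrite ltn_mod.
by case: (d %% 12)%N => [|[|[|[|[|[|[|[|[|[|[|[|]]]]]]]]]]]].
Qed.

(** [((1 + 240 A)^3 - (1 - 504 B)^2) / 1728] multiplied out: the linear part is
    [144 (5 A + 7 B) / 1728], and the other coefficients are [3 * 240^2 / 1728 = 100],
    [240^3 / 1728 = 20^3] and [504^2 / 1728 = 147]. *)
Definition tauZ n : int :=
  ((5 * sigz 3 n + 7 * sigz 5 n) %/ 12)%Z + 100 * conv (sigz 3) (sigz 3) n
  + 20 ^+ 3 * conv (sigz 3) (conv (sigz 3) (sigz 3)) n - 147 * conv (sigz 5) (sigz 5) n.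

Lemma tauZE n : conv E4_coef (conv E4_coef E4_coef) n - conv E6_coef E6_coef n =
  12 ^+ 3 * tauZ n.
Proof.
have E4 a : conv E4_coef a n = a n + 240 * conv (sigz 3) a n.
  by rewrite (eq_conv n E4_coefE (frefl a)) convDl convZl conv_cst1l mul1r.
have E4' b m : conv E4_coef b m = b m + 240 * conv (sigz 3) b m.
  by rewrite (eq_conv m E4_coefE (frefl b)) convDl convZl conv_cst1l mul1r.
have E44 m : conv E4_coef E4_coef m = cst1 1 m + (480 * sigz 3 m + 240 ^+ 2 * conv (sigz 3) (sigz 3) m).
  rewrite E4' (eq_conv m (frefl (sigz 3)) E4_coefE) convDr convZr conv_cst1r E4_coefE.
  by ring.
have E66 : conv E6_coef E6_coef n = cst1 1 n - 1008 * sigz 5 n + 504 ^+ 2 * conv (sigz 5) (sigz 5) n.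
  rewrite (eq_conv n E6_coefE E6_coefE) convDl convZl conv_cst1l !convDr !convZr conv_cst1r.
  by ring.
rewrite (eq_conv n (frefl E4_coef) E44) E4' E66 !convDr !convZr conv_cst1r /tauZ.
have [k hk] := dvdzP (dvd12_sigma n); rewrite hk mulzK //.
transitivity (144 * (5 * sigz 3 n + 7 * sigz 5 n) + 3 * 240 ^+ 2 * conv (sigz 3) (sigz 3) n
  + 240 ^+ 3 * conv (sigz 3) (conv (sigz 3) (sigz 3)) n - 504 ^+ 2 * conv (sigz 5) (sigz 5) n).
  by ring.
by rewrite hk; ring.
Qed.

Lemma ramanujan_tauE n : ramanujan_tau n = (tauZ n)%:~R.
Proof.
rewrite /ramanujan_tau; have -> : cauchy_product E4_coef (cauchy_product E4_coef E4_coef) n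
    - cauchy_product E6_coef E6_coef n = 12 ^+ 3 * tauZ n by exact: tauZE.
have cancel_div (K x : rat) : K != 0 -> K * x / K = x by move=> K0; rewrite mulrC mulKf.
rewrite rmorphM /=; have -> : (12 ^+ 3)%:~R = 1728 :> rat by rewrite rmorphXn.
by apply: cancel_div; rewrite pnatr_eq0.
Qed.

Lemma tauZ0 : tauZ 0 = 0. Proof. by rewrite /tauZ /conv !big_ord1. Qed.
Lemma sig_val : (sig 3 1 = 1) * (sig 5 1 = 1) * (sig 3 2 = 9) * (sig 5 2 = 33).
Proof. by rewrite /sig /sigma unlock. Qed.

Lemma conv0 (V : pzSemiRingType) (a b : nat -> V) : conv a b 0 = a 0%N * b 0%N.
Proof. by rewrite /conv big_ord1. Qed.

Lemma conv1 (V : pzSemiRingType) (a b : nat -> V) :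
  conv a b 1 = a 0%N * b 1%N + a 1%N * b 0%N.
Proof. by rewrite /conv !big_ord_recl big_ord0 addr0. Qed.

Lemma conv2 (V : pzSemiRingType) (a b : nat -> V) :
  conv a b 2 = a 0%N * b 2%N + a 1%N * b 1%N + a 2%N * b 0%N.
Proof. by rewrite /conv !big_ord_recl big_ord0 addr0 addrA. Qed.

Lemma tauZ1 : tauZ 1 = 1.
Proof. by rewrite /tauZ !conv1 !conv0 /sigz !sig_val. Qed.

Lemma tauZ2 : tauZ 2 = - 24.
Proof. by rewrite /tauZ !conv2 !conv1 !conv0 /sigz !sig_val. Qed.

(** A geometric majorant, exact at n = 2. Small n are computed; beyond, [sig 3 n <= n^4], and
    consecutive fourth powers have ratio at most [(4/3)^4 < 4]. *)
Lemma sig3_le n : (1 < n)%N -> (sig 3 n <= 9 * 4 ^ (n - 2))%N.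
Proof.
case: n => [|[|n]] // _; rewrite subSS subSS subn0.
do 4 (case: n => [|n]; first by rewrite /sig /sigma unlock; vm_compute).
apply: (leq_trans (sig_le _ _)); elim: n => [|n IH]; first by vm_compute.
rewrite [(4 ^ n.+4.+1)%N]expnS mulnCA; apply: leq_trans (leq_mul (leqnn 4) IH).
have h : (3 * n.+4.+3 <= 4 * n.+4.+2)%N by lia.
have h4 : ((3 * n.+4.+3) ^ 4 <= (4 * n.+4.+2) ^ 4)%N by rewrite leq_exp2r.
rewrite !expnMn in h4; rewrite -(leq_pmul2l (isT : 0 < 3 ^ 4)%N); apply: (leq_trans h4).
by rewrite mulnA leq_mul2r; apply/orP; right.
Qed.

(** As for [sig3_le], with [n^6] and [(4/3)^6 < 8]. *)
Lemma sig5_le n : (1 < n)%N -> (sig 5 n <= 33 * 8 ^ (n - 2))%N.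
Proof.
case: n => [|[|n]] // _; rewrite subSS subSS subn0.
do 3 (case: n => [|n]; first by rewrite /sig /sigma unlock; vm_compute).
apply: (leq_trans (sig_le _ _)); elim: n => [|n IH]; first by vm_compute.
rewrite [(8 ^ n.+4)%N]expnS mulnCA; apply: leq_trans (leq_mul (leqnn 8) IH).
have h : (3 * n.+4.+2 <= 4 * n.+4.+1)%N by lia.
have h4 : ((3 * n.+4.+2) ^ 6 <= (4 * n.+4.+1) ^ 6)%N by rewrite leq_exp2r.
rewrite !expnMn in h4; rewrite -(leq_pmul2l (isT : 0 < 3 ^ 6)%N); apply: (leq_trans h4).
by rewrite mulnA leq_mul2r; apply/orP; right; vm_compute.
Qed.

End TauInteger.

(** * Delta near the cusp *)

Section DeltaNonzero.
Variable R : realType.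
Local Notation C := R[i].
Implicit Types (z w : C).
Opaque e.

Lemma sum_geo_le (t : R) (B : seq nat) : 0 <= t < 1 -> uniq B ->
  \sum_(n <- B) t ^+ n <= (1 - t)^-1.
Proof.
move=> /andP[t0 t1] uB; pose m := (\max_(i <- B) i).+1.
apply: (@le_trans _ _ (\sum_(0 <= n < m) t ^+ n)).
  apply: sum_uniq_sub => //; [by move=> n; exact: exprn_ge0 | exact: iota_uniq |].
  move=> n nS; rewrite mem_index_iota /=.
  by rewrite ltnS; apply: (@leq_bigmax_seq _ _ xpredT id).
have h : (1 - t) * \sum_(i < m) t ^+ i = 1 - t ^+ m.
  by rewrite -opprB mulNr -subrX1 opprB.
have t1' : 0 < 1 - t by lra.
by rewrite big_mkord -[leRHS]mul1r ler_pdivlMr // mulrC h gerBl exprn_ge0.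
Qed.

Lemma sigq_near p (K T : R) z : 0 < complex.Im z -> 0 <= K -> 0 <= T -> T * nm (e z) < 1 ->
  (forall n, (1 < n)%N -> (sig p n)%:R <= K * T ^+ (n - 2)) ->
  nm (sigq p z - e z) <= K * nm (e z) ^+ 2 / (1 - T * nm (e z)).
Proof.
move=> y0 K0 T0 Tq h; have q0 := nm_ge0 (e z).
have -> : sigq p z - e z = sigq p z - \sum_(n <- [:: 0; 1]%N) (sig p n)%:R * e z ^+ n.
  rewrite big_cons big_seq1 mul0r add0r expr1 (_ : sig p 1 = 1%N) ?mul1r //.
  by rewrite /sig /sigma (_ : divisors 1 = [:: 1%N]) // big_seq1 exp1n.
apply: (has_sum_leB (has_sum_sigq p y0)) => // B uB dis.
have hB k : k \in B -> (1 < k)%N.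
  by move=> /dis; rewrite !inE; case: k => [//|[//|]].
apply: (@le_trans _ _ (\sum_(n <- B) K * nm (e z) ^+ 2 * (T * nm (e z)) ^+ (n - 2))).
  rewrite big_seq [leRHS]big_seq; apply: ler_sum => n /hB n1.
  rewrite nmM nm_nat nmX exprMn [leRHS]mulrACA -exprD subnKC //.
  by apply: ler_wpM2r; [exact: exprn_ge0 | exact: h].
rewrite -mulr_sumr; apply: ler_wpM2l; first by rewrite mulr_ge0 ?exprn_ge0.
have Tq0 : 0 <= T * nm (e z) < 1 by rewrite mulr_ge0.
have := @sum_geo_le (T * nm (e z)) [seq (n - 2)%N | n <- B] Tq0; rewrite big_map; apply.
by rewrite map_inj_in_uniq // => a b /hB ? /hB ? ?; lia.
Qed.

Lemma DeltaE z : 0 < complex.Im z -> Delta z =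
  (5 * sigq 3 z + 7 * sigq 5 z) / 12 + 100 * sigq 3 z ^+ 2 + 20 ^+ 3 * sigq 3 z ^+ 3
  - 147 * sigq 5 z ^+ 2.
Proof.
move=> y0; rewrite /Delta E4E // E6E // /phi eisC3 eisC5.
move: (sigq 3 z) (sigq 5 z) => A B.
have -> : 1728 = 12 ^+ 3 :> C by rewrite -natrX.
have -> : 240 * (240^-1 + A) = 1 + 240 * A by field.
have -> : - 504 * (- 504^-1 + B) = 1 - 504 * B by field.
have -> : 240 = 12 * 20 :> C by rewrite -natrM.
have -> : 504 = 12 * 42 :> C by rewrite -natrM.
by field.
Qed.

Lemma nm_sum5 (a b c d f : C) :
  nm (a - b + c + d - f) <= nm a + nm b + nm c + nm d + nm f.
Proof.
apply: (le_trans (nmB _ _)); rewrite lerD2r.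
apply: (le_trans (nmD _ _)); rewrite lerD2r.
apply: (le_trans (nmD _ _)); rewrite lerD2r; exact: nmB.
Qed.

Lemma Delta_estimate (q u v : C) : nm q <= 1 / 200 -> nm u <= 23 / 500 * nm q ->
  nm v <= 43 / 250 * nm q ->
  nm ((5 * (q + u) + 7 * (q + v)) / 12 + 100 * (q + u) ^+ 2 + 20 ^+ 3 * (q + u) ^+ 3
  - 147 * (q + v) ^+ 2 - q) <= 19 / 20 * nm q.
Proof.
move=> r1 hu hv; have r0 := nm_ge0 q; have u0 := nm_ge0 u; have v0 := nm_ge0 v.
have -> : (5 * (q + u) + 7 * (q + v)) / 12 + 100 * (q + u) ^+ 2 + 20 ^+ 3 * (q + u) ^+ 3
  - 147 * (q + v) ^+ 2 - q =
  (5 * u + 7 * v) / 12 - 47 * (q * q) + 100 * (u * (2 * q + u)) + 20 ^+ 3 * (q + u) ^+ 3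
  - 147 * (v * (2 * q + v)) by field.
set r := nm q in r0 r1 hu hv *.
have h1 : nm ((5 * u + 7 * v) / 12) <= (5 * nm u + 7 * nm v) / 12.
  rewrite nmM nmV nm_nat; apply: ler_wpM2r => //.
  by apply: (le_trans (nmD _ _)); rewrite !nmM !nm_nat.
have h2 : nm (47 * (q * q)) <= 47 * (r * r) by rewrite !nmM nm_nat.
have h3 : nm (100 * (u * (2 * q + u))) <= 100 * (23 / 500 * r * (2 * r + 23 / 500 * r)).
  rewrite nmM nm_nat nmM; apply: ler_wpM2l => //; apply: ler_pM => //; first exact: nm_ge0.
  by apply: (le_trans (nmD _ _)); rewrite nmM nm_nat -/r; lra.
have h4 : nm (20 ^+ 3 * (q + u) ^+ 3) <= 20 ^+ 3 * (r + 23 / 500 * r) ^+ 3.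
  rewrite nmM nmX nm_nat nmX; apply: ler_wpM2l; first by rewrite exprn_ge0.
  have hq : nm (q + u) <= r + 23 / 500 * r by apply: (le_trans (nmD _ _)); rewrite -/r; lra.
  have rp : r + 23 / 500 * r \is Num.nneg by rewrite nnegrE; lra.
  have np : nm (q + u) \is Num.nneg by rewrite nnegrE nm_ge0.
  exact: (lerXn2r 3 np rp hq).
have h5 : nm (147 * (v * (2 * q + v))) <= 147 * (43 / 250 * r * (2 * r + 43 / 250 * r)).
  rewrite nmM nm_nat nmM; apply: ler_wpM2l => //; apply: ler_pM => //; first exact: nm_ge0.
  by apply: (le_trans (nmD _ _)); rewrite nmM nm_nat -/r; lra.
have r2 : r * r <= r / 200 by nra.
have r3 : r * r * r <= r / 200 / 200 by nra.
apply: (le_trans (nm_sum5 _ _ _ _ _)).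
apply: (le_trans (lerD (lerD (lerD (lerD h1 h2) h3) h4) h5)).
by lra.
Qed.

Lemma Delta_near z : 0 < complex.Im z -> nm (e z) <= 1 / 200 ->
  nm (Delta z - e z) <= 19 / 20 * nm (e z).
Proof.
move=> y0 r1; have r0 := nm_ge0 (e z); set r := nm (e z) in r0 r1 *.
have hu : nm (sigq 3 z - e z) <= 23 / 500 * r.
  have := @sigq_near 3 9 4 z y0; rewrite -/r => h.
  apply: (@le_trans _ _ (9 * r ^+ 2 / (1 - 4 * r))).
    apply: h => //; first by lra.
    by move=> n n1; rewrite -natrX -natrM ler_nat; exact: sig3_le.
  by rewrite ler_pdivrMr; [rewrite expr2; nra | lra].
have hv : nm (sigq 5 z - e z) <= 43 / 250 * r.
  have := @sigq_near 5 33 8 z y0; rewrite -/r => h.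
  apply: (@le_trans _ _ (33 * r ^+ 2 / (1 - 8 * r))).
    apply: h => //; first by lra.
    by move=> n n1; rewrite -natrX -natrM ler_nat; exact: sig5_le.
  by rewrite ler_pdivrMr; [rewrite expr2; nra | lra].
rewrite DeltaE //; have -> : sigq 3 z = e z + (sigq 3 z - e z) by rewrite addrC subrK.
have -> : sigq 5 z = e z + (sigq 5 z - e z) by rewrite addrC subrK.
exact: Delta_estimate.
Qed.

End DeltaNonzero.

(** * Nonvanishing of Delta, expansions of 1/Delta and j *)

Section DeltaInverse.
Variable R : realType.
Local Notation C := R[i].
Implicit Types (z w : C).
Opaque e.

(** For [t = pi y / 2], y the imaginary part, [pi^4 >= 96] and [y^4 >= 9/16] give [t >= 27/20]; five
    Taylor terms give [exp t >= 19/5], and [(19/5)^4 > 200]. *)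
Lemma nm_e_200 z : 0 < complex.Im z -> 3 / 4 <= complex.Im z ^+ 2 -> nm (e z) <= 1 / 200.
Proof.
move=> y0 y34; have p4 := pi4_ge R; have p0 := pi_gt0 R.
pose t : R := pi * complex.Im z / 2.
have t0 : 0 < t by rewrite divr_gt0 ?mulr_gt0.
have t4 : (27 / 20) ^+ 4 <= t ^+ 4.
  have -> : t ^+ 4 = pi ^+ 4 * (complex.Im z ^+ 2) ^+ 2 / 2 ^+ 4.
    by rewrite /t; field.
  have h : 96 * (3 / 4) ^+ 2 <= pi ^+ 4 * (complex.Im z ^+ 2) ^+ 2.
    by apply: ler_pM => //; apply: lerXn2r => //; rewrite nnegrE; lra.
  move: h; move: (pi ^+ 4 * (complex.Im z ^+ 2) ^+ 2) => x; rewrite !exprS !expr0 => h.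
  by lra.
have t1 : 27 / 20 <= t.
  by rewrite -(@ler_pXn2r _ 4) // nnegrE; lra.
have ht : 19 / 5 <= expR t.
  have := @sum_exp_le R (27 / 20) [:: 0; 1; 2; 3; 4]%N ltac:(lra) isT.
  rewrite !big_cons big_nil (_ : 4`! = 24)%N // (_ : 3`! = 6)%N // (_ : 2`! = 2)%N //.
  rewrite (_ : 1`! = 1)%N // (_ : 0`! = 1)%N // => h.
  have h2 : expR (27 / 20) <= expR t by rewrite ler_expR.
  by lra.
rewrite nm_e expRN div1r lef_pV2 ?posrE ?expR_gt0 //.
have -> : 2 * pi * complex.Im z = 4%:R * t by rewrite /t; field.
rewrite expRM_natl; apply: (@le_trans _ _ ((19 / 5) ^+ 4)); first by lra.
by apply: lerXn2r => //; rewrite nnegrE ?expR_ge0 //; lra.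
Qed.

Lemma Delta_ge z : 0 < complex.Im z -> 3 / 4 <= complex.Im z ^+ 2 ->
  nm (e z) / 20 <= nm (Delta z).
Proof.
move=> y0 y34; have h := Delta_near y0 (nm_e_200 y0 y34).
have := nmB_ge (e z) (e z - Delta z); rewrite subKr nm_distC => h2; lra.
Qed.

(** At the reduced point Delta is at least [nm (e _) / 20], and passing back to [z] does not
    decrease it, as [|c z + d| <= 1]. If c = 0 the imaginary part is unchanged; otherwise that of
    the reduced point is at most [1 / Im z], hence at most [1 / y1]. *)
Lemma Delta_lb (y1 : R) : 0 < y1 -> exists2 eps : R, 0 < eps & forall z,
  y1 <= complex.Im z -> eps * nm (e z) <= nm (Delta z).
Proof.
move=> y10; have p0 := pi_gt0 R.
exists (expR (- (2 * pi * y1^-1)) / 20); first by rewrite divr_gt0 ?expR_gt0.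
move=> z hz; have y0 : 0 < complex.Im z by lra.
have [a [b [c [d [hd h34 hc1]]]]] := reduction y0.
have y0' := Im_moeb_gt0 hd y0.
have := Delta_ge y0' h34; rewrite Delta_modular // nmM nmX => h.
have N0 : 0 < nm (cxd c d z) by rewrite nm_gt0 cxd_neq0 // (det_cd_neq0 hd).
have h1 : nm (cxd c d z) ^+ 12 * nm (Delta z) <= nm (Delta z).
  by rewrite -[leRHS]mul1r ler_wpM2r ?nm_ge0 // exprn_ile1 // ltW.
apply: le_trans (le_trans h h1); rewrite mulrAC ler_wpM2r //.
have e1 : expR (- (2 * pi * y1^-1)) <= 1.
  by rewrite expR_le1 oppr_le0 !mulr_ge0 ?invr_ge0 ?(ltW p0) ?(ltW y10).
have [c0|c0] := eqVneq c 0.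
  have d1 : d ^+ 2 = 1.
    rewrite c0 mulr0 subr0 in hd; have := congr1 absz hd; rewrite abszM => /eqP.
    by rewrite muln_eq1 => /andP[_ /eqP hd1]; nia.
  have -> : nm (e (moeb a b c d z)) = nm (e z).
    rewrite !nm_e Im_moeb // c0 /cxd mul0r add0r nm_int -rmorphXn /=.
    by rewrite real_normK ?num_real // d1 divr1.
  by rewrite -[leRHS]mul1r ler_wpM2r ?nm_ge0.
apply: (@le_trans _ _ (expR (- (2 * pi * y1^-1)))).
  by rewrite -[leRHS]mulr1 ler_wpM2l ?expR_ge0 // ltW // nm_e_lt1.
rewrite nm_e ler_expR lerN2; apply: ler_wpM2l; first by rewrite mulr_ge0 // ltW.
rewrite Im_moeb //; have hcy : complex.Im z <= nm (cxd c d z).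
  apply: le_trans (Im_le_nm _); rewrite /cxd cImD cImM Re_int !Im_int mul0r !addr0 normrM.
  rewrite (gtr0_norm y0) -[leLHS]mul1r ler_wpM2r ?(ltW y0) // -intr_norm ler1z; lia.
rewrite ler_pdivrMr ?exprn_gt0 // mulrC ler_pdivlMr // expr2.
apply: (@le_trans _ _ (complex.Im z * complex.Im z)); first by rewrite ler_wpM2l // ltW.
by apply: ler_pM => //; exact: ltW.
Qed.

Lemma Delta_neq0 z : 0 < complex.Im z -> Delta z != 0.
Proof.
move=> y0; have [eps e0 h] := Delta_lb y0; rewrite -nm_gt0.
by apply: lt_le_trans (h z (lexx _)); rewrite mulr_gt0 // nm_gt0 e_neq0.
Qed.

Lemma il_sigq p : il 0 (sigz p) (@sigq R p).
Proof.
split=> [|z y0]; last by rewrite expr0 mulr1.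
apply: qs_bounded => r /andP[r0 r1].
have r0' : (r%:C : C) != 0 by rewrite -nm_gt0 nm_real gtr0_norm.
have [|z y0 hz] := e_surj r0'; first by rewrite nm_real gtr0_norm.
have [[_ [M hM]] _] := has_sum_sigma p (y0 : 0 < complex.Im z).
exists M => n; have := hM [:: n] isT; rewrite big_seq1 nmM nmX hz nm_real gtr0_norm //.
Qed.

Lemma il_E4 : il 0 E4_coef (@E4 R).
Proof.
have h := ilD (il_cst R 1) (ilZ 240 (il_sigq 3)).
apply: (il_ext _ _ h) => [n|z y0]; first by rewrite E4_coefE.
by rewrite E4E // /phi eisC3 mulrDr mulfV // pnatr_eq0.
Qed.

Lemma il_E6 : il 0 E6_coef (@E6 R).
Proof.
have h := ilD (il_cst R 1) (ilZ (- 504) (il_sigq 5)).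
apply: (il_ext _ _ h) => [n|z y0]; first by rewrite E6_coefE.
by rewrite E6E // /phi eisC5 mulrDr mulrNN mulfV ?pnatr_eq0 // mulrNz.
Qed.

Lemma il_Delta : il 0 tauZ (@Delta R).
Proof.
have h3 := ilM il_E4 (ilM il_E4 il_E4).
have h2 := ilZ (-1) (ilM il_E6 il_E6).
have h := lqZ (12 ^+ 3)^-1 (ilD h3 h2).
have n0 : (12 ^+ 3 : C) != 0 by rewrite expf_neq0 // pnatr_eq0.
apply: (lq_ext _ _ h) => [n|z y0].
  rewrite mulN1r tauZE rmorphM rmorphXn /= mulrA mulVf ?mul1r //.
rewrite /Delta (_ : 1728 = 12 ^+ 3) -?natrX // mulN1r -!expr2 -exprS mulrC //.
Qed.

(** The series of [Delta / q]: its constant term is 1, so its reciprocal is integral. *)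
Definition Dc n : int := tauZ n.+1.
Definition Dinv : nat -> int := invs Dc.

Lemma qs_Dc : qs (fun n => (Dc n)%:~R : C).
Proof.
apply: qs_bounded => r hr; have /andP[r0 r1] := hr.
have [_ [K hK]] := il_Delta.1 r (introT andP (conj (ltW r0) r1)).
exists (K / r) => n; rewrite ler_pdivlMr // -mulrA -exprSr.
by have := hK [:: n.+1] isT; rewrite big_seq1.
Qed.

Lemma qv_Dc z : 0 < complex.Im z -> e z * qv (fun n => (Dc n)%:~R) z = Delta z.
Proof.
move=> y0; have [_ h] := il_Delta; have := h z y0; rewrite expr0 mulr1 => ->.
have := qv_sh 1 qs_Dc y0; rewrite expr1 => <-; congr (qv _ z).
by apply/funext => -[|n]; rewrite /shq /= ?tauZ0 // subn1.
Qed.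

Lemma conv_Dinv n : conv Dc Dinv n = cst1 1 n.
Proof. by apply: conv_invs; exact: tauZ1. Qed.

Lemma qs_Dinv : qs (fun n => (Dinv n)%:~R : C).
Proof.
apply: (@qs_inverse _ _ _ qs_Dc); first by rewrite /Dc tauZ1.
  by move=> n; rewrite intr_conv conv_Dinv /cst1; case: ifP.
move=> r /andP[r0 r1]; have p0 := pi_gt0 R.
(* [nm (e z) <= r] amounts to [Im z >= - ln r / (2 pi)]. *)
have y10 : 0 < - ln r / (2 * pi).
  by rewrite divr_gt0 ?mulr_gt0 // oppr_gt0 ln_lt0 // r0.
have [eps e0 h] := Delta_lb y10; exists eps => // z y0 hz.
have q0 : 0 < nm (e z) by rewrite nm_gt0 e_neq0.
rewrite -(ler_pM2r q0) [leRHS]mulrC -nmM qv_Dc //; apply: h.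
rewrite ler_pdivrMr ?mulr_gt0 // lerNl -ler_expR lnK ?posrE // mulrC -nm_e //.
Qed.

Lemma il_Dinv : il 1 Dinv (fun z : C => (Delta z)^-1).
Proof.
split=> [|z y0]; first exact: qs_Dinv.
have h := qv_conv qs_Dc qs_Dinv y0.
have E : conv (fun n => (Dc n)%:~R : C) (fun n => (Dinv n)%:~R) = cst1 1.
  by apply/funext => n; rewrite intr_conv conv_Dinv /cst1; case: ifP.
rewrite E qv_cst1 in h; rewrite -(qv_Dc y0) expr1 invfM mulrC mulVKf ?e_neq0 //.
have D0 : qv (fun n => (Dc n)%:~R) z != 0 by apply/eqP => D0; move/eqP: h; rewrite D0 mul0r oner_eq0.
by apply: (mulfI D0); rewrite mulfV.
Qed.

Definition E43c := conv E4_coef (conv E4_coef E4_coef).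
Definition jc := conv E43c Dinv.

Lemma il_E43 : il 0 E43c (fun z : C => E4 z ^+ 3).
Proof. by apply: (il_ext _ _ (ilM il_E4 (ilM il_E4 il_E4))). Qed.

Lemma il_j : il 1 jc (@j R).
Proof. exact: (ilM il_E43 il_Dinv). Qed.

Lemma Dinv0 : Dinv 0 = 1.
Proof. by have := conv_Dinv 0; rewrite conv0 /Dc tauZ1 mul1r. Qed.

Lemma jc0 : jc 0 = 1.
Proof. by rewrite /jc conv0 Dinv0 /E43c !conv0. Qed.

Lemma j_invariant (a b c d : int) z : a * d - b * c = 1 -> 0 < complex.Im z ->
  j (moeb a b c d z) = j z.
Proof.
move=> h y0; rewrite /j (E4_modular h y0) (Delta_modular h y0).
have N0 := cxd_neq0 y0 (det_cd_neq0 h).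
move: (cxd c d z) N0 (E4 z) (Delta z) => x x0 u v.
have [->|v0] := eqVneq v 0; first by rewrite mulr0 invr0 !mulr0.
by field; rewrite x0 v0.
Qed.

End DeltaInverse.

(** * Constant terms in weight 2 *)

Section ConstantTerm.
Variable R : realType.
Local Notation C := R[i].
Implicit Types (z w : C) (c : nat -> C).
Opaque e.

Lemma qs_natM c : qs c -> qs (fun n => n%:R * c n).
Proof.
move=> hc; apply: qs_bounded => r /andP[r0 r1].
have [t ht rt] : exists2 t : R, 0 < t < 1 & r < t.
  by exists ((r + 1) / 2); last lra; apply/andP; split; lra.
case/andP: ht => t0 t1.
have [_ [K hK]] := hc t (introT andP (conj (ltW t0) t1)).
have q1 : nm ((r / t)%:C : C) < 1.
  by rewrite nm_real ger0_norm ?divr_ge0 ?(ltW r0) ?(ltW t0) // ltr_pdivrMr // mul1r.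
have [_ [L hL]] := summ_powq 1 q1.
have K0 : 0 <= K by have := hK [::] isT; rewrite big_nil.
exists (L * K) => n.
have h1 := hK [:: n] isT; have h2 := hL [:: n] isT.
rewrite big_seq1 in h1; rewrite big_seq1 expr1 nmM nmX nm_real nm_nat in h2.
rewrite ger0_norm ?divr_ge0 ?(ltW r0) ?(ltW t0) // in h2.
have -> : nm (n%:R * c n) * r ^+ n = (n%:R * (r / t) ^+ n) * (nm (c n) * t ^+ n).
  have tn : t ^+ n != 0 by rewrite expf_neq0 // lt0r_neq0.
  by rewrite nmM nm_nat expr_div_n mulrACA divfK.
apply: ler_pM => //; first by rewrite mulr_ge0 ?exprn_ge0 ?divr_ge0 ?(ltW r0) ?(ltW t0).
by rewrite mulr_ge0 ?nm_ge0 ?exprn_ge0 ?(ltW t0).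
Qed.

Definition twopii : C := 2 * pi%:C * 'i.

Lemma twopii_neq0 : twopii != 0.
Proof.
rewrite /twopii !mulf_neq0 ?pnatr_eq0 //.
  by rewrite -nm_gt0 nm_real normr_gt0 lt0r_neq0 // pi_gt0.
by rewrite -nm_gt0 nm_i.
Qed.

Lemma nm_twopii : nm twopii = 2 * pi.
Proof. by rewrite /twopii !nmM nm_nat nm_real nm_i mulr1 ger0_norm ?pi_ge0. Qed.

(** Coefficients of the termwise primitive. The constant term of the form, at index [N], integrates
    to [c N * z], which [prim] adds. *)
Definition primc N c n : C := if n == N then 0 else c n / (twopii * (n%:R - N%:R)).

Definition prim N c z : C := (e z) ^- N * qv (primc N c) z + c N * z.

Lemma natB_neq0 (n N : nat) : n != N -> (n%:R - N%:R : C) != 0.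
Proof. by move=> nN; rewrite subr_eq0 eqr_nat. Qed.

Lemma nm_natB_ge1 (n N : nat) : n != N -> 1 <= nm (n%:R - N%:R : C).
Proof.
move=> nN; have -> : (n%:R - N%:R : C) = (n%:Z - N%:Z)%:~R by rewrite rmorphB.
by rewrite nm_int ler1z; lia.
Qed.

Lemma nm_natB_le (n N : nat) : nm (n%:R - N%:R : C) <= n%:R + N%:R.
Proof. by apply: (le_trans (nmB _ _)); rewrite !nm_nat. Qed.

Lemma qs_primc N c : qs c -> qs (primc N c).
Proof.
move=> hc; apply: qs_bounded => r /andP[r0 r1].
have [_ [K hK]] := hc r (introT andP (conj (ltW r0) r1)).
have K0 : 0 <= K by have := hK [::] isT; rewrite big_nil.
exists K => n; have := hK [:: n] isT; rewrite big_seq1 => h.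
rewrite /primc; case: eqP => [_|/eqP nN]; first by rewrite nm0 mul0r.
apply: le_trans h; apply: ler_wpM2r; first by rewrite exprn_ge0 // ltW.
rewrite nmM nmV nmM nm_twopii -[leRHS]mulr1; apply: ler_wpM2l; first exact: nm_ge0.
rewrite invf_le1; last first.
  by rewrite !mulr_gt0 ?pi_gt0 // (lt_le_trans ltr01) ?nm_natB_ge1.
by have := nm_natB_ge1 nN; have := pi_ge2 R; nra.
Qed.

Lemma e_shift (n N : nat) z : e z ^- N * e z ^+ n = expC (twopii * (n%:R - N%:R) * z).
Proof.
transitivity (e ((n%:R - N%:R) * z)); last by rewrite -mulrA.
by rewrite mulrBl eD eN !e_natM mulrC.
Qed.

(** Expresses, uniformly on a horizontal strip, that [prim] has derivative [f]; [expC_second_order]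
    is applied to each term. *)
Lemma prim_second_order N c f (y1 y2 : R) : 0 < y1 -> lq N c f -> exists2 K : R, 0 <= K & forall z w,
  y1 <= complex.Im z <= y2 -> y1 <= complex.Im w <= y2 ->
  nm (f z) <= K /\ nm (prim N c w - prim N c z - f z * (w - z)) <= K * nm (w - z) ^+ 2.
Proof.
move=> y10 [hc hf]; have p0 := pi_gt0 R.
pose rho : R := expR (- (2 * pi * y1)).
have rho0 : 0 < rho by exact: expR_gt0.
have rho1 : rho < 1 by rewrite expR_lt1 oppr_lt0 !mulr_gt0.
pose E : R := expR (2 * pi * (N%:R * y2)).
have E0 : 0 < E by exact: expR_gt0.
have [_ [A hA]] := hc rho (introT andP (conj (ltW rho0) rho1)).
have [_ [B hB]] := qs_natM hc (introT andP (conj (ltW rho0) rho1)).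
have A0 : 0 <= A by have := hA [::] isT; rewrite big_nil.
have B0 : 0 <= B by have := hB [::] isT; rewrite big_nil.
(* [E] absorbs the negative powers of q, at most [N] in number. *)
have hE (n : nat) (y : R) : y1 <= y <= y2 ->
   expR (- (2 * pi * ((n%:R - N%:R) * y))) <= E * rho ^+ n.
  move=> /andP[hy1 hy2]; rewrite /E /rho -expRM_natl -expRD ler_expR.
  have : N%:R * y <= N%:R * y2 by rewrite ler_wpM2l.
  have : n%:R * y1 <= n%:R * y by rewrite ler_wpM2l.
  by set a := n%:R; set b := N%:R; nra.
pose K1 : R := E * A; pose K2 : R := expK R * (2 * pi) * E * (B + N%:R * A).
have K10 : 0 <= K1 by rewrite mulr_ge0 // ltW.
have K20 : 0 <= K2.
  rewrite /K2 !mulr_ge0 ?(ltW (expK_gt0 R)) ?(ltW p0) ?(ltW E0) //.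
  by rewrite addr_ge0 // mulr_ge0.
exists (K1 + K2) => [|z w hz hw]; first exact: addr_ge0.
have yz : 0 < complex.Im z by case/andP: hz => ? _; lra.
have yw : 0 < complex.Im w by case/andP: hw => ? _; lra.
have fE : has_sum (fun n => c n * expC (twopii * (n%:R - N%:R) * z)) (f z).
  have -> : f z = e z ^- N * qv c z.
    by rewrite -hf // mulrC mulfK // expf_neq0 // e_neq0.
  apply: (has_sum_ext _ (has_sumZ (e z ^- N) (qs_has_sum hc yz))) => n.
  by rewrite -e_shift mulrCA.
have nmx (n : nat) (u : C) : nm (expC (twopii * (n%:R - N%:R) * u)) =
    expR (- (2 * pi * ((n%:R - N%:R) * complex.Im u))).
  rewrite nm_expC -mulrA Re_2pii; congr (expR (- (_ * _))).
  have -> : (n%:R - N%:R : C) = (n%:R - N%:R : R)%:C by rewrite rmorphB /= !rmorph_nat.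
  by rewrite cImM /= mul0r addr0.
split.
  apply: (@le_trans _ _ K1); last by rewrite lerDl.
  apply: (summ_has_sum_le (b := fun n => E * (nm (c n) * rho ^+ n)) fE) => [n|S uS].
    by rewrite nmM nmx [leRHS]mulrCA ler_wpM2l ?nm_ge0 ?hE.
  by rewrite -mulr_sumr ler_wpM2l ?(ltW E0) ?hA.
have hp u : 0 < complex.Im u -> has_sum (fun n => primc N c n * expC (twopii * (n%:R - N%:R) * u))
    (e u ^- N * qv (primc N c) u).
  move=> yu; apply: (has_sum_ext _ (has_sumZ (e u ^- N) (qs_has_sum (qs_primc N hc) yu))) => n.
  by rewrite -e_shift mulrCA.
have hsum := has_sumB (has_sumB (hp w yw) (hp z yz)) (has_sumZr (w - z) fE).
(* The linear part of [prim] contributes [c N * (w - z)], which cancels the [N]-th term of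
   [f z * (w - z)]. *)
have h1 := @has_sum1 R _ (fun n => if n == N then c N * (w - z) else 0) N.
rewrite eqxx in h1; have {}h1 := h1 (fun n (hn : n != N) => ifN _ _ hn).
have {hsum} := has_sumD hsum h1.
have -> : e w ^- N * qv (primc N c) w - e z ^- N * qv (primc N c) z - f z * (w - z) + c N * (w - z) =
    prim N c w - prim N c z - f z * (w - z).
  by rewrite /prim; move: (e w ^- N * _) (e z ^- N * _) (f z) => a b x; ring.
move=> hsum.
apply: (@le_trans _ _ (K2 * nm (w - z) ^+ 2)); last first.
  by apply: ler_wpM2r; [rewrite exprn_ge0 ?nm_ge0 | rewrite lerDr].
apply: (summ_has_sum_le (b := fun n => (expK R * (2 * pi) * E * nm (w - z) ^+ 2) *
   (nm (n%:R * c n) * rho ^+ n + N%:R * (nm (c n) * rho ^+ n))) hsum) => [n|S uS]; last first.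
  rewrite -mulr_sumr big_split /= -mulr_sumr /K2 [leRHS]mulrAC; apply: ler_wpM2l.
    by rewrite !mulr_ge0 ?(ltW (expK_gt0 R)) ?(ltW p0) ?(ltW E0) ?exprn_ge0 ?nm_ge0.
  by rewrite lerD ?hB // ler_wpM2l ?hA.
have rhs0 : 0 <= expK R * (2 * pi) * E * nm (w - z) ^+ 2 *
   (nm (n%:R * c n) * rho ^+ n + N%:R * (nm (c n) * rho ^+ n)).
  rewrite mulr_ge0 //.
    by rewrite !mulr_ge0 ?(ltW (expK_gt0 R)) ?(ltW p0) ?(ltW E0) ?exprn_ge0 ?nm_ge0.
  by rewrite addr_ge0 // !mulr_ge0 ?nm_ge0 ?exprn_ge0 ?(ltW rho0).
move: rhs0; rewrite /primc; have [->|nN] := eqVneq n N => rhs0.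
  have hx : expC (twopii * (N%:R - N%:R) * z) = 1 by rewrite subrr mulr0 mul0r expC0.
  by rewrite hx !mul0r mulr1 subrr sub0r addNr nm0.
rewrite addr0.
set a := twopii * (n%:R - N%:R).
have a0 : a != 0 by rewrite mulf_neq0 ?twopii_neq0 ?natB_neq0.
have -> : c n / a * expC (a * w) - c n / a * expC (a * z) - c n * expC (a * z) * (w - z) =
   c n / a * (expC (a * w) - expC (a * z) - (a * w - a * z) * expC (a * z)).
  by move: (expC (a * w)) (expC (a * z)) => u v; field.
have := @expC_second_order R (a * z) (a * w) (E * rho ^+ n).
rewrite -!nm_expC !nmx => /(_ (hE n _ hz) (hE n _ hw)) h2.
rewrite nmM; apply: (le_trans (ler_wpM2l (nm_ge0 _) h2)).
rewrite -mulrBr [nm (c n / a)]nmM nmV [nm (a * (w - z))]nmM [(nm a * _) ^+ 2]exprMn.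
have na0 : 0 < nm a by rewrite nm_gt0.
have -> : nm (c n) / nm a * (expK R * (nm a ^+ 2 * nm (w - z) ^+ 2) * (E * rho ^+ n)) =
   (expK R * E * nm (w - z) ^+ 2) * (nm a * (nm (c n) * rho ^+ n)).
  by field; rewrite lt0r_neq0.
have -> : expK R * (2 * pi) * E * nm (w - z) ^+ 2 *
   (nm (n%:R * c n) * rho ^+ n + N%:R * (nm (c n) * rho ^+ n)) =
   (expK R * E * nm (w - z) ^+ 2) * ((2 * pi * (n%:R + N%:R)) * (nm (c n) * rho ^+ n)).
  by rewrite nmM nm_nat; ring.
apply: ler_wpM2l.
  by rewrite !mulr_ge0 ?(ltW (expK_gt0 R)) ?(ltW E0) ?exprn_ge0 ?nm_ge0.
apply: ler_wpM2r; first by rewrite mulr_ge0 ?nm_ge0 ?exprn_ge0 ?(ltW rho0).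
by rewrite /a nmM nm_twopii ler_wpM2l ?nm_natB_le // mulr_ge0 // ltW.
Qed.

(** Along the segment, n steps of length 1/n change [G] by at most [n * (K / n^2)]. *)
Lemma second_order_constant (G : C -> C) (p q : C) (K : R) :
  (forall s t : R, 0 <= s <= 1 -> 0 <= t <= 1 ->
     nm (G (p + t%:C * (q - p)) - G (p + s%:C * (q - p))) <= K * (t - s) ^+ 2) ->
  G p = G q.
Proof.
move=> h; apply/eqP; rewrite eq_sym -subr_eq0; apply/eqP; apply: nm_small0 => eps e0.
have K0 : 0 <= K.
  have := h 0 1; rewrite subr0 expr1n mulr1 => /(_ _ _)/= h1.
  by apply: le_trans (nm_ge0 _) (h1 _ _); rewrite ?lexx ?ler01.
pose n := Num.bound (K / eps).
have hn : K / eps < n%:R by apply: archi_boundP; rewrite divr_ge0 // ltW.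
have n0 : 0 < n%:R :> R by apply: le_lt_trans hn; rewrite divr_ge0 // ltW.
pose P k : C := p + (k%:R / n%:R)%:C * (q - p).
have P0 : P 0%N = p by rewrite /P mul0r rmorph0 mul0r addr0.
have Pn : P n = q by rewrite /P divff ?lt0r_neq0 // rmorph1 mul1r addrC subrK.
have tele k : (k <= n)%N -> nm (G (P k) - G (P 0%N)) <= k%:R * (K / n%:R ^+ 2).
  elim: k => [|k IH] kn; first by rewrite subrr nm0 mul0r.
  have -> : G (P k.+1) - G (P 0%N) = (G (P k.+1) - G (P k)) + (G (P k) - G (P 0%N)) by ring.
  apply: (le_trans (nmD _ _)); rewrite -natr1 mulrDl mul1r addrC; apply: lerD.
    by apply: IH; exact: ltnW.
  have hr m : (m <= n)%N -> 0 <= (m%:R / n%:R : R) <= 1.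
    by move=> mn; rewrite divr_ge0 ?(ltW n0) //= ler_pdivrMr // mul1r ler_nat.
  apply: (le_trans (h _ _ (hr k (ltnW kn)) (hr k.+1 kn))).
  have -> : k.+1%:R / n%:R - k%:R / n%:R = n%:R^-1 :> R by rewrite -natr1; field; rewrite lt0r_neq0.
  by rewrite exprVn.
have := tele n (leqnn n); rewrite P0 Pn => h1; apply: (le_lt_trans h1).
have -> : n%:R * (K / n%:R ^+ 2) = K / n%:R by field; rewrite lt0r_neq0.
by rewrite ltr_pdivrMr // mulrC -ltr_pdivrMr.
Qed.

(* A primitive of [f] changes by a constant under [z |-> -1/z], and this constant
   vanishes at the fixed point [i]; at [exp(i pi/3)] the two points differ by [1]. *)
Theorem constant_term_weight2 N c f : lq N c f ->
  (forall z, 0 < complex.Im z -> f (- z^-1) = z ^+ 2 * f z) -> c N = 0.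
Proof.
move=> hl hf; have half0 : 0 < 1 / 2 :> R by [].
have [K K0 hK] := prim_second_order 2 half0 hl.
pose s3 : R := Num.sqrt 3 / 2.
have s32 : s3 ^+ 2 = 3 / 4 by rewrite /s3 expr_div_n sqr_sqrtr // -natrX.
have s30 : 0 <= s3 by rewrite divr_ge0 ?sqrtr_ge0.
have s3l : 4 / 5 <= s3 by rewrite -(@ler_pXn2r _ 2) ?nnegrE // s32; lra.
have s3u : s3 <= 1 by rewrite -(@ler_pXn2r _ 2) ?nnegrE // s32; lra.
(* The segment from i to exp(i pi/3); it and its image under [z |-> -1/z] stay in the strip
   [1/2 <= Im <= 2]. *)
pose p : C := 'i; pose q : C := (1 / 2) +i* s3.
pose G z := prim N c (- z^-1) - prim N c z.
pose pt (t : R) : C := p + t%:C * (q - p).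
have ptE t : pt t = (t / 2) +i* (1 + t * (s3 - 1)).
  by rewrite /pt /p /q -complexr0; simpc; congr (_ +i* _); ring.
have reg t : 0 <= t <= 1 -> [/\ 1 / 2 <= complex.Im (pt t) <= 2,
    1 / 2 <= complex.Im (- (pt t)^-1) <= 2, 1 / 2 <= nm (pt t) & 0 < complex.Im (pt t)].
  move=> /andP[t0 t1].
  have y1 : 4 / 5 <= complex.Im (pt t) <= 1 by rewrite ptE /=; apply/andP; split; nra.
  have x1 : 0 <= complex.Re (pt t) <= 1 / 2 by rewrite ptE /=; apply/andP; split; lra.
  case/andP: y1 => y1 y2; case/andP: x1 => x1 x2.
  have n2 : 16 / 25 <= nm (pt t) ^+ 2 <= 5 / 4.
    by rewrite nm_sqr !expr2; apply/andP; split; nra.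
  case/andP: n2 => n2 n3.
  split; [by apply/andP; split; lra| | |by lra].
  - have -> : complex.Im (- (pt t)^-1) = complex.Im (pt t) / nm (pt t) ^+ 2.
      by rewrite nm_sqr; case: (pt t) => a b /=; rewrite opprK.
    rewrite ler_pdivlMr ?ler_pdivrMr; [|lra|lra].
    by apply/andP; split; nra.
  - by rewrite -(@ler_pXn2r _ 2) ?nnegrE ?nm_ge0 // expr2; lra.
have hG : G p = G q.
  apply: (@second_order_constant G p q ((17 * K + 2 * K) * nm (q - p) ^+ 2)) => s t hs ht.
  rewrite -/(pt t) -/(pt s); have [zi zi' zn z0] := reg s hs; have [wi wi' wn w0] := reg t ht.
  set z := pt s in zi zi' zn z0 *; set w := pt t in wi wi' wn w0 *.
  have E : nm (w - z) ^+ 2 = nm (q - p) ^+ 2 * (t - s) ^+ 2.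
    have -> : w - z = (t - s)%:C * (q - p) by rewrite /w /z /pt rmorphB /=; ring.
    by rewrite nmM nm_real exprMn real_normK ?num_real // mulrC.
  rewrite -mulrA -E.
  have zz : z != 0 by rewrite -nm_gt0; lra.
  have ww : w != 0 by rewrite -nm_gt0; lra.
  have [f1 h1] := hK z w zi wi; have [f2 h2] := hK (- z^-1) (- w^-1) zi' wi'.
  rewrite (hf z z0) in h2.
  (* By weight 2 the first-order terms at [z] and at [-1/z] cancel up to
     [f z * (w - z) ^+ 2 / w]. *)
  have -> : G w - G z = (prim N c (- w^-1) - prim N c (- z^-1) - z ^+ 2 * f z * (- w^-1 - - z^-1))
     - (prim N c w - prim N c z - f z * (w - z)) - f z * w^-1 * ((w - z) * (w - z)).
    rewrite /G; move: (prim N c (- w^-1)) (prim N c (- z^-1)) (prim N c w) (prim N c z) (f z).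
    by move=> a1 a2 a3 a4 a5; field; rewrite zz ww.
  apply: (le_trans (nmB _ _)); have h3 := nmB (prim N c (- w^-1) - prim N c (- z^-1) - z ^+ 2 * f z * (- w^-1 - - z^-1)) (prim N c w - prim N c z - f z * (w - z)).
  have h4 : nm (- w^-1 - - z^-1) ^+ 2 <= 16 * nm (w - z) ^+ 2.
    have -> : - w^-1 - - z^-1 = (w - z) * (w^-1 * z^-1) by field; rewrite zz ww.
    rewrite !nmM !nmV exprMn mulrC; apply: ler_wpM2r; first by rewrite exprn_ge0 ?nm_ge0.
    have iw : (nm w)^-1 <= 2 by rewrite -[2]invrK lef_pV2 ?posrE ?invr_gt0 //; lra.
    have iz : (nm z)^-1 <= 2 by rewrite -[2]invrK lef_pV2 ?posrE ?invr_gt0 //; lra.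
    have iw0 : 0 <= (nm w)^-1 by rewrite invr_ge0 nm_ge0.
    have iz0 : 0 <= (nm z)^-1 by rewrite invr_ge0 nm_ge0.
    have : (nm w)^-1 * (nm z)^-1 <= 2 * 2 by apply: ler_pM.
    have : 0 <= (nm w)^-1 * (nm z)^-1 by rewrite mulr_ge0.
    by rewrite expr2; nra.
  have h5 : nm (f z * w^-1 * ((w - z) * (w - z))) <= 2 * K * nm (w - z) ^+ 2.
    rewrite nmM -expr2 nmX; apply: ler_wpM2r; first by rewrite exprn_ge0 ?nm_ge0.
    rewrite nmM nmV mulrC; apply: ler_pM => //; rewrite ?nm_ge0 ?invr_ge0 ?nm_ge0 //.
    by rewrite -[2]invrK lef_pV2 ?posrE ?invr_gt0 //; lra.
  have h6 : K * nm (- w^-1 - - z^-1) ^+ 2 <= K * (16 * nm (w - z) ^+ 2) by rewrite ler_wpM2l.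
  by lra.
have Gp : G p = 0.
  have i0 : 'i != 0 :> C by rewrite -nm_gt0 nm_i.
  have ii : - 'i^-1 = 'i :> C.
    by apply: (mulfI i0); rewrite mulrN mulfV // -expr2 sqr_i.
  by rewrite /G /p ii subrr.
have q0 : q != 0 by rewrite -nm_gt0 (lt_le_trans _ (Im_le_nm _)) //= normr_gt0 lt0r_neq0 //; lra.
have qi : - q^-1 = q - 1.
  have : q * (q - 1) = -1.
    apply/eqP; rewrite eq_complex cReM cImM !cReD !cImD !cReN !cImN /=.
    by have := s32; rewrite expr2 => h; apply/andP; split; apply/eqP; lra.
  by move=> h; apply: (mulfI q0); rewrite mulrN mulfV // h.
move: hG; rewrite Gp /G qi /prim.
have -> : e (q - 1) = e q by rewrite -[X in q - X]/(1%:~R) -mulrNz eDint.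
have -> : qv (primc N c) (q - 1) = qv (primc N c) q.
  by rewrite /qv; have -> : e (q - 1) = e q by rewrite -[X in q - X]/(1%:~R) -mulrNz eDint.
move: (_ * qv _ q) => x h; have : c N = - (x + c N * (q - 1) - (x + c N * q)) by ring.
by rewrite -h oppr0.
Qed.

End ConstantTerm.

(** * Poincare series *)

Section BesselBounds.
Variable R : realType.
Local Notation C := R[i].
Opaque e.

Definition besc (k : nat) : R := ((k`! * (k + 11)`!)%:R)^-1.

Lemma besc_ge0 k : 0 <= besc k. Proof. by rewrite invr_ge0. Qed.

(** [besc k <= 1 / (k!)^2]; with [s = sqrt x], one factor of [(s^k / k!)^2] is bounded by [exp s]
    and the other is summed. *)
Lemma bes_sum_le (x : R) B : 0 <= x -> uniq B ->
  \sum_(k <- B) x ^+ k * besc k <= expR (2 * Num.sqrt x).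
Proof.
move=> x0 uB; set s := Num.sqrt x; have s0 : 0 <= s := sqrtr_ge0 x.
have a0 k : 0 <= s ^+ k / k`!%:R by rewrite divr_ge0 ?exprn_ge0.
have a1 k : s ^+ k / k`!%:R <= expR s by have := @sum_exp_le R s [:: k] s0 isT; rewrite big_seq1.
apply: (@le_trans _ _ (\sum_(k <- B) expR s * (s ^+ k / k`!%:R))).
  apply: ler_sum => k _; apply: (@le_trans _ _ ((s ^+ k / k`!%:R) * (s ^+ k / k`!%:R))); last first.
    by apply: ler_wpM2r.
  have -> : s ^+ k / k`!%:R * (s ^+ k / k`!%:R) = x ^+ k * (k`! * k`!)%:R^-1.
    by rewrite mulrACA -exprMn -expr2 sqr_sqrtr // natrM invfM.
  apply: ler_wpM2l; first exact: exprn_ge0.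
  rewrite lef_pV2 ?posrE ?ltr0n ?muln_gt0 ?fact_gt0 // ler_nat leq_mul2l; apply/orP; right.
  by apply: leq_fact; exact: leq_addr.
rewrite -mulr_sumr mulrDl mul1r expRD; apply: ler_wpM2l; first exact: expR_ge0.
exact: sum_exp_le.
Qed.

Lemma summ_bes (x : R) : 0 <= x -> summ (fun k => nm ((x ^+ k * besc k)%:C : C)).
Proof.
move=> x0; have h k : 0 <= x ^+ k * besc k by rewrite mulr_ge0 ?exprn_ge0 ?besc_ge0.
split=> [k|]; first exact: nm_ge0.
exists (expR (2 * Num.sqrt x)) => B uB; apply: le_trans (bes_sum_le x0 uB).
by apply: ler_sum => k _; rewrite nm_real ger0_norm.
Qed.

(** [x^(-11/2) I_11(2 sqrt x)], a power series in x free of square roots. *)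
Definition Bes (x : R) : C := csum (fun k => (x ^+ k * besc k)%:C : C).

Lemma has_sum_Bes x : 0 <= x -> has_sum (fun k => (x ^+ k * besc k)%:C : C) (Bes x).
Proof. by move=> x0; apply: csumP; exact: summ_bes. Qed.

Lemma nm_Bes_le x : 0 <= x -> nm (Bes x) <= expR (2 * Num.sqrt x).
Proof.
move=> x0; apply: (summ_has_sum_le (b := fun k => x ^+ k * besc k) (has_sum_Bes x0)).
  by move=> k; rewrite nm_real ger0_norm // mulr_ge0 ?exprn_ge0 ?besc_ge0.
by move=> B; exact: bes_sum_le.
Qed.

(** With [L = - ln (sqrt rho)], [2 sqrt (A r) <= A / L + r L]: half of the decay of [rho ^+ r] pays
    for the growth of the Bessel factor. *)
Lemma sqrt_exp_bound (A rho : R) : 0 <= A -> 0 < rho < 1 -> exists2 K : R, 0 <= K &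
  forall r : nat, expR (2 * Num.sqrt (A * r%:R)) * rho ^+ r <= K * Num.sqrt rho ^+ r.
Proof.
move=> A0 /andP[r0 r1]; set t := Num.sqrt rho.
have t0 : 0 < t by rewrite sqrtr_gt0.
have t1 : t < 1 by rewrite -sqrtr1 ltr_sqrt.
have l0 : 0 < - ln t by rewrite oppr_gt0 ln_lt0 // t0.
exists (expR (A / (- ln t))) => [|r]; first exact: expR_ge0.
have -> : rho ^+ r = t ^+ r * t ^+ r by rewrite -exprMn -expr2 sqr_sqrtr // ltW.
rewrite mulrA; apply: ler_wpM2r; first by rewrite exprn_ge0 // ltW.
have -> : t ^+ r = expR (r%:R * ln t) by rewrite expRM_natl lnK.
rewrite -expRD ler_expR; set L := - ln t in l0 *.
have -> : ln t = - L by rewrite /L opprK.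
set x := Num.sqrt (A * r%:R); have x2 : x ^+ 2 = A * r%:R by rewrite sqr_sqrtr // mulr_ge0.
rewrite mulrN lerBlDr.
have h : 0 <= (r%:R * L - x) ^+ 2 + 0 by rewrite addr0 sqr_ge0.
have r00 : 0 <= r%:R :> R by [].
have [rz|rz] := eqVneq (r%:R : R) 0.
  have -> : x = 0 by apply/eqP; rewrite -(@sqrf_eq0 R) x2 rz mulr0.
  by rewrite mulr0 rz mul0r addr0 divr_ge0 // ltW.
have rp : 0 < r%:R :> R by rewrite lt0r rz.
have hA : A = x ^+ 2 / r%:R by rewrite x2 mulfK.
rewrite hA -subr_ge0.
have -> : x ^+ 2 / r%:R / L + r%:R * L - 2 * x = (x - r%:R * L) ^+ 2 / (r%:R * L).
  by field; rewrite rz lt0r_neq0.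
by rewrite divr_ge0 ?sqr_ge0 // mulr_ge0 // ltW.
Qed.

Lemma summ_sqrtexp (A rho : R) m : 0 <= A -> 0 < rho < 1 ->
  summ (fun r : nat => r%:R ^+ m * (expR (2 * Num.sqrt (A * r%:R)) * rho ^+ r)).
Proof.
move=> A0 hr; have [K K0 hK] := sqrt_exp_bound A0 hr; case/andP: hr => r0 r1.
have t1 : nm ((Num.sqrt rho)%:C : C) < 1.
  by rewrite nm_real ger0_norm ?sqrtr_ge0 // -sqrtr1 ltr_sqrt.
apply: (summ_le (summZ K0 (summ_powq m t1))) => r.
rewrite !mulr_ge0 ?exprn_ge0 ?expR_ge0 ?(ltW r0) //= nmM !nmX nm_nat nm_real.
rewrite ger0_norm ?sqrtr_ge0 // [leRHS]mulrCA; apply: ler_wpM2l; first exact: exprn_ge0.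
exact: hK.
Qed.

Lemma qs_sqrtexp (c : nat -> C) (K A : R) m : 0 <= K -> 0 <= A ->
  (forall r : nat, nm (c r) <= K * (r%:R ^+ m * expR (2 * Num.sqrt (A * r%:R)))) -> qs c.
Proof.
move=> K0 A0 h; apply: qs_bounded => r hr; have [_ [L hL]] := summ_sqrtexp m A0 hr.
case/andP: hr => r0 r1; exists (K * L) => n.
have := hL [:: n] isT; rewrite big_seq1 => h1.
apply: le_trans (ler_wpM2l K0 h1); rewrite [n%:R ^+ m * (_ * _)]mulrA [leRHS]mulrA.
by apply: ler_wpM2r; [rewrite exprn_ge0 // ltW | exact: h].
Qed.

Lemma summ_expC_lip (w : C) (b : C) : 0 < complex.Im w ->
  summ (fun p : int * nat => nm (b ^+ p.2 / p.2`!%:R * (w + p.1%:~R) ^- (12 + p.2))).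
Proof.
move=> y0; have wn (l : int) : 0 < nm (w + l%:~R) by rewrite nm_gt0 nm_addint_neq0.
have s12 := summ_lip (p := 11) y0 isT.
apply: (summ_pair (c := fun l : int => expR (nm b / complex.Im w) * nm ((w + l%:~R) ^- 12))).
- by move=> p; exact: nm_ge0.
- by apply: summZ => //; exact: expR_ge0.
move=> l B uB /=.
apply: (@le_trans _ _ (\sum_(k <- B) nm ((w + l%:~R) ^- 12) * ((nm b / complex.Im w) ^+ k / k`!%:R))).
  apply: ler_sum => k _; rewrite !nmM !nmV !nmX nm_nat exprD invfM [leLHS]mulrCA -!exprVn.
  rewrite ?nmV; apply: ler_wpM2l; first by rewrite exprn_ge0 // invr_ge0 ltW.
  rewrite mulrAC expr_div_n; apply: ler_wpM2r => //.
  apply: ler_wpM2l; first by rewrite exprn_ge0 ?nm_ge0.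
  rewrite -exprVn; apply: lerXn2r; rewrite ?nnegrE ?invr_ge0 ?(ltW y0) ?(ltW (wn l)) //.
  by rewrite lef_pV2 ?posrE ?nm_addint_ge.
rewrite -mulr_sumr mulrC; apply: ler_wpM2r; first exact: nm_ge0.
by apply: sum_exp_le => //; rewrite divr_ge0 ?nm_ge0 ?ltW.
Qed.

(** Each [2 pi i] from the exponential pairs with a [- 2 pi i] from [lipK], and the product
    [(2 pi)^2] is positive. For this reason I_11 appears and not J_11. *)
Lemma lipK_pow (b : R) k : (twopii R * b%:C) ^+ k / k`!%:R * lipK R (11 + k) =
  (((2 * pi) ^+ 12 : R)%:C) * (((2 * pi) ^+ 2 * b) ^+ k * besc k : R)%:C.
Proof.
have t2 : - twopii R * twopii R = ((2 * pi) ^+ 2 : R)%:C.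
  rewrite mulNr /twopii mulrACA -expr2 -(expr2 'i) sqr_i mulrN1 opprK.
  by rewrite rmorphXn /= rmorphM /= rmorph_nat.
have t12 : (- twopii R) ^+ 12 = ((2 * pi) ^+ 12 : R)%:C.
  rewrite -[12%N]/(2 * 6)%N !exprM sqrrN.
  have -> : twopii R ^+ 2 = - ((2 * pi) ^+ 2 : R)%:C by rewrite -t2 mulNr opprK expr2.
  by rewrite -[6%N]/(2 * 3)%N !exprM sqrrN -!exprM -rmorphXn /= -exprM.
rewrite /lipK -/(twopii R) -[(11 + k).+1]/(12 + k)%N exprD t12 [(11 + k)%N]addnC.
have E1 : (((2 * pi) ^+ 2 * b : R)%:C : C) = - twopii R * twopii R * b%:C by rewrite t2 -rmorphM.
have E2 : ((besc k)%:C : C) = (k`!%:R * (k + 11)`!%:R)^-1.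
  by rewrite /besc fmorphV /= rmorph_nat natrM.
have E3 : ((((2 * pi) ^+ 2 * b) ^+ k * besc k : R)%:C : C) =
    (((2 * pi) ^+ 2 * b : R)%:C) ^+ k * (besc k)%:C by rewrite rmorphM rmorphXn.
rewrite E3 E1 E2 [(twopii R * b%:C) ^+ k]exprMn [(- twopii R * twopii R * b%:C) ^+ k]exprMn.
rewrite [(- twopii R * twopii R) ^+ k]exprMn.
have f1 : (k`!%:R : C) != 0 by rewrite pnatr_eq0 -lt0n fact_gt0.
have f2 : ((k + 11)`!%:R : C) != 0 by rewrite pnatr_eq0 -lt0n fact_gt0.
move: (((2 * pi) ^+ 12)%:C) (twopii R ^+ k) ((- twopii R) ^+ k) (b%:C ^+ k) => P x y u.
by field; rewrite f1 f2.
Qed.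

Definition lipB (b : R) (r : nat) : C :=
  ((2 * pi) ^+ 12 : R)%:C * r%:R ^+ 11 * Bes ((2 * pi) ^+ 2 * b * r%:R).

(** The exponential is expanded, Lipschitz's formula is applied to each exponent 12 + k, and the
    sums over k and r are exchanged; for fixed r the sum over k is a Bessel series. *)
Lemma lipschitz_exp (w : C) (b : R) : 0 < complex.Im w -> 0 <= b ->
  exists2 S, has_sum (fun l : int => (w + l%:~R) ^- 12 * expC (twopii R * b%:C / (w + l%:~R))) S
  & has_sum (fun r : nat => lipB b r * e w ^+ r) S.
Proof.
move=> y0 b0; set bt := twopii R * b%:C.
have sF := summ_expC_lip bt y0; have [S hS] := summ_has_sum sF.
have wn (l : int) : w + l%:~R != 0 by exact: nm_addint_neq0.
exists S.
  apply: (has_sum_pair hS) => l /=.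
  have := has_sumZ ((w + l%:~R) ^- 12) (has_sum_expC (bt / (w + l%:~R))).
  apply: has_sum_ext => k; rewrite expr_div_n exprD.
  move: ((w + l%:~R) ^+ 12) ((w + l%:~R) ^+ k) (bt ^+ k) (k`!%:R) => y x a f.
  by rewrite invfM; move: y^-1 x^-1 f^-1 => *; ring.
have hk : has_sum (fun k => bt ^+ k / k`!%:R * (lipK R (11 + k) * polylog (11 + k) w)) S.
  apply: (has_sum_pair (has_sum_pairC hS)) => k /=; apply: has_sumZ.
  exact: (@lipschitz R w (11 + k) y0).
have q1 := nm_e_lt1 y0; have q0 : 0 < nm (e w) by rewrite nm_gt0 e_neq0.
pose H (p : nat * nat) : C := bt ^+ p.2 / p.2`!%:R * (lipK R (11 + p.2) * (p.1%:R ^+ (11 + p.2) * e w ^+ p.1)).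
have HE r k : H (r, k) = ((2 * pi) ^+ 12 : R)%:C * r%:R ^+ 11 * e w ^+ r *
    (((2 * pi) ^+ 2 * b * r%:R) ^+ k * besc k : R)%:C.
  have E : ((((2 * pi) ^+ 2 * b * r%:R) ^+ k * besc k : R)%:C : C) =
     (((2 * pi) ^+ 2 * b) ^+ k * besc k : R)%:C * r%:R ^+ k.
    by rewrite exprMn mulrAC rmorphM /= rmorphXn /= rmorph_nat.
  rewrite /H /= mulrA lipK_pow exprD E.
  move: (((2 * pi) ^+ 12)%:C) ((((2 * pi) ^+ 2 * b) ^+ k * besc k)%:C) (e w ^+ r).
  by move: (r%:R ^+ k) (r%:R ^+ 11) => *; ring.
have pp : 0 <= (2 * pi : R) by rewrite mulr_ge0 ?pi_ge0.
have x0 (r : nat) : 0 <= (2 * pi) ^+ 2 * b * r%:R.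
  by apply: mulr_ge0 => //; apply: mulr_ge0 => //; exact: exprn_ge0.
have sH : summ (fun p => nm (H p)).
  have P0 : 0 <= (2 * pi : R) ^+ 12 by exact: exprn_ge0.
  have A0 : 0 <= (2 * pi : R) ^+ 2 * b by rewrite mulr_ge0 ?exprn_ge0.
  have sr := summ_sqrtexp 11 A0 (introT andP (conj q0 q1)).
  apply: (summ_pair _ (summZ P0 sr)) => [p|r B uB]; first exact: nm_ge0.
  under eq_bigr do rewrite HE nmM nm_real ger0_norm ?mulr_ge0 ?exprn_ge0 ?besc_ge0 //.
  rewrite -mulr_sumr [nm (_ * e w ^+ r)]nmM [nm (_ * r%:R ^+ 11)]nmM nm_real (ger0_norm P0) !nmX nm_nat.
  have r0 : 0 <= r%:R ^+ 11 :> R by exact: exprn_ge0.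
  have e0 : 0 <= nm (e w) ^+ r by rewrite exprn_ge0 ?nm_ge0.
  have := bes_sum_le (x0 r) uB; set X := \sum_(_ <- _) _; set Y := expR _ => XY.
  move: P0 r0 e0; move: ((2 * pi) ^+ 12) (r%:R ^+ 11) (nm (e w) ^+ r) => x y t x0' y0' t0.
  rewrite [leRHS](_ : _ = x * y * t * Y); last by ring.
  by apply: ler_wpM2l => //; rewrite !mulr_ge0.
have hH : has_sum H S.
  have sH' := summ_pairC sH.
  have hH' : has_sum (fun p : nat * nat => H (p.2, p.1)) S.
    apply: (has_sum_pairI sH' _ hk) => k /=.
    have h := has_sumZ (lipK R (11 + k)) (has_sum_polylog (11 + k) y0).
    exact: has_sumZ (bt ^+ k / k`!%:R) h.
  by apply: (has_sum_ext _ (has_sum_pairC hH')) => -[].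
apply: (has_sum_pair hH) => r; have h := has_sumZ (((2 * pi) ^+ 12 : R)%:C * r%:R ^+ 11 * e w ^+ r) (has_sum_Bes (x0 r)).
rewrite /lipB mulrAC; apply: (has_sum_ext _ h) => k.
by rewrite HE.
Qed.

End BesselBounds.

Section Poincare.
Variable R : realType.
Local Notation C := R[i].
Implicit Types (z w : C).
Opaque e.

(** Two top rows completing the same bottom row differ by an integral multiple of it, which
    translates [moeb] by an integer. *)
Lemma e_moeb_indep (n : nat) (a b a' b' c d : int) z : 0 < complex.Im z ->
  a * d - b * c = 1 -> a' * d - b' * c = 1 ->
  e (- (n%:R * moeb a b c d z)) = e (- (n%:R * moeb a' b' c d z)).
Proof.
move=> y0 h h'; have N0 := cxd_neq0 y0 (det_cd_neq0 h).
have [t ha hb] : exists2 t : int, a = a' + t * c & b = b' + t * d.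
  exists (a' * b - a * b').
    transitivity (a * (a' * d - b' * c)); first by rewrite h' mulr1.
    transitivity (a' * (a * d - b * c) + (a' * b - a * b') * c); first by ring.
    by rewrite h mulr1.
  transitivity (b * (a' * d - b' * c)); first by rewrite h' mulr1.
  transitivity (b' * (a * d - b * c) + (a' * b - a * b') * d); first by ring.
  by rewrite h mulr1.
have E : moeb a b c d z = moeb a' b' c d z + t%:~R.
  rewrite ha hb /moeb; move: N0; rewrite /cxd => N0; rewrite !rmorphD /= !rmorphM /=.
  by field.
rewrite E mulrDr opprD -[n%:R in X in _ + X]/(n%:Z%:~R) -rmorphM -rmorphN /= eDint //.
Qed.

(** A term of the Poincare series of index -n. Coprime pairs represent the cosets of the
    translations, each twice up to sign, and Bezout coefficients complete them to a matrix. *)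
Definition pc (n : nat) (p : int * int) z : C :=
  if coprimez p.1 p.2 then
    cxd p.1 p.2 z ^- 12 *
    e (- (n%:R * moeb (egcdz p.1 p.2).2 (- (egcdz p.1 p.2).1) p.1 p.2 z))
  else 0.

Lemma egcdz_det (c d : int) : coprimez c d ->
  (egcdz c d).2 * d - (- (egcdz c d).1) * c = 1.
Proof.
move=> /eqP cop; case: egcdzP => u v /= huv _.
by rewrite -cop -huv; ring.
Qed.

Lemma pcE n (a b c d : int) z : 0 < complex.Im z -> a * d - b * c = 1 ->
  pc n (c, d) z = cxd c d z ^- 12 * e (- (n%:R * moeb a b c d z)).
Proof.
move=> y0 h; have cop : coprimez c d.
  apply/coprimezP; exists (- b, a) => /=; by rewrite -h; ring.
rewrite /pc cop /=; congr (_ * _); apply: e_moeb_indep => //.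
exact: egcdz_det.
Qed.

(** The imaginary part of [moeb] is [Im z / |c z + d|^2], at most [Im z * latK z], so the
    exponentials are bounded and the lattice sum of weight 12 dominates. *)
Lemma summ_pc n z : 0 < complex.Im z -> summ (fun p => nm (pc n p z)).
Proof.
move=> y0; have K0 := latK_gt0 z; have p0 := pi_gt0 R.
have sl := summ_lat (k := 12) y0 isT.
have E0 : 0 <= expR (2 * pi * (n%:R * (complex.Im z * latK z))) by exact: expR_ge0.
apply: (summ_le_nm (summZ E0 sl)) => -[c d]; rewrite /pc /=.
case: ifP => cop; last by rewrite nm0 mulr_ge0 ?nm_ge0.
have hd := egcdz_det cop; have cd0 := det_cd_neq0 hd.
rewrite /lat (negPf cd0) /= nmM mulrC; apply: ler_wpM2r; first exact: nm_ge0.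
rewrite nm_e ler_expR cImN Im_natM mulrN opprK; apply: ler_wpM2l; first by rewrite mulr_ge0 // ltW.
apply: ler_wpM2l => //; rewrite Im_moeb //.
have N0 : 0 < nm (cxd c d z) ^+ 2 by rewrite exprn_gt0 // nm_gt0 cxd_neq0.
rewrite ler_pdivrMr // -mulrA -[leLHS]mulr1; apply: ler_wpM2l; first exact: ltW.
exact: cxd_lb.
Qed.

(** The factor 1/2 compensates for [(c, d)] and [(-c, -d)], which give the same term. *)
Definition poinc n z : C := 2^-1 * csum (fun p => pc n p z).

Lemma poinc_modular n (a b c d : int) z : a * d - b * c = 1 -> 0 < complex.Im z ->
  poinc n (moeb a b c d z) = cxd c d z ^+ 12 * poinc n z.
Proof.
move=> h y0; have N0 := cxd_neq0 y0 (det_cd_neq0 h).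
have y1 := Im_moeb_gt0 h y0.
pose g (p : int * int) := (p.1 * a + p.2 * c, p.1 * b + p.2 * d).
have bij : bijective g.
  exists (fun p => (p.1 * d - p.2 * c, p.2 * a - p.1 * b)) => -[m k]; rewrite /g /=; congr (_, _).
  - by rewrite -[RHS]mulr1 -h; ring.
  - by rewrite -[RHS]mulr1 -h; ring.
  - by rewrite -[RHS]mulr1 -h; ring.
  - by rewrite -[RHS]mulr1 -h; ring.
rewrite /poinc [RHS]mulrCA; congr (_ * _); apply: csumE.
have := has_sumZ (cxd c d z ^+ 12) (has_sum_bij bij (csumP (summ_pc n y0))).
apply: has_sum_ext => -[c' d'] /=; case: (boolP (coprimez c' d')) => cop; last first.
  have cop' : coprimez (c' * a + d' * c) (c' * b + d' * d) = false.
    apply/negP => /coprimezP[[u v] /= huv]; case/negP: cop.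
    by apply/coprimezP; exists (u * a + v * b, u * c + v * d) => /=; rewrite -huv; ring.
  by rewrite /pc /g /= cop' (negPf cop) mulr0.
have := egcdz_det cop; set a' := (egcdz c' d').2; set b' := - (egcdz c' d').1 => hd.
have hd' : (a' * a + b' * c) * (c' * b + d' * d) - (a' * b + b' * d) * (c' * a + d' * c) = 1.
  by rewrite -[RHS]mulr1 -{1}hd -h; ring.
rewrite (pcE n y1 hd) (pcE n y0 hd').
have M0 := cxd_neq0 y0 (det_cd_neq0 hd').
have E1 (u v : int) : cxd u v (moeb a b c d z) = cxd (u * a + v * c) (u * b + v * d) z / cxd c d z.
  by rewrite -(cxd_moeb u v h y0) mulfK.
have Em : moeb a' b' c' d' (moeb a b c d z) =
    moeb (a' * a + b' * c) (a' * b + b' * d) (c' * a + d' * c) (c' * b + d' * d) z.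
  rewrite /moeb !E1; move: (cxd _ _ z) (cxd _ _ z) M0 (cxd c d z) N0 => x y y' t t'.
  by field; rewrite ?y' ?t'.
by rewrite Em E1 [LHS]mulrA expr_div_n invf_div.
Qed.

Lemma inv_modP (c v : nat) : (0 < c)%N -> coprime v c -> exists t : int,
  (inv_mod c v)%:Z * v%:Z = 1 + t * c%:Z.
Proof.
move=> c0 cop; rewrite /inv_mod; case: (posnP v) => [v0|v0].
  (* [v = 0] is coprime to [c] only for [c = 1], where the congruence is trivial. *)
  rewrite v0 in cop *; have c1 : c = 1%N by move: cop; rewrite /coprime gcd0n => /eqP.
  by exists (-1); rewrite c1 mulr0.
case: egcdnP => // u t hu _; exists t%:Z.
have g1 : gcdn v c = 1%N by apply/eqP.
by rewrite /= -!PoszM hu g1 PoszD addrC.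
Qed.

Definition pT (n c r : nat) : C :=
  if c == 0%N then 0 else
  kloosterman R (- n%:Z) r%:Z c * c%:R ^- 12 * lipB (n%:R / c%:R ^+ 2) r.

(** Write [d = v + c l] and [w = z + v / c]. For an inverse [a] of [v] modulo [c], the image of [z]
    is [a / c - 1 / (c^2 (w + l))]: the first part gives the Kloosterman phase, and the second is
    summed over l by [lipschitz_exp] with [b = n / c^2]. *)
Lemma row_sum n (c : nat) z : 0 < complex.Im z -> (0 < c)%N ->
  exists2 A, has_sum (fun d : int => pc n (c%:Z, d) z) A
  & has_sum (fun r => pT n c r * e z ^+ r) A.
Proof.
move=> y0 c0; have c0' : (c%:R : C) != 0 by rewrite pnatr_eq0 -lt0n.
pose b : R := n%:R / c%:R ^+ 2.
have b0 : 0 <= b by rewrite divr_ge0 ?exprn_ge0.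
pose w (v : nat) : C := z + v%:R / c%:R.
have Imw v : complex.Im (w v) = complex.Im z.
  have -> : w v = z + (v%:R / c%:R : R)%:C by rewrite rmorphM fmorphV /= !rmorph_nat.
  by rewrite cImD /= addr0.
have yw v : 0 < complex.Im (w v) by rewrite Imw.
have /choice [S hS] : forall v : nat, exists S : C,
  has_sum (fun l : int => (w v + l%:~R) ^- 12 * expC (twopii R * b%:C / (w v + l%:~R))) S
  /\ has_sum (fun r : nat => lipB b r * e (w v) ^+ r) S.
  by move=> v; have [S h1 h2] := lipschitz_exp (yw v) b0; exists S.
pose ph (v : nat) : C := if coprime v c then
   c%:R ^- 12 * e ((- n%:Z * (inv_mod c v)%:Z)%:~R / c%:R) else 0.
have term (v : nat) (l : int) : pc n (c%:Z, v%:Z + c%:Z * l) z =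
    ph v * ((w v + l%:~R) ^- 12 * expC (twopii R * b%:C / (w v + l%:~R))).
  rewrite /ph; case: ifP => cop; last first.
    rewrite /pc /= [coprimez _ _](_ : _ = false) ?mul0r //.
    apply/negP => /coprimezP[[u t] /= hut]; move/negP: cop; apply.
    have : coprimez v%:Z c%:Z by apply/coprimezP; exists (t, u + t * l) => /=; rewrite -hut; ring.
    by rewrite coprimezE.
  have [t ht] := inv_modP c0 cop; set a := (inv_mod c v)%:Z in ht *.
  have hd : a * (v%:Z + c%:Z * l) - (t + a * l) * c%:Z = 1.
    by rewrite mulrDr ht; ring.
  rewrite (pcE n y0 hd).
  have wl : w v + l%:~R != 0 by exact: nm_addint_neq0.
  have Ec : cxd c%:Z (v%:Z + c%:Z * l) z = c%:R * (w v + l%:~R).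
    by rewrite /cxd /w rmorphD rmorphM /= -![(Posz _)%:~R]/(_%:R); field.
  have htC : a%:~R * v%:R = 1 + t%:~R * c%:R :> C.
    by have := congr1 (fun x : int => x%:~R : C) ht; rewrite rmorphD !rmorphM.
  have Em : moeb a (t + a * l) c%:Z (v%:Z + c%:Z * l) z = a%:~R / c%:R - (c%:R ^+ 2 * (w v + l%:~R))^-1.
    rewrite /moeb Ec /cxd rmorphD rmorphM /=.
    have -> : t%:~R = (a%:~R * v%:R - 1) / c%:R :> C by rewrite htC addrC addKr mulfK.
    have zE : z = w v - v%:R / c%:R by rewrite /w addrK.
    rewrite {1}zE; move: (w v) wl => y wl.
    by field; rewrite ?wl ?c0'.
  have Eexp : expC (twopii R * b%:C / (w v + l%:~R)) = e (b%:C / (w v + l%:~R)) by rewrite -mulrA.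
  have bE : b%:C = n%:R / c%:R ^+ 2 :> C.
    by rewrite rmorphM fmorphV /= rmorphXn /= !rmorph_nat.
  have Earg : - (n%:R * (a%:~R / c%:R - (c%:R ^+ 2 * (w v + l%:~R))^-1)) =
     (- n%:Z * a)%:~R / c%:R + b%:C / (w v + l%:~R).
    by rewrite bE rmorphM rmorphN /=; field; rewrite ?wl ?c0'.
  rewrite Ec Em Eexp Earg eD [(c%:R * _) ^+ 12]exprMn invfM; exact: mulrACA.
pose A : C := \sum_(v < c) ph v * S v.
exists A.
  pose g (p : 'I_c * int) : int := (p.1 : nat)%:Z + c%:Z * p.2.
  have ginj : injective g.
    move=> [v l] [v' l'] /= hg; have vc := ltn_ord v; have vc' := ltn_ord v'.
    have hl : l = l' by rewrite /g /= in hg; nia.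
    subst l'; congr (_, _); apply: val_inj; rewrite /g /= in hg *; lia.
  have sd : summ (fun d : int => nm (pc n (c%:Z, d) z)).
    by apply: (summ_inj (h := fun d : int => (c%:Z, d)) _ (summ_pc n y0)) => x y [].
  apply: (has_sum_inj ginj).
    move=> d hd; exfalso.
    have dm : (0 <= (d %% c%:Z)%Z < c%:Z)%R.
      by rewrite modz_ge0 ?ltz_pmod //; lia.
    have vc : (absz (d %% c%:Z)%Z < c)%N by lia.
    have := hd (Ordinal vc, (d %/ c%:Z)%Z); rewrite /g /= => /eqP; apply.
    by rewrite gez0_abs; [rewrite addrC mulrC -divz_eq | case/andP: dm].
  apply: (has_sum_pairI (summ_inj ginj sd) (g := fun v : 'I_c => ph v * S v)).
    move=> v; apply: (has_sum_ext _ (has_sumZ (ph v) (hS v).1)) => l.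
    by rewrite /g /= term.
  by apply: has_sum_fin; [exact: index_enum_uniq | move=> v; rewrite mem_index_enum].
have H := has_sum_sum (index_enum 'I_c) (fun v : 'I_c => has_sumZ (ph v) (hS v).2).
apply: (has_sum_ext _ H) => r; rewrite /pT gtn_eqF // /kloosterman.
rewrite mulr_suml mulr_suml mulr_suml [RHS]big_mkcond /=; apply: eq_bigr => v _.
rewrite /ph; case: ifP => cop; last by rewrite !mul0r.
have E1 : e (w v) ^+ r = e z ^+ r * e (r%:R * v%:R / c%:R).
  by rewrite -!e_natM -eD; congr e; rewrite /w; field.
have E2 : e ((- n%:Z * (inv_mod c v)%:Z + r%:Z * v%:Z)%:~R / c%:R) =
   e ((- n%:Z * (inv_mod c v)%:Z)%:~R / c%:R) * e (r%:R * v%:R / c%:R) :> C.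
  by rewrite -eD; congr e; rewrite rmorphD rmorphM /= mulrDl.
rewrite E1 E2; move: (c%:R ^- 12) (e (_ / c%:R)) (e (_ / c%:R)) (lipB b r) (e z ^+ r).
by move=> *; ring.
Qed.

Lemma nm_kloosterman (m n : int) c : nm (kloosterman R m n c) <= c%:R.
Proof.
apply: (le_trans (nm_sum _ _ _)); apply: (@le_trans _ _ (\sum_(v < c) 1)); last first.
  by rewrite sumr_const card_ord.
rewrite [leLHS]big_mkcond; apply: ler_sum => v _; case: ifP => // _.
set k := _ + _; have -> : (k%:~R / c%:R : C) = (k%:~R / c%:R : R)%:C.
  by rewrite rmorphM fmorphV /= rmorph_nat rmorph_int.
by rewrite nm_e /= mulr0 oppr0 expR0.
Qed.

Definition pTb (n r : nat) : R :=
  (2 * pi) ^+ 12 * (r%:R ^+ 11 * expR (2 * Num.sqrt ((2 * pi) ^+ 2 * n%:R * r%:R))).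

Lemma pTb_ge0 n r : 0 <= pTb n r.
Proof. by rewrite /pTb !mulr_ge0 ?exprn_ge0 ?expR_ge0 ?mulr_ge0 ?pi_ge0. Qed.

Lemma nm_lipB_le (n c r : nat) : (0 < c)%N -> nm (lipB (n%:R / c%:R ^+ 2) r : C) <= pTb n r.
Proof.
move=> c0; have pp : 0 <= (2 * pi : R) by rewrite mulr_ge0 ?pi_ge0.
have c1 : 1 <= c%:R ^+ 2 :> R by rewrite exprn_ege1 // ler1n.
have b0 : 0 <= n%:R / c%:R ^+ 2 :> R by rewrite divr_ge0 ?exprn_ge0.
have x0 : 0 <= (2 * pi) ^+ 2 * (n%:R / c%:R ^+ 2) * r%:R :> R.
  by apply: mulr_ge0 => //; apply: mulr_ge0 => //; exact: exprn_ge0.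
rewrite /lipB /pTb -mulrA nmM nm_real ger0_norm ?exprn_ge0 //.
apply: ler_wpM2l; first exact: exprn_ge0.
rewrite nmM nmX nm_nat; apply: ler_wpM2l; first exact: exprn_ge0.
apply: (le_trans (nm_Bes_le x0)); rewrite ler_expR; apply: ler_wpM2l => //.
rewrite ler_sqrt; last by apply: mulr_ge0 => //; apply: mulr_ge0 => //; exact: exprn_ge0.
apply: ler_wpM2r => //; apply: ler_wpM2l; first exact: exprn_ge0.
by rewrite ler_pdivrMr; [rewrite -[leLHS]mulr1 ler_wpM2l | lra].
Qed.

(** In weight 12 the trivial bound [c] for the Kloosterman sum leaves [c^-11], which is summable. *)
Lemma nm_pT_le (n c r : nat) : nm (pT n c r) <= 2 * (1 + c%:R ^+ 2)^-1 * pTb n r.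
Proof.
have g0 : 0 < 1 + c%:R ^+ 2 :> R by rewrite ltr_pwDl ?sqr_ge0.
rewrite /pT; case: (posnP c) => [c0|c0].
  by rewrite nm0 mulr_ge0 ?pTb_ge0 // mulr_ge0 // invr_ge0 ltW.
rewrite nmM; apply: ler_pM; rewrite ?nm_ge0 ?nm_lipB_le //.
have c1 : 1 <= c%:R :> R by rewrite ler1n.
rewrite nmM nmV nmX nm_nat; apply: (@le_trans _ _ (c%:R / c%:R ^+ 12)).
  by apply: ler_wpM2r; [rewrite invr_ge0 exprn_ge0 | exact: nm_kloosterman].
have cp : 0 < c%:R :> R by lra.
rewrite ler_pdivrMr ?exprn_gt0 // mulrAC ler_pdivlMr //.
have h : (c%:R : R) ^+ 3 <= c%:R ^+ 12 by rewrite ler_weXn2l.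
have e3 : c%:R ^+ 3 = c%:R * c%:R ^+ 2 :> R by rewrite exprS.
have : c%:R <= (c%:R : R) ^+ 3 by rewrite -[leLHS]expr1 ler_weXn2l.
rewrite e3 in h *; lra.
Qed.

Definition pcoef (n r : nat) : C := csum (fun c => pT n c r).

Lemma has_sum_pcoef n r : has_sum (fun c => pT n c r) (pcoef n r).
Proof.
apply: csumP; apply: (summ_le_nm _ (fun c => nm_pT_le n c r)).
have := summZ (_ : 0 <= 2 * pTb n r) (summ_invsq_nat R) => h.
have {}h := h (mulr_ge0 (ler0n _ 2) (pTb_ge0 n r)).
apply: (summ_le h) => c; apply/andP; split; last by rewrite mulrAC.
by rewrite mulr_ge0 ?pTb_ge0 // mulr_ge0 // invr_ge0 addr_ge0 ?sqr_ge0.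
Qed.

Lemma pcoef0 n : pcoef n 0 = 0.
Proof.
apply: csumE; apply: (has_sum_ext _ (@has_sum0 R _)) => c.
by rewrite /pT /lipB expr0n /= mulr0 mul0r mulr0; case: ifP.
Qed.

Lemma qs_pcoef n : qs (pcoef n).
Proof.
have [_ [M hM]] := summ_invsq_nat R.
have M0 : 0 <= M by have := hM [::] isT; rewrite big_nil.
have p12 : 0 <= (2 * pi : R) ^+ 12 by rewrite exprn_ge0 // mulr_ge0 ?pi_ge0.
apply: (@qs_sqrtexp _ _ (2 * M * (2 * pi) ^+ 12) ((2 * pi) ^+ 2 * n%:R) 11).
- by rewrite mulr_ge0 // mulr_ge0.
- by rewrite mulr_ge0 // exprn_ge0 // mulr_ge0 ?pi_ge0.
move=> r; apply: (summ_has_sum_le (b := fun c => 2 * (1 + c%:R ^+ 2)^-1 * pTb n r) (has_sum_pcoef n r)).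
  by move=> c; exact: nm_pT_le.
move=> B uB; rewrite -mulr_suml -mulr_sumr /pTb mulrA; apply: ler_wpM2r.
  by rewrite mulr_ge0 ?exprn_ge0 ?expR_ge0.
by apply: ler_wpM2r => //; apply: ler_wpM2l => //; exact: hM.
Qed.

Lemma pc_opp n (c d : int) z : 0 < complex.Im z -> pc n (- c, - d) z = pc n (c, d) z.
Proof.
move=> y0; case: (boolP (coprimez c d)) => cop; last first.
  have cop' : coprimez (- c) (- d) = false.
    by apply: negbTE; apply: contra cop; rewrite !coprimezE !abszN.
  by rewrite /pc /= cop' (negPf cop).
have hd := egcdz_det cop; move: hd; set a := (egcdz c d).2; set b := - (egcdz c d).1 => hd.
have hd' : (- a) * (- d) - (- b) * (- c) = 1 by rewrite !mulrNN.
rewrite (pcE n y0 hd) (pcE n y0 hd').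
have Nz := cxd_neq0 y0 (det_cd_neq0 hd).
have Ec (u v : int) : cxd (- u) (- v) z = - cxd u v z by rewrite /cxd !rmorphN /=; ring.
rewrite !Ec /moeb !Ec invrN mulrNN; congr (_ * _).
by rewrite exprNn -signr_odd expr0 mul1r.
Qed.

(** The pairs [(0, 1)] and [(0, -1)] give [2 q^-n], and the rows [c] and [-c] coincide. The rows
    [c > 0] form an absolutely summable double series in [c] and the power of q, which is summed
    over [c] last. *)
Lemma poinc_lq n : lq n (fun i => cst1 1 i + shq n (pcoef n) i) (poinc n).
Proof.
split=> [|z y0]; first by apply: qsD; [exact: qs_cst1 | apply: qs_sh; exact: qs_pcoef].
rewrite qvD ?qv_cst1 ?qv_sh //; [| exact: qs_pcoef | exact: qs_cst1 | by apply: qs_sh; exact: qs_pcoef].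
have en : e z ^+ n != 0 by rewrite expf_neq0 // e_neq0.
suff H : poinc n z = e z ^- n + qv (pcoef n) z.
  by rewrite H mulrDl mulVf // mulrC.
have /choice [A hA] : forall c : nat, exists A : C, (0 < c)%N ->
    has_sum (fun d : int => pc n (c%:Z, d) z) A /\ has_sum (fun r => pT n c r * e z ^+ r) A.
  move=> c; case: (posnP c) => [->|c0]; first by exists 0.
  by have [A h1 h2] := row_sum n y0 c0; exists A.
have row0 : has_sum (fun d : int => pc n (0, d) z) (2 * e z ^- n).
  have one (d : int) : (d == 1) || (d == -1) -> pc n (0, d) z = e z ^- n.
    move=> hd; have hdd : d * d - 0 * 0 = 1 by case/orP: hd => /eqP ->.
    rewrite (pcE n y0 hdd) /moeb /cxd !mul0r !add0r addr0.
    have dC : (d%:~R : C) ^+ 2 = 1 by rewrite expr2 -rmorphM /=; case/orP: hd => /eqP ->.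
    have d0 : (d%:~R : C) != 0 by case/orP: hd => /eqP ->; rewrite ?oppr_eq0 oner_eq0.
    rewrite [d%:~R * z / _]mulrAC mulfV // mul1r -[12%N]/(2 * 6)%N exprM dC expr1n invr1 mul1r.
    by rewrite eN e_natM.
  have -> : 2 * e z ^- n = \sum_(d <- [:: 1; -1] : seq int) pc n (0, d) z.
    by rewrite big_cons big_seq1 !one // mulr2n mulrDl mul1r.
  apply: has_sum_fin => // d.
  rewrite !inE => hd; rewrite /pc /= [coprimez _ _](_ : _ = false) //.
  by rewrite coprimezE /= /coprime gcd0n; lia.
pose g (c : int) : C := if c == 0 then 2 * e z ^- n else A `|c|%N.
have hg : has_sum g (csum (fun p => pc n p z)).
  apply: (has_sum_pair (csumP (summ_pc n y0))) => c; rewrite /g.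
  have [->|c0] := eqVneq c 0; first exact: row0.
  have c1 : (0 < `|c|)%N by lia.
  have [h1 _] := hA _ c1; have [cp|cn] := leP 0 c.
    by apply: (has_sum_ext _ h1) => d; rewrite gez0_abs.
  have bij : bijective (fun d : int => - d) by exists (fun d => - d) => x; rewrite opprK.
  apply: (has_sum_ext _ (has_sum_bij bij h1)) => d /=.
  by rewrite -[in RHS](opprK c) -(ltz0_abs cn) -[in RHS](opprK d) pc_opp.
have hu : has_sum (fun u : nat => if u == 0%N then 2 * e z ^- n else 2 * A u) (csum (fun p => pc n p z)).
  apply: (has_sum_fiber (h := absz) hg) => u.
  pose L : seq int := undup [:: u%:Z; - u%:Z].
  rewrite (_ : (if _ then _ else _) = \sum_(t <- L) if `|t|%N == u then g t else 0).
    apply: has_sum_fin; first exact: undup_uniq.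
    by move=> t; rewrite mem_undup !inE => ht; rewrite ifF //; apply/negP => hu; lia.
  rewrite {}/L; case: u => [|u].
    by rewrite (_ : undup [:: 0%:Z; - 0%:Z] = [:: 0]) // big_seq1 /g eqxx.
  rewrite (_ : undup [:: u.+1%:Z; - u.+1%:Z] = [:: u.+1%:Z; - u.+1%:Z]) //.
  by rewrite big_cons big_seq1 /g abszN /= eqxx /= mulr2n mulrDl !mul1r.
have h0 := @has_sum1 R _ (fun u : nat => if u == 0%N then 2 * e z ^- n else 0) 0%N.
have {}h0 := h0 (fun x (hx : x != 0%N) => ifN _ _ hx).
have hA' : has_sum (fun u => if u == 0%N then 0 else A u) (poinc n z - e z ^- n).
  have -> : poinc n z - e z ^- n = 2^-1 * (csum (fun p => pc n p z) - 2 * e z ^- n).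
    by rewrite /poinc mulrBr mulKf // pnatr_eq0.
  apply: (has_sum_ext _ (has_sumZ 2^-1 (has_sumB hu h0))) => u.
  by case: ifP => _; [rewrite subrr mulr0 | rewrite subr0 mulKf // pnatr_eq0].
have q1 := nm_e_lt1 y0; have q0 : 0 < nm (e z) by rewrite nm_gt0 e_neq0.
have sp : summ (fun p : nat * nat => nm (pT n p.1 p.2 * e z ^+ p.2)).
  have A0 : 0 <= (2 * pi : R) ^+ 2 * n%:R by rewrite mulr_ge0 // exprn_ge0 // mulr_ge0 ?pi_ge0.
  have p12 : 0 <= (2 * pi : R) ^+ 12 by rewrite exprn_ge0 // mulr_ge0 ?pi_ge0.
  have s1 := summZ (ler0n R 2) (summ_invsq_nat R).
  have s2 := summZ p12 (summ_sqrtexp 11 A0 (introT andP (conj q0 q1))).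
  apply: (summ_le_nm (summ_pair_prod s1 s2)) => -[c r] /=.
  rewrite nmM nmX; apply: (le_trans (ler_wpM2r _ (nm_pT_le n c r))); first by rewrite exprn_ge0 ?nm_ge0.
  by rewrite /pTb !mulrA.
have hp : has_sum (fun p : nat * nat => pT n p.1 p.2 * e z ^+ p.2) (poinc n z - e z ^- n).
  apply: (has_sum_pairI sp _ hA') => c /=; case: (posnP c) => [->|c0].
    by apply: (has_sum_ext _ (@has_sum0 R _)) => r; rewrite /pT mul0r.
  by have [_] := hA c c0.
have hr : has_sum (fun r => pcoef n r * e z ^+ r) (poinc n z - e z ^- n).
  apply: (has_sum_pair (has_sum_pairC hp)) => r /=.
  exact: has_sumZr (has_sum_pcoef n r).
by rewrite /qv (csumE hr) addrC subrK.
Qed.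

End Poincare.

(** * Hecke operators *)

Section Hecke.
Variable R : realType.
Local Notation C := R[i].
Implicit Types (z w : C) (f : C -> C).
Opaque e.

Definition hecke_idx n := [seq (d, b) | d <- divisors n, b <- iota 0 d].

Lemma mem_hecke_idx n d b : (0 < n)%N ->
  ((d, b) \in hecke_idx n) = (d %| n)%N && (b < d)%N.
Proof.
move=> n0; apply/allpairsPdep/andP => [[x [y [hx hy [-> ->]]]]|[hd hb]].
  by move: hx hy; rewrite -dvdn_divisors // mem_iota.
by exists d, b; rewrite -dvdn_divisors // mem_iota.
Qed.

Lemma hecke_idx_uniq n : uniq (hecke_idx n).
Proof.
apply: allpairs_uniq_dep => [|d _|[x1 x2] [y1 y2] _ _ /= [-> ->]] //.
  exact: divisors_uniq.
exact: iota_uniq.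
Qed.

(* [(a, b; 0, d) S] is factored as an element of SL2(Z) times a matrix in
   Hermite normal form [(a', b'; 0, d')]. *)
Definition hecke_rel (n : nat) (p p' : nat * nat) (al be ga de : int) :=
  [/\ al * de - be * ga = 1, p.2%:Z = al * (n %/ p'.1)%:Z,
      - (n %/ p.1)%:Z = al * p'.2%:Z + be * p'.1%:Z,
      p.1%:Z = ga * (n %/ p'.1)%:Z & 0 = ga * p'.2%:Z + de * p'.1%:Z].

(** The product with S is [(b, -a; d, 0)]. Its first column is [g = gcdn b d] times a primitive
    column, which becomes the first column of the unimodular factor; hence [d' = n / g], and [b'] is
    fixed modulo [d'] by a Bezout relation. *)
Lemma hecke_step n (p : nat * nat) : (0 < n)%N -> p \in hecke_idx n ->
  exists2 p', p' \in hecke_idx n & exists al be ga de, hecke_rel n p p' al be ga de.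
Proof.
case: p => d b n0; rewrite mem_hecke_idx // => /andP[dn bd].
have d0 : (0 < d)%N by apply: dvdn_gt0 dn.
pose g := gcdn b d; have g0 : (0 < g)%N by rewrite gcdn_gt0 d0 orbT.
have [al hal] : exists al, b = (al * g)%N by apply/dvdnP; exact: dvdn_gcdl.
have [ga hga] : exists ga, d = (ga * g)%N by apply/dvdnP; exact: dvdn_gcdr.
have [a ha] : exists a, n = (a * d)%N by apply/dvdnP.
have ga0 : (0 < ga)%N by move: d0; rewrite hga; case: (ga).
have a0 : (0 < a)%N by move: n0; rewrite ha; case: (a).
have cop : coprimez al ga.
  rewrite coprimezE /= /coprime; have : gcdn b d = g by [].
  rewrite {1}hal {1}hga -muln_gcdl -[X in _ = X]mul1n => /eqP.
  by rewrite eqn_pmul2r.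
case/coprimezP: cop => -[u v] /= huv.
pose d' := (a * ga)%N; have d'0 : (0 < d')%N by rewrite muln_gt0 a0.
pose k := ((- (u * a%:Z)) %/ d'%:Z)%Z; pose b' := ((- (u * a%:Z)) %% d'%:Z)%Z.
have hk : - (u * a%:Z) = k * d'%:Z + b' by exact: divz_eq.
have b'0 : 0 <= b' by rewrite modz_ge0; lia.
have b'1 : b' < d'%:Z by rewrite ltz_pmod //; lia.
have nE : n = (g * d')%N by rewrite ha hga /d' mulnA mulnC.
have E1 : (n %/ d' = g)%N by rewrite nE mulnK.
have E2 : (n %/ d = a)%N by rewrite ha mulnK.
have b'E : (`|b'|%N)%:Z = b' by rewrite gez0_abs.
have b'E2 : b' = - (u + k * ga%:Z) * a%:Z.
  have : b' = - (u * a%:Z) - k * d'%:Z by rewrite hk addrC addKr.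
  by rewrite /d' PoszM => ->; ring.
exists (d', `|b'|%N); first by rewrite mem_hecke_idx // nE dvdn_mull //; lia.
exists al%:Z, (- v + k * al%:Z), ga%:Z, (u + k * ga%:Z).
rewrite /hecke_rel /= E1 E2 b'E b'E2 /d' PoszM; split.
- by rewrite -huv; ring.
- by rewrite hal PoszM.
- transitivity (- a%:Z * (u * al%:Z + v * ga%:Z)); first by rewrite huv mulr1.
  by ring.
- by rewrite hga PoszM.
- by ring.
Qed.

(** Two forms with the same image differ by a unimodular matrix on the left. Being upper triangular
    with positive diagonals, they differ by a translation, and [b < d] excludes all but the trivial
    one. *)
Lemma hecke_rel_inj n p1 p2 p' a1 b1 c1 d1 a2 b2 c2 d2 : (0 < n)%N ->
  p1 \in hecke_idx n -> p2 \in hecke_idx n -> p' \in hecke_idx n ->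
  hecke_rel n p1 p' a1 b1 c1 d1 -> hecke_rel n p2 p' a2 b2 c2 d2 -> p1 = p2.
Proof.
case: p1 p2 p' => [x1 y1] [x2 y2] [x' y'] n0; rewrite !mem_hecke_idx //.
move=> /andP[hx1 hy1] /andP[hx2 hy2] /andP[hx' hy'].
rewrite /hecke_rel /=; set a' := (n %/ x')%:Z.
have a'0 : 0 < a' by rewrite /a' ltz_nat divn_gt0 ?(dvdn_leq _ hx') //; apply: leq_trans hy'.
have [x10 x20 x'0] : [/\ (0 < x1)%N, (0 < x2)%N & (0 < x')%N] by split; [apply: leq_trans hy1 | apply: leq_trans hy2 | apply: leq_trans hy'].
case=> D1 e1 _ f1 g1 [D2 e2 _ f2 g2].
have c10 : 0 < c1 by rewrite -(pmulr_lgt0 _ a'0) -f1; lia.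
have c20 : 0 < c2 by rewrite -(pmulr_lgt0 _ a'0) -f2; lia.
have hcd : c1 * d2 = c2 * d1.
  have x'n : x'%:Z != 0 by lia.
  apply: (mulIf x'n); rewrite -!mulrA.
  have -> : d2 * x'%:Z = - (c2 * y'%:Z) by apply/eqP; rewrite -addr_eq0 addrC -g2.
  have -> : d1 * x'%:Z = - (c1 * y'%:Z) by apply/eqP; rewrite -addr_eq0 addrC -g1.
  by ring.
have cE : c1 = c2.
  have k1 : c1 = c2 * (a2 * d1 - b2 * c1).
    have : c1 * (a2 * d2 - b2 * c2) = c2 * (a2 * d1 - b2 * c1).
      by rewrite !mulrBr mulrCA hcd; ring.
    by rewrite D2 mulr1.
  have k2 : c2 = c1 * (a1 * d2 - b1 * c2).
    have : c2 * (a1 * d1 - b1 * c1) = c1 * (a1 * d2 - b1 * c2).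
      by rewrite !mulrBr mulrCA -hcd; ring.
    by rewrite D1 mulr1.
  move: (a2 * d1 - b2 * c1) (a1 * d2 - b1 * c2) k1 k2 => s t k1 k2.
  have s0 : 0 < s by rewrite -(pmulr_rgt0 _ c20) -k1.
  have t0 : 0 < t by rewrite -(pmulr_rgt0 _ c10) -k2.
  by apply/eqP; rewrite eq_le {1}k2 [X in _ && (_ <= X)]k1 !ler_peMr //; lia.
subst c2; have dE : d1 = d2 by apply: (mulfI (x := c1)); [lia | rewrite hcd].
subst d2; have xE : x1 = x2 by move: f1; rewrite -f2 => -[].
subst x2; congr (_, _).
have q : (a1 - a2) * d1 = (b1 - b2) * c1.
  by apply/eqP; rewrite -subr_eq0; apply/eqP; transitivity (a1 * d1 - b1 * c1 - (a2 * d1 - b2 * c1)); [ring | rewrite D1 D2].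
have q2 : a1 - a2 = c1 * ((a1 - a2) * - b1 + a1 * (b1 - b2)).
  transitivity ((a1 - a2) * (a1 * d1 - b1 * c1)); first by rewrite D1 mulr1.
  by rewrite mulrBr mulrCA q; ring.
have q3 : y1%:Z - y2%:Z = x1%:Z * ((a1 - a2) * - b1 + a1 * (b1 - b2)).
  by rewrite e1 e2 -mulrBl {1}q2 f1; ring.
move: ((a1 - a2) * - b1 + a1 * (b1 - b2)) q3 => t q3.
have x1p : 0 <= x1%:Z by [].
have [t1|t1] := leP 1 t; first last.
  have [t2|t2] := leP t (-1); last by move: q3; rewrite (_ : t = 0) ?mulr0; lia.
  have : x1%:Z <= x1%:Z * (- t) by rewrite ler_peMr //; lia.
  by rewrite mulrN; move: (x1%:Z * t) q3 => s q3; lia.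
have : x1%:Z <= x1%:Z * t by rewrite ler_peMr.
by move: (x1%:Z * t) q3 => s q3; lia.
Qed.

Definition hecke_sum (om : nat -> C) n f z : C :=
  \sum_(d <- divisors n) om d * \sum_(b < d) f (((n %/ d)%:R * z + b%:R) / d%:R).

Lemma hecke_sumE om n f z : hecke_sum om n f z =
  \sum_(p <- hecke_idx n) om p.1 * f (((n %/ p.1)%:R * z + p.2%:R) / p.1%:R).
Proof.
rewrite /hecke_idx big_allpairs_dep /=; apply: eq_bigr => d _; rewrite mulr_sumr.
rewrite [RHS](_ : _ = \sum_(0 <= b < d) om d * f (((n %/ d)%:R * z + b%:R) / d%:R)).
  by rewrite big_mkord.
by rewrite /index_iota subn0.
Qed.

Lemma Im_affine (a b d : nat) z : complex.Im ((a%:R * z + b%:R) / d%:R) =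
  a%:R * complex.Im z / d%:R.
Proof.
have -> : (a%:R * z + b%:R) / d%:R = (d%:R^-1 : R)%:C * (a%:R * z + b%:R).
  by rewrite fmorphV /= rmorph_nat mulrC.
by rewrite cImM /= mul0r addr0 cImD Im_natM Im_nat addr0 mulrC.
Qed.

(** [hecke_step] maps the finite set of Hermite forms to itself and [hecke_rel_inj] makes this map
    injective, hence a permutation of the terms. *)
Lemma hecke_sum_S (k n : nat) f z : (0 < n)%N ->
  (forall (a b c d : int) z, a * d - b * c = 1 -> 0 < complex.Im z ->
     f (moeb a b c d z) = cxd c d z ^+ k * f z) -> 0 < complex.Im z ->
  hecke_sum (fun d => d%:R ^- k) n f (- z^-1) = z ^+ k * hecke_sum (fun d => d%:R ^- k) n f z.
Proof.
move=> n0 hf y0; have z0 : z != 0 by apply: contraTneq y0 => ->; rewrite ltxx.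
have /choice [ph hph] : forall p : nat * nat, exists p' : nat * nat, p \in hecke_idx n ->
    p' \in hecke_idx n /\ exists al be ga de, hecke_rel n p p' al be ga de.
  move=> p; have [hp|] := boolP (p \in hecke_idx n); last by exists p.
  by have [p' h1 h2] := hecke_step n0 hp; exists p'.
have phi_inj : {in hecke_idx n &, injective ph}.
  move=> p1 p2 h1 h2 E; have [i1 [a1 [b1 [c1 [d1 r1]]]]] := hph _ h1.
  have [i2 [a2 [b2 [c2 [d2 r2]]]]] := hph _ h2; rewrite -E in i2 r2.
  exact: (hecke_rel_inj n0 h1 h2 i1 r1 r2).
have pe : perm_eq (map ph (hecke_idx n)) (hecke_idx n).
  apply: uniq_perm; rewrite ?hecke_idx_uniq ?map_inj_in_uniq ?hecke_idx_uniq //.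
  have [] := @uniq_min_size _ (map ph (hecke_idx n)) (hecke_idx n) => //.
  - by rewrite map_inj_in_uniq ?hecke_idx_uniq.
  - by move=> p' /mapP[p hp ->]; have [] := hph _ hp.
  - by rewrite size_map.
rewrite !hecke_sumE -[in RHS](perm_big _ pe) /= big_map mulr_sumr big_seq [RHS]big_seq.
apply: eq_bigr => -[d b] hp; have [] := hph _ hp; case: (ph (d, b)) => d' b' /=.
rewrite mem_hecke_idx // => /andP[d'n b'd'] [al [be [ga [de [D e1 e2 e3 e4]]]]].
move: e1 e2 e3 e4 => /= e1 e2 e3 e4.
move: hp; rewrite mem_hecke_idx // => /andP[dn bd].
have d0 : (d%:R : C) != 0 by rewrite pnatr_eq0 -lt0n; apply: leq_trans bd.
have d'0 : (d'%:R : C) != 0 by rewrite pnatr_eq0 -lt0n; apply: leq_trans b'd'.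
set a' := (n %/ d')%N in e1 e3 *; set a := (n %/ d)%N in e2 *.
pose z' : C := (a'%:R * z + b'%:R) / d'%:R.
have y' : 0 < complex.Im z'.
  rewrite /z' Im_affine divr_gt0 ?mulr_gt0 ?ltr0n //; last by apply: leq_trans b'd'.
  by rewrite divn_gt0; [exact: dvdn_leq | apply: leq_trans b'd'].
have toC (x y : int) : x = y -> x%:~R = y%:~R :> C by move=> ->.
have {}e1 := toC _ _ e1; have {}e2 := toC _ _ e2; have {}e3 := toC _ _ e3; have {}e4 := toC _ _ e4.
move: e1 e2 e3 e4; rewrite !rmorphD !rmorphN !rmorphM /= -![(Posz _)%:~R]/(_%:R) => e1 e2 e3 e4.
have Ec : cxd ga de z' = d%:R * z / d'%:R.
  rewrite /cxd /z' e3; have : de%:~R = - (ga%:~R * b'%:R) / d'%:R :> C.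
    by apply: (mulIf d'0); rewrite mulfVK //; apply/eqP; rewrite -addr_eq0 addrC -e4.
  by move=> ->; field.
have Ea : cxd al be z' = (b%:R * z - a%:R) / d'%:R.
  by rewrite /cxd /z' e1 e2; field.
have -> : (a%:R * - z^-1 + b%:R) / d%:R = moeb al be ga de z'.
  by rewrite /moeb Ec Ea; field; rewrite ?d0 ?z0 ?d'0.
rewrite (hf _ _ _ _ _ D y') Ec -/z' !expr_div_n exprMn.
have dk : (d%:R : C) ^+ k != 0 by rewrite expf_neq0.
rewrite !mulrA mulVf // mul1r; by move: (f z') => ?; ring.
Qed.

(** Summing over b modulo d at [(a z + b) / d] keeps the exponents [d l] and sends them to [a l]; so
    the coefficient at [k = a l] is that of index [d (k / a)]. *)
Definition hecke_coef (a d : nat) (u : nat -> C) (k : nat) : C :=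
  if (a %| k)%N then u (d * (k %/ a))%N else 0.

Lemma nm_e_affine (a d b : nat) z : (0 < d)%N ->
  nm (e ((a%:R * z + b%:R) / d%:R)) ^+ d = nm (e z) ^+ a.
Proof.
move=> d0; have d0' : (d%:R : C) != 0 by rewrite pnatr_eq0 -lt0n.
by rewrite -!nmX -!e_natM [d%:R * _]mulrC mulfVK // eDnat.
Qed.

Lemma qs_hecke_coef a d u : (0 < a)%N -> (0 < d)%N -> qs u -> qs (hecke_coef a d u).
Proof.
move=> a0 d0 qu; apply: qs_bounded => r /andP[r0 r1].
have rC : r%:C != 0 :> C by rewrite -nm_gt0 nm_real normr_gt0 gt_eqF.
have rn : nm (r%:C : C) = r by rewrite nm_real ger0_norm // ltW.
have [|z yz hz] := e_surj rC; first by rewrite rn.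
have y0 : 0 < complex.Im z := yz.
have y1 : 0 < complex.Im ((a%:R * z + 0%:R) / d%:R).
  by rewrite Im_affine divr_gt0 ?mulr_gt0 ?ltr0n.
have [s0 [M hM]] := qs_at qu y1; exists M => k; rewrite /hecke_coef; case: ifP => hk.
  have /dvdnP[l lE] := hk; rewrite lE mulnK //.
  have := hM [:: (d * l)%N] isT; rewrite big_seq1 exprM nm_e_affine // hz rn.
  by rewrite -exprM [(a * l)%N]mulnC.
by rewrite nm0 mul0r; have := hM [::] isT; rewrite big_nil.
Qed.

Lemma sum_hecke_qv a d u z : (0 < a)%N -> (0 < d)%N -> qs u -> 0 < complex.Im z ->
  \sum_(b < d) qv u ((a%:R * z + b%:R) / d%:R) = d%:R * qv (hecke_coef a d u) z.
Proof.
move=> a0 d0 qu y0; have d0' : (d%:R : C) != 0 by rewrite pnatr_eq0 -lt0n.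
pose w (b : nat) : C := (a%:R * z + b%:R) / d%:R.
have yw b : 0 < complex.Im (w b) by rewrite Im_affine divr_gt0 ?mulr_gt0 ?ltr0n.
have H := has_sum_sum (index_enum 'I_d) (fun b : 'I_d => qs_has_sum qu (yw b)).
set S := \sum_(b < d) _; set S' := \sum_(_ <- _) _ in H.
have SE : S = S' by [].
pose F (k : nat) : C := if (d %| k)%N then d%:R * (u k * e z ^+ (a * (k %/ d))) else 0.
have HF : has_sum F S.
  rewrite SE; apply: (has_sum_ext _ H) => k; rewrite /F -mulr_sumr.
  have E (b : 'I_d) : e (w b) ^+ k = e (k%:R * (a%:R * z / d%:R)) * e (k%:R * b%:R / d%:R).
    by rewrite -e_natM -eD; congr e; rewrite /w; field.
  rewrite (eq_bigr _ (fun b _ => E b)) -mulr_sumr sum_e_orth //.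
  case: ifP => hk; last by rewrite !mulr0.
  have /dvdnP[l lE] := hk; rewrite lE mulnK // natrM.
  have -> : l%:R * d%:R * (a%:R * z / d%:R) = (a * l)%:R * z :> C by rewrite natrM; field.
  by rewrite e_natM; ring.
have sF : summ (fun k => nm (F k)).
  have dp : 0 <= d%:R :> R by [].
  apply: (summ_le_nm (summZ dp (qs_at qu (yw 0%N)))) => k; rewrite /F; case: ifP => hk.
    have /dvdnP[l lE] := hk.
    rewrite [nm (d%:R * _)]nmM nm_nat [nm (u k * _)]nmM nmX lE mulnK //.
    by rewrite [X in _ <= _ * (_ * X)](_ : _ = nm (e z) ^+ (a * l)) // mulnC exprM nm_e_affine // -exprM.
  by rewrite nm0 !mulr_ge0 ?nm_ge0 ?exprn_ge0 ?nm_ge0.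
have di : injective (fun l => d * l)%N by move=> x y /eqP; rewrite eqn_pmul2l // => /eqP.
have ai : injective (fun l => a * l)%N by move=> x y /eqP; rewrite eqn_pmul2l // => /eqP.
have H1 := has_sum_inj_inv di _ sF HF.
have H2 : has_sum (fun l => F (d * l)%N) S.
  apply: H1 => k hk; rewrite /F; case: ifP => // /dvdnP[l lE].
  by have := hk l; rewrite lE mulnC eqxx.
have qh := qs_hecke_coef a0 d0 qu.
apply: (has_sum_uniq _ (has_sumZ d%:R (qs_has_sum qh y0))).
apply: (has_sum_inj ai) => [k hk|].
  rewrite /hecke_coef; case: ifP => [/dvdnP[l lE]|]; last by rewrite mul0r mulr0.
  by have := hk l; rewrite lE mulnC eqxx.
apply: (has_sum_ext _ H2) => l; rewrite /F /hecke_coef dvdn_mulr // dvdn_mulr //.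
by rewrite !mulKn.
Qed.

Definition hecke_seq (om : nat -> C) n (u : nat -> C) k : C :=
  \sum_(d <- divisors n) om d * d%:R * hecke_coef (n %/ d) d u k.

Lemma qs_sum (I : Type) (r : seq I) (c : I -> nat -> C) :
  (forall t, qs (c t)) -> qs (fun k => \sum_(t <- r) c t k).
Proof.
move=> h; elim: r => [|t r IH].
  by apply: (@qs_ext _ (cst1 0)); [move=> k; rewrite big_nil /cst1; case: ifP | exact: qs_cst1].
by apply: (@qs_ext _ (fun k => c t k + \sum_(t <- r) c t k)); [move=> k; rewrite big_cons | exact: qsD].
Qed.

(** Orthogonality also acts on the polar term: the sum over b of the translates of [q^-1] vanishes
    unless d = 1, where it gives [q^-n]. *)
Lemma lq_hecke (om : nat -> C) n A u f : (0 < n)%N -> qs u ->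
  (forall z, 0 < complex.Im z -> f z = A * (e z)^-1 + qv u z) ->
  lq n (fun k => cst1 (om 1%N * A) k + shq n (hecke_seq om n u) k) (hecke_sum om n f).
Proof.
move=> n0 qu hf.
have qterm d : (d \in divisors n) ->
    qs (fun k => om d * d%:R * hecke_coef (n %/ d) d u k).
  rewrite -dvdn_divisors // => dn; apply: qsZ; apply: qs_hecke_coef => //.
    by rewrite divn_gt0 ?(dvdn_leq _ dn) // (dvdn_gt0 _ dn).
  exact: dvdn_gt0 dn.
have qh : qs (hecke_seq om n u).
  apply: (@qs_ext _ (fun k => \sum_(d <- divisors n) if d \in divisors n then om d * d%:R * hecke_coef (n %/ d) d u k else 0)).
    by move=> k; rewrite big_seq [RHS]big_seq; apply: eq_bigr => d ->.
  apply: qs_sum => d; case: (boolP (d \in divisors n)) => hd; first exact: qterm.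
  by apply: (@qs_ext _ (cst1 0)); [move=> k; rewrite /cst1; case: ifP | exact: qs_cst1].
split=> [|z y0]; first by apply: qsD; [exact: qs_cst1 | exact: qs_sh].
rewrite qvD ?qv_cst1 ?qv_sh //; [| exact: qs_cst1 | exact: qs_sh].
have en : e z ^+ n != 0 by rewrite expf_neq0 // e_neq0.
suff H : hecke_sum om n f z = om 1%N * A * e z ^- n + qv (hecke_seq om n u) z.
  by rewrite H mulrDl mulfVK // [qv _ z * _]mulrC.
have step d : d \in divisors n ->
    om d * \sum_(b < d) f (((n %/ d)%:R * z + b%:R) / d%:R) =
    (if d == 1%N then om 1%N * A * e z ^- n else 0) +
    om d * d%:R * qv (hecke_coef (n %/ d) d u) z.
  rewrite -dvdn_divisors // => dn; have d0 := dvdn_gt0 n0 dn.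
  have a0 : (0 < n %/ d)%N by rewrite divn_gt0 ?(dvdn_leq _ dn).
  have d0' : (d%:R : C) != 0 by rewrite pnatr_eq0 -lt0n.
  have yw (b : nat) : 0 < complex.Im (((n %/ d)%:R * z + b%:R) / d%:R).
    by rewrite Im_affine divr_gt0 ?mulr_gt0 ?ltr0n.
  rewrite (eq_bigr _ (fun (b : 'I_d) _ => hf _ (yw b))) big_split /= sum_hecke_qv // mulrDr mulrA.
  congr (_ + _); rewrite -mulr_sumr mulrA.
  (* Modulo integers, [- b / d] is [(d - 1) b / d], the form with natural numbers that [sum_e_orth]
     expects. *)
  have E (b : 'I_d) : (e (((n %/ d)%:R * z + b%:R) / d%:R))^-1 =
      e (- ((n %/ d)%:R * z + d%:R) / d%:R) * e (d.-1%:R * b%:R / d%:R).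
    rewrite -eN -eD -[RHS](eDint _ (1 - b%:Z)); congr e.
    have -> : (d.-1%:R : C) = d%:R - 1 by rewrite -[in RHS](prednK d0) -natr1 addrK.
    by rewrite rmorphB /= -![(Posz _)%:~R]/(_%:R); field.
  rewrite (eq_bigr _ (fun b _ => E b)) -mulr_sumr sum_e_orth //.
  have -> : (d %| d.-1)%N = (d == 1%N).
    case: d d0 {dn a0 d0' yw E} => // -[|d] _ //=.
    by apply/negbTE; rewrite gtnNdvd.
  case: eqP => [->|_]; last by rewrite !mulr0.
  by rewrite divn1 divr1 mulr1 opprD eD !eN e_natM e1 invr1 mulr1.
rewrite /hecke_sum big_seq (eq_bigr _ step) big_split /= -!big_seq; congr (_ + _).
  rewrite (bigD1_seq 1%N) ?divisors_uniq //= ?big1 ?addr0 //; last by rewrite -dvdn_divisors.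
  by move=> d /negbTE ->.
rewrite /qv /hecke_seq; apply/esym/csumE.
have H : forall d, has_sum (fun k => if d \in divisors n then om d * d%:R * hecke_coef (n %/ d) d u k * e z ^+ k else 0)
    (if d \in divisors n then om d * d%:R * qv (hecke_coef (n %/ d) d u) z else 0).
  move=> d; case: (boolP (d \in divisors n)) => hd; last exact: has_sum0.
  move: (hd); rewrite -dvdn_divisors // => dn.
  have qd : qs (hecke_coef (n %/ d) d u).
    by apply: qs_hecke_coef; rewrite ?divn_gt0 ?(dvdn_leq _ dn) // (dvdn_gt0 _ dn).
  apply: (has_sum_ext _ (has_sumZ (om d * d%:R) (qs_has_sum qd y0))) => k.
  by rewrite mulrA.
have -> : \sum_(d <- divisors n) om d * d%:R * qv (hecke_coef (n %/ d) d u) z =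
  \sum_(d <- divisors n) (if d \in divisors n then om d * d%:R * qv (hecke_coef (n %/ d) d u) z else 0).
  by rewrite big_seq [RHS]big_seq; apply: eq_bigr => d ->.
apply: (has_sum_ext _ (has_sum_sum (divisors n) H)) => k.
by rewrite mulr_suml big_seq [RHS]big_seq; apply: eq_bigr => d ->.
Qed.

End Hecke.

(** * The mock modular form *)

Section MockModular.
Variable R : realType.
Local Notation C := R[i].

(* Locked, as unification would otherwise compute the factorial in unary. *)
Definition fac11 : C := locked 11`!%:R.

Lemma fac11E : fac11 = 11`!%:R. Proof. by rewrite /fac11 -lock. Qed.

Definition M_const : C := locked (24 * 11`!%:R / B12 R).

Lemma M_constE : M_const = 24 * fac11 / B12 R. Proof. by rewrite /M_const fac11E -lock. Qed.

Implicit Types (z w : C).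
Opaque e.

Lemma cvs_real (u : nat -> R) (s : C) : cvs (fun n => (u n)%:C) s ->
  (lim (u n @[n --> \oo])%classic)%:C = s.
Proof.
move=> h; have hr : (u n @[n --> \oo] --> complex.Re s)%classic.
  apply/cvgrPdist_lt => eps e0; have [N hN] := h _ e0; exists N => // n /= /hN hn.
  apply: le_lt_trans hn; rewrite distrC; have := Re_le_nm ((u n)%:C - s).
  by rewrite cReD cReN.
have Im0 : complex.Im s = 0.
  apply: contrapT => /eqP; rewrite -normr_gt0 => h0.
  have [N hN] := h _ h0; have := hN N (leqnn N); apply/negP; rewrite -leNgt.
  by have := Im_le_nm ((u N)%:C - s); rewrite cImD cImN /= add0r normrN.
rewrite (cvg_lim (@Rhausdorff R) hr).
by case: s Im0 {h hr} => a b /= ->.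
Qed.

Lemma besselI_Bes (x : R) : 0 <= x ->
  (besselI 11 x)%:C = ((x / 2) ^+ 11)%:C * Bes ((x / 2) ^+ 2).
Proof.
move=> x0; have h0 : 0 <= (x / 2) ^+ 2 by exact: sqr_ge0.
rewrite /besselI; apply: cvs_real.
apply: (cvs_ext _ (has_sum_cvs (has_sumZ (((x / 2) ^+ 11)%:C) (has_sum_Bes h0)))).
exists 0%N => n _; rewrite big_mkord rmorph_sum /=; apply: eq_bigr => k _.
by rewrite -rmorphM /besc /= mulrA -exprM -exprD addnC.
Qed.

Lemma powR_half11 (n : nat) : (0 < n)%N ->
  n%:R `^ (- (11 / 2)) * Num.sqrt n%:R ^+ 11 = 1 :> R.
Proof.
move=> n0; rewrite powRN -powR_mulrn ?sqrtr_ge0 // -powR12_sqrt // -powRrM.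
rewrite [2^-1 * _]mulrC mulVf // gt_eqF // powR_gt0 // ltr0n //.
Qed.

(** A coefficientwise form of Bol's identity: [q d/dq] applied 11 times takes [M_Delta] to [- 11!]
    times the Poincare series of index -1. The same Kloosterman and Bessel factors occur in both,
    and the powers of [n] and [c] account for [kap]. *)
Lemma a_DeltaE n : (0 < n)%N ->
  a_Delta R n = - fac11 * (pcoef R 1 n / n%:R ^+ 11).
Proof.
move=> n0; have p0 := pi_gt0 R.
set s : R := Num.sqrt n%:R; have s0 : 0 <= s := sqrtr_ge0 _.
have s2 : s ^+ 2 = n%:R by rewrite sqr_sqrtr.
pose kap : C := (s ^+ 11)%:C / ((2 * pi)%:C * n%:R ^+ 11).
have nC : (n%:R : C) != 0 by rewrite pnatr_eq0 -lt0n.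
have pC : ((2 * pi : R)%:C : C) != 0.
  by rewrite -nm_gt0 nm_real normr_gt0 mulf_neq0 ?pnatr_eq0 // gt_eqF.
rewrite /a_Delta (lim_sum1 (has_sumZ kap (has_sum_pcoef 1 n))); last 2 first.
- by rewrite /pT eqxx mulr0.
- move=> c c0; have cC : (c%:R : C) != 0 by rewrite pnatr_eq0 -lt0n.
  have cR : (c%:R : R) != 0 by rewrite pnatr_eq0 -lt0n.
  have xE : 4 * pi * s / c%:R / 2 = (2 * pi) * s / c%:R :> R by field.
  have x0 : 0 <= 4 * pi * s / c%:R by rewrite divr_ge0 // mulr_ge0 // mulr_ge0 // ltW.
  rewrite besselI_Bes // xE /pT gtn_eqF // /lipB.
  have -> : (2 * pi * s / c%:R) ^+ 2 = (2 * pi) ^+ 2 * (1%:R / c%:R ^+ 2) * n%:R :> R.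
    by rewrite -s2; field.
  have -> : ((2 * pi * s / c%:R) ^+ 11)%:C = (2 * pi)%:C ^+ 11 * (s ^+ 11)%:C / c%:R ^+ 11 :> C.
    by rewrite expr_div_n exprMn rmorphM /= fmorphV /= rmorphM /= !rmorphXn /= rmorph_nat.
  have -> : ((2 * pi) ^+ 12)%:C = (2 * pi)%:C ^+ 12 :> C by rewrite rmorphXn.
  rewrite /kap; move: (Bes _) (kloosterman _ _ _ _) ((s ^+ 11)%:C) => B K t.
  move: ((2 * pi)%:C) pC (n%:R : C) nC (c%:R : C) cC => x x1 y y1 w w1.
  by field; rewrite ?x1 ?y1 ?w1.
have hp := powR_half11 n0; rewrite -/s in hp.
have -> : ((- (2 * pi * 11`!%:R * n%:R `^ (- (11 / 2))))%:C : C) =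
   - (fac11 * (2 * pi)%:C * (n%:R `^ (- (11 / 2)))%:C).
  rewrite fac11E -(rmorph_nat (real_complex R) 11`!).
  move: (11`!%:R) (n%:R `^ _) (2 * pi) => a b c; rewrite -!rmorphM -rmorphN.
  by congr (_%:C); rewrite [c * a]mulrC.
have {}hp : ((n%:R `^ (- (11 / 2)))%:C * (s ^+ 11)%:C : C) = 1 by rewrite -rmorphM hp.
rewrite /kap; move: (pcoef R 1 n) ((n%:R `^ _)%:C) ((s ^+ 11)%:C) hp ((2 * pi)%:C) pC.
move: fac11 => f p x y hp w w0.
transitivity (- f * (x * y) * (p / n%:R ^+ 11)); last by rewrite hp mulr1.
by field; rewrite nC w0.
Qed.

Definition M_coef (n : nat) : C :=
  cst1 (M_const) n + (- fac11) * (pcoef R 1 n / n%:R ^+ 11).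

Lemma qs_M_coef : qs M_coef.
Proof.
apply: qsD; first exact: qs_cst1.
apply: qsZ => r hr; apply: (summ_le (@qs_pcoef R 1 r hr)) => n.
have r0 : 0 <= r by case/andP: hr.
rewrite mulr_ge0 ?nm_ge0 ?exprn_ge0 //=; apply: ler_wpM2r; first exact: exprn_ge0.
rewrite nmM nmV nmX nm_nat -[leRHS]mulr1; apply: ler_wpM2l; first exact: nm_ge0.
case: n => [|n]; first by rewrite expr0n /= invr0.
by rewrite invf_le1 ?exprn_gt0 ?ltr0n // exprn_ege1 // ler1n.
Qed.

Lemma M_coef_gt0 n : (0 < n)%N -> M_coef n = - fac11 * (pcoef R 1 n / n%:R ^+ 11).
Proof. by case: n => // n _; rewrite /M_coef /cst1 /= add0r. Qed.

Lemma M_coef0 : M_coef 0 = M_const.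
Proof. by rewrite /M_coef pcoef0 mul0r mulr0 addr0. Qed.

Lemma M_DeltaE z : 0 < complex.Im z -> M_Delta z = fac11 * (e z)^-1 + qv M_coef z.
Proof.
move=> y0; rewrite /M_Delta -fac11E -M_constE -addrA; congr (_ + _).
have h0 : has_sum (fun n => cst1 (M_const) n * e z ^+ n) (M_const).
  have := @has_sum1 R _ (fun n => cst1 (M_const) n * e z ^+ n) 0%N.
  by rewrite /cst1 eqxx expr0 mulr1; apply=> n /negbTE ->; rewrite mul0r.
rewrite (lim_sum1 (has_sumB (qs_has_sum qs_M_coef y0) h0)).
- by rewrite addrC subrK.
- by rewrite M_coef0 /cst1 eqxx subrr.
by move=> n n0; rewrite a_DeltaE // M_coef_gt0 // /cst1 gtn_eqF // mul0r subr0.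
Qed.

Lemma divn_divn n d : (0 < n)%N -> (d %| n)%N -> (n %/ (n %/ d) = d)%N.
Proof. by move=> n0 dn; rewrite divnA // mulKn. Qed.

Lemma divisors_rev n : (0 < n)%N -> perm_eq [seq n %/ d | d <- divisors n]%N (divisors n).
Proof.
move=> n0; have inj : {in divisors n &, injective (fun d => n %/ d)%N}.
  move=> x y; rewrite -!dvdn_divisors // => hx hy h.
  by rewrite -(divn_divn n0 hx) h divn_divn.
apply: uniq_perm; rewrite ?map_inj_in_uniq ?divisors_uniq // => x.
rewrite -dvdn_divisors //; apply/mapP/idP => [[d]|hx].
  by rewrite -dvdn_divisors // => hd ->; apply: dvdn_div.
exists (n %/ x)%N; first by rewrite -dvdn_divisors // dvdn_div.
by rewrite divn_divn.
Qed.

Lemma hecke_seq_gcd om n u k : (0 < n)%N -> (0 < k)%N -> hecke_seq om n u k =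
  \sum_(g <- divisors (gcdn n k)) om (n %/ g)%N * (n %/ g)%:R * u ((n %/ g) * (k %/ g))%N :> C.
Proof.
move=> n0 k0.
pose G g : C := om (n %/ g)%N * (n %/ g)%:R *
   (if (g %| k)%N then u ((n %/ g) * (k %/ g))%N else 0).
transitivity (\sum_(d <- divisors n) G (n %/ d)%N).
  rewrite /hecke_seq big_seq [RHS]big_seq; apply: eq_bigr => d; rewrite -dvdn_divisors // => dn.
  by rewrite /G /hecke_coef divn_divn.
rewrite -(big_map (fun d => n %/ d)%N xpredT G) (perm_big _ (divisors_rev n0)) /=.
rewrite (bigID (fun g => g %| k)%N) /= [X in _ + X]big1 ?addr0; last first.
  by move=> g /negbTE hg; rewrite /G hg mulr0.
rewrite -big_filter (perm_big (divisors (gcdn n k))) /=.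
  rewrite big_seq [RHS]big_seq; apply: eq_bigr => g.
  by rewrite -dvdn_divisors ?gcdn_gt0 ?n0 // dvdn_gcd /G => /andP[_ ->].
apply: uniq_perm; rewrite ?filter_uniq ?divisors_uniq // => g.
by rewrite mem_filter -!dvdn_divisors ?gcdn_gt0 ?n0 // dvdn_gcd andbC.
Qed.

(** The symmetry behind the theorem. Both sides are sums over the common divisors g of
    [pcoef R 1 (m k / g^2)]: the weights [d^10 d] on the left, divided by [(m k / g^2)^11], and
    [d^-12 d] on the right both leave the factor [(k / g)^-11]. *)
Lemma hecke_M_seq m k : (0 < m)%N -> (0 < k)%N ->
  hecke_seq (fun d => d%:R ^+ 10) m M_coef k =
  - fac11 * hecke_seq (fun d => d%:R ^- 12) k (pcoef R 1) m.
Proof.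
move=> m0 k0; rewrite !hecke_seq_gcd // gcdnC mulr_sumr big_seq [RHS]big_seq.
apply: eq_bigr => g; rewrite -dvdn_divisors ?gcdn_gt0 ?k0 // dvdn_gcd => /andP[gk gm].
have g0 : (0 < g)%N := dvdn_gt0 k0 gk.
have a0 : (0 < m %/ g)%N by rewrite divn_gt0 // dvdn_leq.
have b0 : (0 < k %/ g)%N by rewrite divn_gt0 // dvdn_leq.
rewrite M_coef_gt0 ?muln_gt0 ?a0 // [(k %/ g * _)%N]mulnC natrM.
have aC : ((m %/ g)%:R : C) != 0 by rewrite pnatr_eq0 -lt0n.
have bC : ((k %/ g)%:R : C) != 0 by rewrite pnatr_eq0 -lt0n.
move: (pcoef R 1 _) ((m %/ g)%:R : C) aC ((k %/ g)%:R : C) bC fac11 => p x x0 y y0 f.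
by field; rewrite x0 y0.
Qed.

Lemma hecke_M_seq0 m : hecke_seq (fun d => d%:R ^+ 10) m M_coef 0 =
  (sigma 11 m)%:R * (M_const).
Proof.
rewrite -M_coef0 /hecke_seq /sigma natr_sum mulr_suml; apply: eq_bigr => d _.
by rewrite /hecke_coef dvdn0 div0n muln0 natrX [in RHS]exprSr.
Qed.

(** The factor [m^11] is the inverse of the normalisation [m^(k-1)] for k = -10. *)
Lemma lq_hecke_M m : (0 < m)%N ->
  lq m (fun k => cst1 fac11 k + shq m (hecke_seq (fun d => d%:R ^+ 10) m M_coef) k)
    (fun z => m%:R ^+ 11 * hecke (-10) m (@M_Delta R) z).
Proof.
move=> m0; apply: (lq_ext _ _ (lq_hecke (fun d => d%:R ^+ 10) m0 qs_M_coef M_DeltaE)).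
  by move=> k; rewrite expr1n mul1r.
move=> z y0; rewrite /hecke mulrA.
have mC : (m%:R : C) != 0 by rewrite pnatr_eq0 -lt0n.
have -> : (-10 - 1 : int) = - 11%:Z by [].
rewrite -exprnN mulfV ?expf_neq0 // mul1r; apply: eq_bigr => d _.
by have -> : (-10 : int) = - 10%:Z by []; rewrite -exprnN invrK.
Qed.

Lemma lq_M_Delta : lq 1 (fun k => cst1 fac11 k + shq 1 M_coef k) (@M_Delta R).
Proof.
split=> [|z y0]; first by apply: qsD; [exact: qs_cst1 | apply: qs_sh; exact: qs_M_coef].
rewrite M_DeltaE // (qvD (@qs_cst1 _ _) (qs_sh 1 qs_M_coef) y0) qv_cst1.
rewrite (qv_sh 1 qs_M_coef y0) expr1.
by rewrite mulrDl mulfVK ?e_neq0 // [qv _ z * _]mulrC.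
Qed.

End MockModular.

(** * The polynomials [psi m] *)

Section Psi.
Variable R : realType.
Local Notation C := R[i].
Implicit Types (z w : C) (c : nat -> C) (f : C -> C).
Opaque e.

(** [f] is, up to the constant [c N], the primitive of its termwise derivative, so
    [prim_second_order] applies. *)
Lemma lq_derivative N c f : lq N c f -> exists f' : C -> C, forall z, 0 < complex.Im z ->
  exists2 K : R, 0 <= K & forall w, nm (w - z) <= complex.Im z / 2 ->
    nm (f w - f z - f' z * (w - z)) <= K * nm (w - z) ^+ 2.
Proof.
move=> [hc hf].
pose c' n : C := twopii R * (n%:R - N%:R) * c n.
have qc' : qs c'.
  apply: (@qs_ext _ (fun n => twopii R * (n%:R * c n) + (- (twopii R * N%:R)) * c n)).
    by move=> n; rewrite /c'; ring.
  by apply: qsD; apply: qsZ => //; exact: qs_natM.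
pose f' w := e w ^- N * qv c' w.
have lf' : lq N c' f'.
  by split=> // z y0; rewrite /f' mulrAC mulVf ?mul1r // expf_neq0 // e_neq0.
have c'N : c' N = 0 by rewrite /c' subrr mulr0 mul0r.
have fE w : 0 < complex.Im w -> f w = prim N c' w + c N.
  move=> y0; have en : e w ^+ N != 0 by rewrite expf_neq0 // e_neq0.
  apply: (mulIf en); rewrite hf // /prim c'N mul0r addr0 mulrDl mulrAC mulVf // mul1r.
  have qk := qs_cst1 (c N); rewrite mulrC -[c N](qv_cst1 _ w) -(qv_sh N qk y0).
  rewrite -qvD //; [|exact: qs_primc|exact: qs_sh].
  congr (qv _ w); apply/funext => n; rewrite /primc /shq /cst1 subn_eq0 /c'.
  have [->|nN] := eqVneq n N; first by rewrite ltnn leqnn add0r.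
  have := natB_neq0 R nN; have := twopii_neq0 R => h1 h2.
  case: ltngtP nN => // nN _; rewrite addr0 mulrC mulKf // mulf_neq0 //.
exists f' => z y0; have y1 : 0 < complex.Im z / 2 by rewrite divr_gt0.
have [K K0 hK] := prim_second_order (2 * complex.Im z) y1 lf'.
exists K => // w hw; have := Im_le_nm (w - z); rewrite cImD cImN => h1.
have h2 : `|complex.Im w - complex.Im z| <= complex.Im z / 2 by exact: le_trans hw.
move: h2; rewrite ler_norml => /andP[h2 h3].
have [] := hK z w; [by apply/andP; split; lra | by apply/andP; split; lra |].
move=> _; rewrite !fE //; last by lra.
by rewrite (_ : prim N c' w + c N - (prim N c' z + c N) = prim N c' w - prim N c' z) //; ring.
Qed.

Lemma lq_derivable N c f z : lq N c f -> 0 < complex.Im z -> derivable f z 1.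
Proof.
move=> hl y0; have [f' hf'] := lq_derivative hl; have [K K0 hK] := hf' z y0.
apply: (cvgP (f' z)); apply/cvgrPdist_lt => eps; case: eps => e1 e2.
rewrite ltcE /= => /andP[/eqP e20 e10]; rewrite e20.
have K1 : 0 < K + 1 by lra.
pose d : R := Num.min (complex.Im z / 2) (e1 / (K + 1)).
have d0 : 0 < d by rewrite lt_min !divr_gt0.
rewrite near_withinE; apply/nbhs_ballP; exists d%:C; first by rewrite /= ltcR.
move=> h; rewrite -ball_normE /= sub0r normrN normE ltcR => hd h0.
have hE : h *: (1 : C) + z - z = h by rewrite addrK -[_ *: _]/(h * 1) mulr1.
have := hK (h *: (1 : C) + z); rewrite hE => hw.
have nh : 0 < nm h by rewrite nm_gt0.
rewrite normE -[_ +i* 0]/(e1%:C) ltcR.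
rewrite -[_ *: (f _ - f z)]/(h^-1 * (f (h *: (1 : C) + z) - f z)).
have -> : f' z - h^-1 * (f (h *: (1 : C) + z) - f z) =
   - (h^-1 * (f (h *: (1 : C) + z) - f z - f' z * h)) by field.
rewrite nmN nmM nmV ltr_pdivrMl //.
have h1 : nm h <= complex.Im z / 2 by apply: ltW; apply: lt_le_trans hd _; rewrite ge_min lexx.
have h2 : nm h * (K + 1) < e1 by rewrite -ltr_pdivlMr //; apply: lt_le_trans hd _; rewrite ge_min lexx orbT.
apply: (le_lt_trans (hw h1)); move: (nm h) nh h2 => x x0 h2; nra.
Qed.

Lemma lq_unsh N c f : lq N.+1 c f -> c 0%N = 0 -> lq N (fun n => c n.+1) f.
Proof.
move=> [qc hf] c0.
have qc' : qs (fun n => c n.+1).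
  apply: qs_bounded => r hr; have /andP[r0 r1] := hr.
  have [_ [K hK]] := qc r (introT andP (conj (ltW r0) r1)).
  exists (K / r) => n; rewrite ler_pdivlMr // -mulrA -exprSr.
  by have := hK [:: n.+1] isT; rewrite big_seq1.
split=> // z y0; apply: (mulIf (e_neq0 z)); rewrite -mulrA -exprSr hf //.
have := qv_sh 1 qc' y0; rewrite expr1 mulrC => <-; congr (qv _ z).
by apply/funext => -[|n]; rewrite /shq /= ?c0 // subn1.
Qed.

Lemma lq_sum_nat N (a b : nat) (c : nat -> nat -> C) (f : nat -> C -> C) :
  (forall l, (a <= l < b)%N -> lq N (c l) (f l)) ->
  lq N (fun k => \sum_(a <= l < b) c l k) (fun z => \sum_(a <= l < b) f l z).
Proof.
elim: b => [|b IH] h.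
  split=> [|z y0]; last rewrite big_geq // mul0r.
    by apply: (@qs_ext _ (cst1 0)) (qs_cst1 0) => k; rewrite big_geq // /cst1; case: ifP.
  rewrite -[LHS](qv_cst1 0 z); congr (qv _ z); apply/funext => k.
  by rewrite big_geq // /cst1; case: ifP.
have [ab|ab] := leqP a b; last first.
  have E (V : nmodType) (F : nat -> V) : \sum_(a <= l < b.+1) F l = \sum_(a <= l < b) F l.
    by rewrite !big_geq // ltnW.
  apply: (lq_ext _ _ (IH _)) => [k|z _|l /andP[al lb]]; rewrite ?E //.
  by apply: h; rewrite al ltnW.
have {}IH := IH (fun l hl => h l (introT andP (conj (proj1 (andP hl)) (ltnW (proj2 (andP hl)))))).
apply: (lq_ext _ _ (lqD IH (h b _))) => [k|z _|]; rewrite ?big_nat_recr //=.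
by rewrite ab ltnSn.
Qed.

Lemma il_jX k : exists2 a, il k a (fun z : C => j z ^+ k) & a 0%N = 1.
Proof.
elim: k => [|k [a ha a0]].
  by exists (cst1 1) => //; apply: (il_ext _ _ (il_cst R 1)) => // z _; rewrite expr0.
exists (conv jc a); last by rewrite conv0 a0 jc0.
by apply: (il_ext _ _ (ilM (@il_j R) ha)) => // z _; rewrite exprS.
Qed.

(** A triangular system: [j ^+ N * f] starts with coefficient 1 at its lowest power of q, so [b 0]
    times the top power is split off and the remaining coefficients are prescribed in lower degree.
    All pivots are 1, hence integrality. *)
Lemma poly_principal_part s h f : il s h f -> h 0%N = 1 ->
  forall N (b : nat -> int), exists P : {poly int},
  [/\ (size P <= N.+1)%N, P`_N = b 0%N & exists2 a,
    il (N + s) a (fun z => f z * (map_poly intr P).[j z]) & forall k, (k <= N)%N -> a k = b k].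
Proof.
move=> hf h0; elim=> [|N IH] b.
  exists (b 0%N)%:P; split; [exact: size_polyC_leq1 | by rewrite coefC |].
  exists (fun k => b 0%N * h k) => [|k]; last by rewrite leqn0 => /eqP ->; rewrite h0 mulr1.
  by apply: (il_ext _ _ (ilZ (b 0%N) hf)) => // z _; rewrite map_polyC hornerC mulrC.
have [c0 hc c00] := il_jX N.+1; pose c := conv c0 h.
have ilc : il (N.+1 + s) c (fun z => j z ^+ N.+1 * f z) by exact: ilM.
have c1 : c 0%N = 1 by rewrite /c conv0 c00 h0.
have [P [sP PN [a ha hab]]] := IH (fun k => b k.+1 - b 0%N * c k.+1).
exists (P + b 0%N *: 'X^(N.+1)); split.
- apply: (leq_trans (size_polyD _ _)); rewrite geq_max (leq_trans sP) //=.
  by apply: (leq_trans (size_scale_leq _ _)); rewrite size_polyXn.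
- by rewrite coefD coefZ coefXn eqxx mulr1 nth_default ?add0r.
exists (fun k => shq 1 a k + b 0%N * c k).
  apply: (il_ext _ _ (ilD (il_sh 1 ha) (ilZ (b 0%N) ilc))) => // z _.
  rewrite rmorphD /= map_polyZ map_polyXn /= hornerD hornerZ hornerXn mulrDr.
  by move: (map_poly _ _).[_] ((b 0%N)%:~R : C) (f z) (j z ^+ N.+1) => x y t v; ring.
move=> [|k] kN; first by rewrite /shq /= add0r c1 mulr1.
by rewrite /shq /= subn1 hab // subrK.
Qed.

Lemma lq_polyj (Q : {poly C}) N : (size Q <= N.+1)%N ->
  exists2 c, lq N c (fun z => Q.[j z]) & c 0%N = Q`_N.
Proof.
elim/poly_ind: Q N => [|P k IH] N.
  exists (fun=> 0); last by rewrite coef0.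
  have h := lq_sh N (lq_cst (0 : C)); rewrite addn0 in h.
  apply: (lq_ext _ _ h) => [n|z _]; last by rewrite horner0.
  by rewrite /shq /cst1; case: ifP => //; case: ifP.
case: N => [|N] sQ.
  have -> : P * 'X + k%:P = k%:P.
    have := size1_polyC sQ; rewrite coefD coefMX coefC eqxx /= add0r => {1}-> //.
  exists (cst1 k); last by rewrite coefC.
  by apply: (lq_ext _ _ (lq_cst k)) => // z _; rewrite hornerC.
have sP : (size P <= N.+1)%N.
  by move: sQ; rewrite size_MXaddC; case: ifP => // /andP[/eqP-> _]; rewrite size_poly0.
have [c hc c0] := IH N sP.
have hj : lq 1 (fun n => (jc n)%:~R) (@j R) := @il_j R.
have h1 := lqM hc hj; have h2 := lq_sh N.+1 (lq_cst k); rewrite addn1 in h1; rewrite addn0 in h2.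
exists (fun n => conv c (fun n => (jc n)%:~R) n + shq N.+1 (cst1 k) n); last first.
  by rewrite conv0 jc0 mulr1 c0 /shq /= addr0 coefD coefMX coefC /= addr0.
by apply: (lq_ext _ _ (lqD h1 h2)) => // z _; rewrite hornerMXaddC.
Qed.

(** The coefficient of [P.[j z]] at the lowest power of q is the leading coefficient of P. *)
Lemma polyj_eq0 (Q : {poly C}) : (forall z, 0 < complex.Im z -> Q.[j z] = 0) -> Q = 0.
Proof.
move=> h; apply/eqP; rewrite -lead_coef_eq0 lead_coefE.
have [c hc c0] := lq_polyj (leqSpred (size Q)).
have hz := lq_sh (size Q).-1 (lq_cst (0 : C)); rewrite addn0 in hz.
have hz' : lq (size Q).-1 (shq (size Q).-1 (cst1 0)) (fun z => Q.[j z]).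
  by apply: (lq_ext _ _ hz) => // z y0; rewrite h.
rewrite -c0 (lq_inj hc hz' 0) /shq /cst1; by case: ifP => //; case: ifP.
Qed.

Lemma polyj_inj (P Q : {poly C}) :
  (forall z, 0 < complex.Im z -> P.[j z] = Q.[j z]) -> P = Q.
Proof.
move=> h; apply/eqP; rewrite -subr_eq0; apply/eqP; apply: polyj_eq0 => z y0.
by rewrite hornerD hornerN h // subrr.
Qed.

(** The difference is an invariant function without polar and constant terms, and
    [modular_liouville] makes it vanish. *)
Lemma polyj_principal N c d (P Q : {poly C}) :
  lq N c (fun z => P.[j z]) -> lq N d (fun z => Q.[j z]) ->
  (forall k, (k <= N)%N -> c k = d k) -> P = Q.
Proof.
move=> hc hd cd; apply: polyj_inj => z y0; apply/eqP; rewrite -subr_eq0; apply/eqP.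
pose D z : C := P.[j z] - Q.[j z]; pose u k := c k + (-1) * d k.
have hD : lq N u D.
  by apply: (lq_ext _ _ (lqD hc (lqZ (-1) hd))) => // w _; rewrite /D mulN1r.
have u0 k : (k <= N)%N -> u k = 0 by move=> kN; rewrite /u cd // mulN1r subrr.
have {}hD k : (k <= N)%N -> lq (N - k) (fun n => u (k + n)%N) D.
  elim: k => [|k IH] kN; first by rewrite subn0.
  have := IH (ltnW kN); rewrite (_ : (N - k = (N - k.+1).+1)%N); last by rewrite subnSK.
  have uk : u (k + 0)%N = 0 by rewrite addn0 u0 // ltnW.
  by move=> h; apply: (lq_ext _ _ (lq_unsh h uk)) => // n; rewrite addnS addSn.
have := hD N (leqnn N); rewrite subnn => h.
refine (@modular_liouville R _ D h _ _ z y0); first by rewrite addn0 u0.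
by move=> a b c' d' w hdet yw; rewrite /D j_invariant.
Qed.

Lemma is_j_fun_poly m (P : {poly int}) a : (0 < m)%N ->
  il m a (fun z : C => (map_poly intr P).[j z]) -> a 0%N = 1 ->
  (forall k, (0 < k <= m)%N -> a k = 0) -> is_j_fun m (fun z : C => (map_poly intr P).[j z]).
Proof.
move=> m0 ha a0 ak; split.
- by move=> z y0; apply: (lq_derivable ha).
- by move=> x b c d hd z y0; rewrite -[_ / _]/(moeb x b c d z) j_invariant.
exists (fun n => (a (m + n)%N)%:~R) => z y0; apply/cvs_cvg.
have [qa hf] := ha; have en : e z ^+ m != 0 by rewrite expf_neq0 // e_neq0.
have hs := has_sum_cvs (has_sumZ (e z ^- m) (qs_has_sum qa y0)).
have -> : (map_poly intr P).[j z] = e z ^- m * qv (fun n => (a n)%:~R) z.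
  by rewrite -hf // mulrC mulfK.
have hN : forall n, (n <= n + m)%N by move=> n; rewrite leq_addr.
apply: (cvs_ext _ (cvs_subseq hN hs)); exists 1%N => n n1.
rewrite addnC big_split_ord /= -(big_mkord xpredT (fun t => e z ^- m * ((a t)%:~R * e z ^+ t))).
rewrite big_ltn // a0 expr0 !mulr1 big_nat big1 ?addr0; last first.
  by move=> k /andP[k0 km]; rewrite ak ?k0 ?(ltnW km) // mul0r mulr0.
congr (_ + _).
rewrite -(big_mkord xpredT (fun t => e z ^- m * ((a (m + t)%N)%:~R * e z ^+ (m + t)))).
rewrite big_ltn // addn0 ak ?m0 ?leqnn // mul0r mulr0 add0r; apply: eq_bigr => k _.
rewrite exprD; move: (e z ^+ m) en ((a (m + k)%N)%:~R : C) (e z ^+ k) => x x0 y t.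
by field.
Qed.

(** [is_j_fun] grants only convergence of the partial sums at each point. Their differences, the
    terms, are therefore bounded at every radius; this gives absolute convergence, and
    [modular_liouville] applies to the difference of the two functions. *)
Lemma is_j_fun_uniq m f g : is_j_fun m f -> is_j_fun m g ->
  forall z, 0 < complex.Im z -> f z = g z.
Proof.
move=> [_ If [c hc]] [_ Ig [d hd]] z y0; apply/eqP; rewrite -subr_eq0; apply/eqP.
pose u n : C := if n == 0%N then 0 else c n - d n.
have hu w : 0 < complex.Im w -> cvs (fun N => \sum_(n < N) u n * e w ^+ n) (f w - g w).
  move=> yw; have h1 := (cvs_cvg _ _).2 (hc w yw); have h2 := (cvs_cvg _ _).2 (hd w yw).
  apply: (cvs_ext _ (cvsB h1 h2)); exists 1%N => N N1.
  rewrite -(big_mkord xpredT (fun n => u n * e w ^+ n)) big_ltn // /u eqxx mul0r add0r.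
  rewrite opprD addrACA subrr add0r -sumrB.
  apply: eq_big_nat => n /andP[n0 _].
  by rewrite gtn_eqF // mulrBl.
have qu : qs u.
  apply: qs_bounded => r /andP[r0 r1].
  have rn : nm (r%:C : C) = r by rewrite nm_real ger0_norm // ltW.
  have rC : r%:C != 0 :> C by rewrite -nm_gt0 rn.
  have [|w yw hw] := e_surj rC; first by rewrite rn.
  have h := hu w yw.
  have [N hN] := h 1 ltr01.
  pose M := \sum_(n < N) nm (u n) * r ^+ n.
  exists (M + 2) => n; have t0 k : 0 <= nm (u k) * r ^+ k by rewrite mulr_ge0 ?nm_ge0 ?exprn_ge0 ?ltW.
  have M0 : 0 <= M by apply: sumr_ge0.
  have [nN|nN] := ltnP n N.
    apply: (@le_trans _ _ M); last by lra.
    by rewrite /M (bigD1 (Ordinal nN)) //= lerDl; apply: sumr_ge0.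
  have k1 := hN n nN; have k2 := hN n.+1 (leqW nN).
  have -> : nm (u n) * r ^+ n = nm (u n * e w ^+ n) by rewrite nmM nmX hw rn.
  have -> : u n * e w ^+ n = (\sum_(i < n.+1) u i * e w ^+ i - (f w - g w)) -
      (\sum_(i < n) u i * e w ^+ i - (f w - g w)) by rewrite big_ord_recr /=; ring.
  apply: (le_trans (nmB _ _)); lra.
have hl : lq 0 u (fun z => f z - g z).
  split=> // w yw; rewrite expr0 mulr1; apply: cvs_uniq (hu w yw) _.
  exact: has_sum_cvs (qs_has_sum qu yw).
apply: (modular_liouville hl) => // a b c' d' w hdet yw.
by rewrite -(If a b c' d' hdet w yw) -(Ig a b c' d' hdet w yw).
Qed.

(** An integral polynomial in j with the required principal part shows that both choices, of [j_fun]
    and of [psi], are from nonempty sets; uniqueness transfers its expansion to [psi]. *)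
Lemma psi_principal m : (0 < m)%N -> exists2 a : nat -> int,
  il m a (fun z : C => (psi R m).[j z]) &
  forall k, (k <= m)%N -> a k = (k == 0%N)%:Z.
Proof.
move=> m0; have [P [_ _ [a ha ak]]] := poly_principal_part (il_cst R 1) erefl m (fun k => (k == 0%N)%:Z).
have {}ha : il m a (fun z : C => (map_poly intr P).[j z]).
  by rewrite addn0 in ha; apply: (il_ext _ _ ha) => // z _; rewrite mul1r.
have hJ := is_j_fun_poly m0 ha (ak 0%N isT) _.
have {}hJ : is_j_fun m (fun z : C => (map_poly intr P).[j z]).
  by apply: hJ => k /andP[k0 km]; rewrite ak // gtn_eqF.
have jE z : 0 < complex.Im z -> j_fun m z = (map_poly intr P).[j z].
  rewrite /j_fun gtn_eqF //.
  have h := xgetPex (fun=> 0) (ex_intro [set f : C -> C | is_j_fun m f]%classic _ hJ).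
  exact: is_j_fun_uniq h hJ z.
have hpsi : forall z, upper_half_plane z -> (psi R m).[j z] = j_fun m z.
  apply: (xgetPex (0 : {poly C}) (P := [set P : {poly C} | forall z, upper_half_plane z -> P.[j z] = j_fun m z]%classic)).
  by exists (map_poly intr P) => z y0; rewrite jE.
exists a => //; apply: (il_ext _ _ ha) => // z y0.
by rewrite hpsi // jE.
Qed.

End Psi.

(** * The polynomials [F m] *)

Section PrincipalParts.
Variable V : comPzRingType.
Implicit Types (g c : nat -> V).

Lemma conv_low g c k : g 0%N = 1 -> (forall t, (0 < t <= k)%N -> g t = 0) -> conv g c k = c k.
Proof.
move=> g0 gz; rewrite /conv big_ord_recl /= subn0 g0 mul1r big1 ?addr0 // => t _.
by rewrite gz ?mul0r //= /bump /= add1n ltn_ord.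
Qed.

Lemma conv_low1 g c k : (0 < k)%N -> g 0%N = 1 -> (forall t, (0 < t < k)%N -> g t = 0) ->
  conv g c k = c k + g k * c 0%N.
Proof.
case: k => // k _ g0 gz; rewrite /conv big_ord_recl /= big_ord_recr /= subn0 g0 mul1r.
rewrite big1 ?add0r; last first.
  by move=> t _; rewrite gz ?mul0r //= /bump /= add1n ltnS ltn_ord.
by rewrite /bump /= add1n subnn.
Qed.

Lemma conv_low2 g c k : (1 < k)%N -> g 0%N = 1 -> (forall t, (0 < t < k.-1)%N -> g t = 0) ->
  conv g c k = c k + g k.-1 * c 1%N + g k * c 0%N.
Proof.
case: k => [|[|k]] // _ g0 gz; rewrite /conv big_ord_recl /= !big_ord_recr /= subn0 g0 mul1r.
rewrite big1 ?add0r; last first.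
  by move=> t _; rewrite gz ?mul0r //= /bump /= add1n ltnS ltn_ord.
by rewrite /bump /= !add1n subnn subSn // subnn addrA.
Qed.

Lemma conv_shq g c m n : conv g (shq n c) (m + n)%N = conv g c m.
Proof.
rewrite /conv -(big_mkord xpredT (fun t => g t * shq n c (m + n - t)%N)).
rewrite (big_cat_nat (n := m.+1)) //=; last by rewrite ltnS leq_addr.
rewrite [X in _ + X]big_nat [X in _ + X]big1 ?addr0; last first.
  by move=> t /andP[mt tn]; rewrite /shq ifT ?mulr0 //; lia.
rewrite big_mkord; apply: eq_bigr => t _; congr (_ * _).
by have tm := ltn_ord t; rewrite /shq ifF; [congr c; lia | lia].
Qed.

End PrincipalParts.

(** * The form of weight -10 and its coefficients *)

Section Main.
Variable R : realType.
Local Notation C := R[i].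
Implicit Types (z w : C) (c : nat -> C).
Opaque e.

Lemma moebS z : moeb 0 (-1) 1 0 z = - z^-1.
Proof. by rewrite /moeb /cxd mul0r add0r mul1r addr0 mulN1r. Qed.

Lemma cxdS z : cxd 1 0 z = z. Proof. by rewrite /cxd mul1r addr0. Qed.

Lemma weight_S k (h : C -> C) :
  (forall (a b c d : int) z, a * d - b * c = 1 -> 0 < complex.Im z ->
     h (moeb a b c d z) = cxd c d z ^+ k * h z) ->
  forall z, 0 < complex.Im z -> h (- z^-1) = z ^+ k * h z.
Proof.
by move=> hh z y0; rewrite -moebS hh // cxdS.
Qed.

Lemma lq_phi p : lq 0 (fun n => cst1 (eisC R p) n + (sigz p n)%:~R) (@phi R p).
Proof. exact: lqD (lq_cst _) (il_sigq R p). Qed.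

(* The weight 10 cusp form [f = eisC 9 * E4 E6 - phi 9] vanishes: [f (f / Delta)^5]
   has weight 0 and no constant term. *)
Lemma E4E6_coef n : ((conv E4_coef E6_coef n)%:~R : C) = cst1 1 n - 264 * (sig 9 n)%:R.
Proof.
have hE : lq 0 (fun n => (conv E4_coef E6_coef n)%:~R) (fun z : C => E4 z * E6 z) := ilM (il_E4 R) (il_E6 R).
pose f z : C := eisC R 9 * (E4 z * E6 z) + (-1) * phi 9 z.
pose c n : C := eisC R 9 * (conv E4_coef E6_coef n)%:~R + (-1) * (cst1 (eisC R 9) n + (sigz 9 n)%:~R).
have hf : lq 0 c f := lqD (lqZ (eisC R 9) hE) (lqZ (-1) (lq_phi 9)).
have c0 : c 0%N = 0.
  by rewrite /c conv0 /sigz /sig /= addr0 mulr1 mulN1r subrr.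
have hD : lq 0 (fun k => conv c (fun n => (Dinv n)%:~R) k.+1) (fun z => f z / Delta z).
  by apply: lq_unsh; [exact: (lqM hf (il_Dinv R)) | rewrite conv0 c0 mul0r].
(* The weight is 10 + 5 (10 - 12) = 0, and [f / Delta] has no pole at the cusp because [c 0 = 0]. *)
have hD2 := lqM hD hD; have hD5 := lqM hf (lqM hD (lqM hD2 hD2)).
have fz z : 0 < complex.Im z -> f z = 0.
  move=> y0.
  have h : f z * (f z / Delta z * (f z / Delta z * (f z / Delta z) * (f z / Delta z * (f z / Delta z)))) = 0.
    apply: (modular_liouville hD5 _ _ y0); first by rewrite conv0 c0 mul0r.
    move=> a b c' d w hd yw; have N0 := cxd_neq0 yw (det_cd_neq0 hd).
    have fm : f (moeb a b c' d w) = cxd c' d w ^+ 10 * f w.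
      rewrite /f E4_modular // E6_modular // (@phi_modular R _ _ _ _ _ 9 hd yw) //.
      by move: (cxd c' d w) (E4 w) (E6 w) (phi 9 w) => x u v t; ring.
    have D0 := Delta_neq0 yw.
    rewrite fm Delta_modular //; move: (cxd c' d w) N0 (f w) (Delta w) D0 => x x0 u v v0.
    by field; rewrite x0 v0.
  have D0 := Delta_neq0 y0; apply/eqP; move/eqP: h.
  by rewrite !mulf_eq0 invr_eq0 (negPf D0) !orbF !orbb.
have cz k : c k = 0.
  have hz : lq 0 (cst1 0) f by apply: (lq_ext _ _ (lq_cst 0)) => // z y0; rewrite fz.
  by rewrite (lq_inj hf hz k) /cst1; case: ifP.
have s9 : sig 9 1 = 1%N by rewrite /sig /sigma unlock.
(* At q the coefficients of [E4 E6] and [phi 9] are -264 and 1; the vanishing of [f] thus yields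
   [eisC R 9] as well. *)
have e9 : eisC R 9 * - 264 = 1.
  have hc1 : ((conv E4_coef E6_coef 1)%:~R : C) = - 264.
    have -> : conv E4_coef E6_coef 1 = - 264 by rewrite conv1 !E4_coefE !E6_coefE /sigz !sig_val.
    by rewrite rmorphN /= rmorph_nat.
  have := cz 1%N; rewrite /c hc1 /sigz s9 /cst1 [1%N == 0%N]/= add0r mulN1r.
  by move=> /eqP; rewrite subr_eq0 => /eqP.
have := cz n; rewrite /c mulN1r => /eqP; rewrite subr_eq0 => /eqP h.
have -> : ((conv E4_coef E6_coef n)%:~R : C) = - 264 * (eisC R 9 * (conv E4_coef E6_coef n)%:~R).
  by rewrite mulrA [- 264 * _]mulrC e9 mul1r.
rewrite h mulrDr; congr (_ + _); last by rewrite mulNr.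
rewrite /cst1; case: ifP => _; last by rewrite mulr0.
by rewrite mulrC e9.
Qed.

(** Of weight 14 - 24 = -10, with a pole of order 2 at the cusp, and such that multiplication by
    [E4 E6] gives [j (j - 1728)]. *)
Definition Gbase z : C := E4 z ^+ 2 * E6 z / Delta z ^+ 2.

Lemma il_Gbase : exists2 h, il 2 h Gbase & h 0%N = 1.
Proof.
exists (conv (conv (conv E4_coef E4_coef) E6_coef) (conv Dinv Dinv)); last by rewrite !conv0 Dinv0.
apply: (il_ext _ _ (ilM (ilM (ilM (il_E4 R) (il_E4 R)) (il_E6 R)) (ilM (il_Dinv R) (il_Dinv R)))) => // z _.
by rewrite /Gbase -[(Delta z ^+ 2)^-1]exprVn !expr2.
Qed.

Lemma G_constant_term m (a : nat -> int) (P : {poly int}) N c h :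
  il m a (fun z => Gbase z * (map_poly intr P).[j z]) -> lq N c h ->
  (forall z, 0 < complex.Im z -> h (- z^-1) = z ^+ 12 * h z) ->
  conv (fun k => (a k)%:~R) c (m + N) = 0.
Proof.
move=> ha hc hh; apply: (constant_term_weight2 (lqM ha hc)) => z y0.
have z0 : z != 0 by apply: contraTneq y0 => ->; rewrite ltxx.
have D0 := Delta_neq0 y0.
rewrite hh // /Gbase (weight_S (@E4_modular R) y0) (weight_S (@E6_modular R) y0).
rewrite (weight_S (@Delta_modular R) y0) -moebS j_invariant //.
move: (map_poly _ _).[_] (h z) (E4 z) (E6 z) (Delta z) D0 => x y u v t t0.
by field; rewrite z0 t0.
Qed.

Definition poincT n : C -> C := hecke_sum (fun d => d%:R ^- 12) n (poinc 1).

Lemma lq_poincT n : (0 < n)%N ->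
  lq n (fun k => cst1 1 k + shq n (hecke_seq (fun d => d%:R ^- 12) n (pcoef R 1)) k) (poincT n).
Proof.
move=> n0; have hp z : 0 < complex.Im z -> poinc 1 z = 1 * (e z)^-1 + qv (pcoef R 1) z.
  move=> y0; have [_ h] := poinc_lq R 1; apply: (mulIf (e_neq0 z)).
  have q1 := @qs_pcoef R 1.
  have := h z y0; rewrite (qvD (@qs_cst1 _ _) (qs_sh 1 q1) y0) qv_cst1 (qv_sh 1 q1 y0) expr1 => ->.
  by rewrite mul1r mulrDl mulVf ?e_neq0 // mulrC.
apply: (lq_ext _ _ (lq_hecke (fun d => d%:R ^- 12) n0 (@qs_pcoef R 1) hp)) => // k.
by rewrite expr1n invr1 mulr1.
Qed.

Lemma poincT_S n z : (0 < n)%N -> 0 < complex.Im z -> poincT n (- z^-1) = z ^+ 12 * poincT n z.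
Proof. by move=> n0 y0; apply: hecke_sum_S => // a b c d w; exact: poinc_modular. Qed.

Lemma hecke_seq_poinc0 n : hecke_seq (fun d => d%:R ^- 12) n (pcoef R 1) 0 = 0.
Proof.
rewrite /hecke_seq big1 // => d _.
by rewrite /hecke_coef dvdn0 div0n muln0 pcoef0 mulr0.
Qed.

Lemma hecke_seq_poinc1 n : (0 < n)%N ->
  hecke_seq (fun d => d%:R ^- 12) n (pcoef R 1) 1 = pcoef R 1 n / n%:R ^+ 11.
Proof.
move=> n0; rewrite hecke_seq_gcd // gcdn1 (_ : divisors 1 = [:: 1%N]) // big_seq1 divn1 muln1.
have nC : (n%:R : C) != 0 by rewrite pnatr_eq0 -lt0n.
by move: (n%:R : C) nC (pcoef R 1 n) => x x0 p; field.
Qed.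

Section Expansion.
Variables (m : nat) (a : nat -> int) (P : {poly int}).
Hypotheses (m2 : (1 < m)%N) (ha : il m a (fun z : C => Gbase z * (map_poly intr P).[j z])).
Hypotheses (a0 : a 0%N = 1) (az : forall k, (0 < k < m.-1)%N -> a k = 0).

Let aC k : C := (a k)%:~R.
Let aC0 : aC 0 = 1. Proof. by rewrite /aC a0. Qed.
Let aCz k : (0 < k < m.-1)%N -> aC k = 0. Proof. by move=> hk; rewrite /aC az. Qed.

(** The constant term of G times Delta is [tau(m) + a_(m-1)]: Delta has no constant term, so [a m]
    does not enter. *)
Lemma G_coef_pred : a m.-1 = - tauZ m.
Proof.
have := G_constant_term ha (il_Delta R) (weight_S (@Delta_modular R)).
rewrite addn0 (conv_low2 _ m2 aC0 aCz) tauZ0 tauZ1 mulr0 addr0 mulr1 -rmorphD /=.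
by move/eqP; rewrite intr_eq0 addrC addr_eq0 => /eqP.
Qed.

(** The same with the Eisenstein series of weight 12, whose constant term [eisC R 11] brings in
    [a m]. *)
Lemma G_coef_eis : (sigma 11 m)%:R - (tauZ m)%:~R + aC m * eisC R 11 = 0.
Proof.
have m0 := ltnW m2.
have hphi (x b c d : int) (z : C) : x * d - b * c = 1 -> 0 < complex.Im z ->
    phi 11 (moeb x b c d z) = cxd c d z ^+ 12 * phi 11 z by move=> h y; exact: phi_modular.
have := G_constant_term ha (lq_phi 11) (weight_S hphi).
rewrite addn0 (conv_low2 _ m2 aC0 aCz) /aC G_coef_pred /sigz sig_gt0 // /cst1 gtn_eqF //=.
rewrite add0r addr0 add0r (_ : sig 11 1 = 1%N); last by rewrite /sig /sigma unlock.
by rewrite mulr1 rmorphN.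
Qed.

(** The polar term [q^-n] of the Hecke transform picks out [a (m + n)]; its constant term vanishes,
    and its coefficient at q meets the [- tau(m)] of [G_coef_pred]. *)
Lemma G_coef_pos n : (0 < n)%N -> aC (m + n) =
  (tauZ m)%:~R * (pcoef R 1 n / n%:R ^+ 11) - hecke_seq (fun d => d%:R ^- 12) n (pcoef R 1) m.
Proof.
move=> n0; have := G_constant_term ha (lq_poincT n0) (fun z => @poincT_S n z n0).
rewrite convDr conv_cst1r mul1r conv_shq (conv_low2 _ m2 aC0 aCz) hecke_seq_poinc0 hecke_seq_poinc1 //.
rewrite mulr0 addr0 /aC G_coef_pred rmorphN /=.
by move: (_ / _) => x /eqP; rewrite addr_eq0 => /eqP ->; ring.
Qed.

End Expansion.

(** Degree m - 2 leaves m - 1 coefficients to choose, exactly those from [q^-m] to [q^-2]; the one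
    at [q^-1] is forced. *)
Lemma G_exists m : (1 < m)%N -> exists P : {poly int},
  [/\ (size P <= m.-1)%N, P`_(m.-2) = 1 & exists a,
    [/\ il m a (fun z : C => Gbase z * (map_poly intr P).[j z]), a 0%N = 1
      & forall k, (0 < k < m.-1)%N -> a k = 0]].
Proof.
case: m => [|[|m]] // _; have [h hh h0] := il_Gbase.
have [P [sP PN [a ha ak]]] := poly_principal_part hh h0 m (fun k => (k == 0%N)%:Z).
exists P; split=> //; exists a; split; first by rewrite addn2 in ha.
  by rewrite ak.
by move=> k /andP[k0 km]; rewrite ak // gtn_eqF.
Qed.

(** For m = 2, the product with [E4 ^+ 3] gives [a 2 = - 196560 = - 3 * 65520], while [sigma_11(2) -
    tau(2) = 2049 + 24 = 3 * 691]; [G_coef_eis] relates the two. *)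
Lemma eisC11 : eisC R 11 * (65 * 10 ^+ 3 + 520) = 691.
Proof.
have [P [_ _ [a [ha a0 az]]]] := G_exists (isT : 1 < 2)%N.
have m2 : (1 < 2)%N by [].
have a1 := G_coef_pred m2 ha a0 az; rewrite /= tauZ2 opprK in a1.
have h11 := G_coef_eis m2 ha a0 az.
have mE43 (x b c d : int) z : x * d - b * c = 1 -> 0 < complex.Im z ->
    E4 (moeb x b c d z) ^+ 3 = cxd c d z ^+ 12 * E4 z ^+ 3.
  by move=> hd y0; rewrite E4_modular // exprMn -exprM.
have := G_constant_term ha (il_E43 R) (weight_S mE43).
rewrite addn0 conv2 a0 a1.
have -> : E43c 0 = 1 by rewrite /E43c !conv0.
have -> : E43c 1 = 3 * 240 by rewrite /E43c !conv1 !conv0 !E4_coefE /sigz !sig_val.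
have -> : E43c 2 = 3 * (240 * 9) + 3 * (240 * 240).
  have E0 : E4_coef 0 = 1 by [].
  have E1 : E4_coef 1 = 240 by rewrite E4_coefE /sigz !sig_val.
  have E2 : E4_coef 2 = 240 * 9 by rewrite E4_coefE /sigz !sig_val.
  by rewrite /E43c !conv2 !conv1 !conv0 E0 E1 E2; ring.
move: h11; rewrite tauZ2 (_ : (sigma 11 2)%:R = 2 ^+ 11 + 1); last first.
  by rewrite /sigma (_ : divisors 2 = [:: 1%N; 2%N]) // big_cons big_seq1 exp1n natrD natrX addrC.
rewrite !rmorphD !rmorphM /= rmorphN /=; move: ((a 2%N)%:~R : C) (eisC R 11) => x y h1 h2.
have hx : x = - (3 * (65 * 10 ^+ 3 + 520)).
  by apply/eqP; rewrite -subr_eq0; apply/eqP; rewrite -h2; ring.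
have n3 : (3 : C) != 0 by rewrite pnatr_eq0.
apply: (mulfI n3); rewrite hx in h1; apply/eqP; rewrite -subr_eq0; apply/eqP.
by rewrite -[RHS]oppr0 -h1; ring.
Qed.

Lemma eisC11_coef (x t s : C) : s - t + x * eisC R 11 = 0 ->
  x = (65 * 10 ^+ 3 + 520) * (t - s) / 691.
Proof.
move=> h; have n691 : (691 : C) != 0 by rewrite pnatr_eq0.
apply: (mulIf n691); rewrite mulfVK // -eisC11.
have -> : t - s = x * eisC R 11.
  by apply/esym/eqP; rewrite -subr_eq0; apply/eqP; rewrite -h; ring.
by ring.
Qed.

(** [24 * 2730 = 65520], so the constant term of [M_Delta] is [- 11!] times the inverse of
    [eisC R 11]. *)
Lemma B12_const : M_const R = - fac11 R * ((65 * 10 ^+ 3 + 520) / 691).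
Proof.
rewrite M_constE /B12; have n691 : (691 : C) != 0 by rewrite pnatr_eq0.
have n2730 : (2730 : C) != 0 by rewrite pnatr_eq0.
move: (fac11 R) => f; rewrite invrN invf_div.
have -> : (65 * 10 ^+ 3 + 520 : C) = 24 * 2730 by ring.
by ring.
Qed.

End Main.

Lemma shq_diag (V : nmodType) N (c : nat -> V) : shq N c N = c 0%N.
Proof. by rewrite /shq ltnn subnn. Qed.

Lemma shq_lt (V : nmodType) N (c : nat -> V) k : (k < N)%N -> shq N c k = 0.
Proof. by rewrite /shq => ->. Qed.

(** * Comparison with the mock modular form and with the [psi] polynomials *)

Section Assembly.
Variables (R : realType) (m : nat) (a : nat -> int) (P : {poly int}).
Local Notation C := R[i].
Opaque e.
Hypotheses (m2 : (1 < m)%N) (ha : il m a (fun z : C => Gbase z * (map_poly intr P).[j z])).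
Hypotheses (a0 : a 0%N = 1) (az : forall k, (0 < k < m.-1)%N -> a k = 0).

Let T : C := (tauZ m)%:~R.
Let X : C := 65 * 10 ^+ 3 + 520.
Let m0 : (0 < m)%N := ltnW m2.
Let am1 : a m.-1 = - tauZ m := G_coef_pred m2 ha a0 az.
Let am : (a m)%:~R = X * (T - (sigma 11 m)%:R) / 691 := eisC11_coef (G_coef_eis m2 ha a0 az).
Let n691 : (691 : C) != 0. Proof. by rewrite pnatr_eq0. Qed.

(** The shift by [m.-1] brings [M_Delta], with a pole of order 1, to the common pole order m. *)
Definition mock_coef k : C := (fac11 R)^-1 * (cst1 (fac11 R) k +
  shq m (hecke_seq (fun d => d%:R ^+ 10) m (M_coef R)) k +
  - T * shq m.-1 (fun k => cst1 (fac11 R) k + shq 1 (M_coef R) k) k).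

(** Below [m - 1] only the leading 1 occurs; at [m - 1] and [m] the values are those of
    [G_coef_pred] and [G_coef_eis], the latter through the constant term of [M_Delta]; above [m],
    [hecke_M_seq] turns [G_coef_pos] into Hecke coefficients of [M_Delta]. *)
Lemma mock_coefE k : mock_coef k = (a k)%:~R.
Proof.
have f0 : fac11 R != 0 by rewrite fac11E pnatr_eq0 -lt0n fact_gt0.
rewrite /mock_coef; have [km|mk] := ltnP k m.-1.
  have km' : (k < m)%N by lia.
  rewrite !shq_lt // mulr0 !addr0 /cst1; case: eqP => [->|/eqP k0]; first by rewrite mulVf // a0.
  by rewrite mulr0 az // lt0n k0.
case: (ltngtP k m) => [km|km|->].
- have -> : k = m.-1 by lia.
  rewrite am1 shq_diag !shq_lt ?prednK // /cst1 eqxx gtn_eqF; last by lia.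
  by rewrite !addr0 add0r mulrCA mulVf // mulr1 rmorphN.
- have [n n0 ->] : exists2 n, (0 < n)%N & k = (m + n)%N by exists (k - m)%N; lia.
  rewrite (G_coef_pos m2 ha a0 az n0) shq_addl hecke_M_seq //.
  rewrite (_ : (m + n = m.-1 + (1 + n))%N); last by lia.
  rewrite !shq_addl /cst1 !gtn_eqF; [|lia|lia].
  rewrite !add0r M_coef_gt0 // -/T; move: (hecke_seq _ _ _ _) (pcoef _ _ _ / _) T (fac11 R) f0 => x y t f f0.
  by field.
rewrite am shq_diag hecke_M_seq0.
rewrite [X in shq m.-1 _ X](_ : _ = m.-1 + (1 + 0))%N; last by lia.
rewrite !shq_addl M_coef0 B12_const -/X /cst1 !gtn_eqF // !add0r.
move: ((sigma 11 m)%:R) T (fac11 R) f0 X (691 : C) n691 => s t f f0 x y y0'.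
by field; rewrite f0 y0'.
Qed.

Lemma G_mock (z : C) : 0 < complex.Im z -> Gbase z * (map_poly intr P).[j z] =
  (fac11 R)^-1 * (m%:R ^+ 11 * hecke (-10) m (@M_Delta R) z - T * M_Delta z).
Proof.
move=> y0; have hM := lq_sh m.-1 (lq_M_Delta R); rewrite addn1 prednK // in hM.
have [_ h1] := lqZ (fac11 R)^-1 (lqD (lq_hecke_M R m0) (lqZ (- T) hM)); have [_ h2] := ha.
apply: (mulIf (expf_neq0 m (e_neq0 z))); rewrite h2 // -mulNr h1 //.
by congr (qv _ z); apply/funext => k; rewrite -mock_coefE.
Qed.

Definition Fpoly : {poly int} := 'X * ('X - 1728%:P) * P.

Lemma Fpoly_j (z : C) : 0 < complex.Im z ->
  (map_poly intr Fpoly).[j z] = E4 z * E6 z * (Gbase z * (map_poly intr P).[j z]).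
Proof.
move=> y0; have D0 := Delta_neq0 y0.
rewrite /Fpoly !rmorphM /= rmorphB /= map_polyX map_polyC /= !hornerM hornerD hornerN hornerX hornerC.
rewrite -[1728%:~R]/(1728%:R : C); move: (map_poly _ _).[_] => x; rewrite /Gbase /j.
have n1728 : (1728 : C) != 0 by rewrite pnatr_eq0.
have : Delta z * 1728 = E4 z ^+ 3 - E6 z ^+ 2 by rewrite /Delta mulfVK.
move: (1728 : C) (Delta z) D0 (E4 z) (E6 z) => y t t0 u v hD.
have -> : u ^+ 3 / t - y = v ^+ 2 / t.
  have -> : u ^+ 3 = t * y + v ^+ 2 by rewrite hD subrK.
  by field.
by field.
Qed.

Lemma psi_shifted l : (l < m)%N -> exists2 al : nat -> C,
  lq m al (fun z => (psi R (m - l)).[j z]) & forall k, (k <= m)%N -> al k = (k == l)%:R.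
Proof.
move=> lm; have ml : (0 < m - l)%N by rewrite subn_gt0.
have [b hb bk] := psi_principal R ml; exists (shq l (fun k => (b k)%:~R)).
  by have := lq_sh l hb; rewrite subnKC // ltnW.
move=> k km; rewrite /shq; case: ltnP => lk; first by rewrite ltn_eqF.
by rewrite bk ?leq_sub2r // subn_eq0 eqn_leq lk andbT; case: (k <= l)%N.
Qed.

Lemma sum_indicator (F : nat -> C) x y k :
  \sum_(x <= l < y) F l * (k == l)%:R = if (x <= k < y)%N then F k else 0.
Proof.
case: ifP => hk.
  rewrite (bigD1_seq k) ?mem_index_iota ?iota_uniq //= eqxx mulr1 big1 ?addr0 // => l.
  by rewrite eq_sym => /negbTE ->; rewrite mulr0.
rewrite big_nat big1 // => l hl; case: eqP => [kl|_]; last by rewrite mulr0.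
by rewrite kl hl in hk.
Qed.

(** By [polyj_principal] it suffices to compare the coefficients from [q^-m] to [q^0]. There each
    [psi R (m - l)] contributes the single term [q^(l - m)], while the left side is G times the
    series of [E4 E6] with coefficients [- 264 sigma_9]. *)
Lemma Fpoly_psi : map_poly intr Fpoly =
  psi R m + ((247 * 10 ^+ 3 + 944) * T / 691)%:P - (X * (sigma 11 m)%:R / 691)%:P
  - (264 * (sigma 9 m)%:R)%:P
  - 264 *: \sum_(1 <= l < m.-1) (sigma 9 l)%:R *: psi R (m - l)
  - (T + 264 * (sigma 9 m.-1)%:R) *: psi R 1.
Proof.
have hF : lq m (conv (fun k => (a k)%:~R) (fun k => (conv E4_coef E6_coef k)%:~R))
    (fun z : C => (map_poly intr Fpoly).[j z]).
  have hE : lq 0 (fun n => (conv E4_coef E6_coef n)%:~R) (fun z : C => E4 z * E6 z) :=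
    ilM (il_E4 R) (il_E6 R).
  have h := lqM ha hE; rewrite addn0 in h; apply: (lq_ext _ _ h) => // z y0.
  by rewrite Fpoly_j // mulrC.
have /choice [al hal] : forall l, exists al : nat -> C, (l < m)%N ->
    lq m al (fun z => (psi R (m - l)).[j z]) /\ forall k, (k <= m)%N -> al k = (k == l)%:R.
  move=> l; case: (ltnP l m) => lm; last by exists (fun=> 0).
  by have [b h1 h2] := psi_shifted lm; exists b.
pose A : C := (247 * 10 ^+ 3 + 944) * T / 691 - X * (sigma 11 m)%:R / 691 - 264 * (sigma 9 m)%:R.
have hS : lq m (fun k => \sum_(1 <= l < m.-1) (sigma 9 l)%:R * al l k)
    (fun z => \sum_(1 <= l < m.-1) (sigma 9 l)%:R * (psi R (m - l)).[j z]).
  by apply: lq_sum_nat => l /andP[_ lm]; apply: lqZ; apply: (hal l _).1; lia.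
have hA := lq_sh m (lq_cst A); rewrite addn0 in hA.
have [h0 al0] := hal 0%N m0; have pm : (m.-1 < m)%N by lia.
have [h1 al1] := hal _ pm; rewrite subn0 in h0; rewrite (_ : m - m.-1 = 1)%N in h1; last by lia.
have hR := lqD (lqD (lqD h0 hA) (lqZ (- 264) hS)) (lqZ (- (T + 264 * (sigma 9 m.-1)%:R)) h1).
apply: (polyj_principal hF).
  apply: (lq_ext _ _ hR) => [k|z _]; first exact: erefl.
  rewrite !(hornerD, hornerN, hornerZ, hornerC, horner_sum) /A.
  under [in RHS]eq_bigr do rewrite hornerZ.
  by move: (\sum_(_ <= _ < _) _) => s; ring.
move=> k km; rewrite /= al0 // al1 //.
have -> : \sum_(1 <= l < m.-1) (sigma 9 l)%:R * al l k =
    if (0 < k < m.-1)%N then (sigma 9 k)%:R else 0 :> C.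
  rewrite -(sum_indicator (fun l => (sigma 9 l)%:R)); apply: eq_big_nat => l /andP[_ lm].
  by rewrite (hal l _).2 //; lia.
have aC0 : (a 0%N)%:~R = 1 :> C by rewrite a0.
have [kl|kl] := ltnP k m.-1.
  rewrite conv_low //; last by move=> t ht; rewrite az //; lia.
  rewrite E4E6_coef /shq (_ : k < m)%N; last by lia.
  rewrite (ltn_eqF kl) andbT mulr0 !addr0 /cst1; case: (posnP k) => [->|k0].
    by rewrite /sig /= !mulr0 subr0 addr0.
  by rewrite sig_gt0 //= !add0r mulNr.
(* At [q^-1] the product has [- 264 sigma_9(m - 1)] from [E4 E6] and [- tau(m)] from G. *)
have [km1|km1] := eqVneq k m.-1.
  rewrite km1 conv_low1 //; [|lia|by move=> t ht; rewrite az].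
  rewrite !E4E6_coef am1 rmorphN /= -/T shq_lt // andbF /cst1 eqxx.
  rewrite gtn_eqF; last by lia.
  by rewrite sig_gt0; [rewrite /sig /=; ring | lia].
(* The constant term is [- 264 sigma_9(m) + 264 tau(m) + 65520 (tau(m) - sigma_11(m)) / 691], and
   [264 * 691 + 65520 = 247944]. *)
have -> : k = m by lia.
rewrite conv_low2 //; last by move=> t ht; rewrite az.
rewrite !E4E6_coef am1 am rmorphN /= -/T shq_diag /cst1 eqxx andbF gtn_eqF // sig_gt0 // (_ : sig 9 1 = 1%N); last by rewrite /sig /sigma unlock.
rewrite (_ : sig 9 0 = 0%N) // /A /X; move: T ((sigma 11 m)%:R) ((sigma 9 m)%:R) => t s r.
rewrite (_ : (1%N == 0%N) = false) // (_ : false%:R = 0) //; move: (sigma 9 m.-1)%:R => r'.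
by field.
Qed.

End Assembly.

Lemma Fpoly_monic (P : {poly int}) n : (size P <= n.+1)%N -> P`_n = 1 ->
  (Fpoly P \is monic) * (size (Fpoly P) = n.+3).
Proof.
move=> sP PN; have h : (n < size P)%N.
  by rewrite ltnNge; apply/negP => h; move: PN; rewrite nth_default.
have sE : size P = n.+1 by apply/eqP; rewrite eqn_leq sP.
have Pm : P \is monic by apply/monicP; rewrite lead_coefE sE.
have Qm : ('X * ('X - 1728%:P) : {poly int}) \is monic by rewrite monicMl ?monicX ?monicXsubC.
split; first by rewrite /Fpoly monicMl.
rewrite /Fpoly size_Mmonic ?monic_neq0 // sE mulrC size_mulX ?polyXsubC_eq0 // size_XsubC.
by rewrite addSn.
Qed.

(* The literals 247944 and 65520 are written in base 1000 because mathcomp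
   parses numerals as unary naturals, which overflows the stack at this size. *)
Theorem theorem1p2 (R : realType) (m : nat) (hm : (2 <= m)%N) :
  exists F : {poly int},
    [/\ F \is monic,
        size F = m.+1,
        forall z : R[i], upper_half_plane z ->
          (map_poly intr F).[j z] =
            E4 z * E6 z / 11`!%:R
            * (m%:R ^+ 11 * hecke (-10) m (@M_Delta R) z
               - ratr (ramanujan_tau m) * M_Delta z)
      & map_poly intr F =
          psi R m
          + ((247 * 10 ^+ 3 + 944) * ratr (ramanujan_tau m) / 691)%:P
          - ((65 * 10 ^+ 3 + 520) * (sigma 11 m)%:R / 691)%:P
          - (264 * (sigma 9 m)%:R)%:P
          - 264 *: \sum_(1 <= l < m.-1) (sigma 9 l)%:R *: psi R (m - l)
          - (ratr (ramanujan_tau m) + 264 * (sigma 9 m.-1)%:R) *: psi R 1].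
Proof.
have [P [sP PN [a [ha a0 az]]]] := G_exists R hm.
have sP' : (size P <= m.-2.+1)%N by apply: (leq_trans sP); lia.
have [Fm Fs] := Fpoly_monic sP' PN.
have tE : ratr (ramanujan_tau m) = (tauZ m)%:~R :> R[i] by rewrite ramanujan_tauE ratr_int.
exists (Fpoly P); split=> //; first by rewrite Fs; lia.
- move=> z y0; rewrite tE -fac11E; apply: (etrans (Fpoly_j P y0)).
  by apply: (etrans (congr1 _ (G_mock hm ha a0 az y0))); rewrite mulrA.
- by rewrite tE; exact: (Fpoly_psi hm ha a0 az).
Qed.
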